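(* Let $G$ be a (finite, simple) plane graph with minimum degree five. Then $G$ contains at least one of the following minor $5$-stars: $\langle 5,7,7,5,17\rangle$, $\langle 5,7,8,5,11\rangle$, $\langle 5,7,5,8,8\rangle$, $\langle 8,5,5,11,6\rangle$, $\langle 8,5,5,8,7\rangle$, $\langle 8,5,5,7,8\rangle$, $\langle 8,5,5,6,9\rangle$, $\langle 5,6,5,8,11\rangle$, $\langle 5,6,6,5,\infty\rangle$, $\langle 5,6,6,6,17\rangle$, $\langle 6,6,6,6,11\rangle$, $\langle 6,6,6,7,8\rangle$, $\langle 6,6,7,6,8\rangle$, $\langle 5,6,6,11,7\rangle$, $\langle 5,6,11,6,7\rangle$, $\langle 5,6,6,8,8\rangle$, $\langle 5,6,8,6,8\rangle$, $\langle 5,7,6,8,7\rangle$, $\langle 5,6,7,7,7\rangle$, $\langle 5,6,6,7,11\rangle$, $\langle 5,6,7,6,11\rangle$, $\langle 5,7,6,7,8\rangle$, $\langle 5,7,7,6,8\rangle$, $\langle 5,7,6,6,14\rangle$, $\langle 5,8,6,6,11\rangle$, $\langle 5,5,7,6,14\rangle$, $\langle 5,6,7,5,35\rangle$, $\langle 5,6,8,5,15\rangle$, $\langle 5,6,9,5,10\rangle$, $\langle 5,6,11,5,9\rangle$, $\langle 5,5,10,5,12\rangle$, $\langle 5,7,11,5,8\rangle$, $\langle 5,6,5,7,14\rangle$, $\langle 5,5,9,5,17\rangle$.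
   Context: A plane graph is a graph embedded in the plane without edge crossings; $\deg(v)$ denotes the degree of $v$ in $G$. For integers (or $\infty$) $\kappa_1,\dots,\kappa_5$, a $\langle \kappa_1,\kappa_2,\kappa_3,\kappa_4,\kappa_5\rangle$-star in $G$ is a vertex $v$ of degree exactly $5$ together with its five neighbors $v_1,\dots,v_5$, listed in the cyclic order around $v$ given by the embedding (starting at some neighbor, in either orientation), such that $\deg(v_i)\le \kappa_i$ for $i=1,\dots,5$; the entry $\infty$ means no restriction. A star is called minor if its center has degree at most five; a minor $5$-star is thus a $5$-vertex together with its five neighbors. *)

(* Defs.v *)
From HB Require Import structures.
From mathcomp Require Export all_boot all_order all_algebra.
From mathcomp Require Export all_classical all_reals all_analysis.

Set Implicit Arguments.
Unset Strict Implicit.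
Unset Printing Implicit Defensive.
Import Order.TTheory GRing.Theory Num.Theory.
Import numFieldNormedType.Exports.

Local Open Scope classical_set_scope.
Local Open Scope ring_scope.

Record sgraph := SGraph {
  vertex :> finType;
  adj : rel vertex;
  adj_sym : symmetric adj;
  adj_irrefl : irreflexive adj }.

Definition degree (G : sgraph) (v : G) : nat := #|[set w : G | adj v w]%SET|.

(* The minimum is attained, so the graph is in particular nonempty. *)
Definition has_min_degree (G : sgraph) (d : nat) : Prop :=
  (forall v : G, (d <= degree v)%N) /\ (exists v : G, degree v = d).

(* [arc u v], restricted to [0, 1], draws the edge uv from u to v, and [arc v u]
   is the same arc traversed backwards.  The values of [arc] on nonadjacent
   pairs and outside [0, 1] are irrelevant. *)
Record plane_embedding (R : realType) (G : sgraph) := PlaneEmbedding {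
  pos : G -> R * R;
  arc : G -> G -> R -> R * R;
  pos_inj : injective pos;
  arc_continuous : forall u v : G, adj u v ->
    {within `[0%R, 1%R], continuous (arc u v)};
  arc_inj : forall u v : G, adj u v -> forall s t : R,
    0 <= s <= 1 -> 0 <= t <= 1 -> arc u v s = arc u v t -> s = t;
  arc_start : forall u v : G, adj u v -> arc u v 0 = pos u;
  arc_end : forall u v : G, adj u v -> arc u v 1 = pos v;
  arc_rev : forall u v : G, adj u v -> forall t : R,
    0 <= t <= 1 -> arc v u t = arc u v (1 - t);
  arc_avoids_vertices : forall u v w : G, adj u v -> forall t : R,
    0 < t < 1 -> arc u v t <> pos w;
  arc_no_crossing : forall u v x y : G, adj u v -> adj x y -> forall s t : R,
    0 < s < 1 -> 0 < t < 1 -> arc u v s = arc x y t ->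
    (u = x /\ v = y) \/ (u = y /\ v = x) }.

Definition eucl_dist (R : realType) (p q : R * R) : R :=
  Num.sqrt ((p.1 - q.1) ^+ 2 + (p.2 - q.2) ^+ 2).

Definition circle_point (R : realType) (c : R * R) (r theta : R) : R * R :=
  (c.1 + r * cos theta, c.2 + r * sin theta).

(* The curve g on [0, 1] leaves the closed disc of center c and radius r for
   the last time at the point of its boundary in direction theta. *)
Definition leaves_disc (R : realType) (g : R -> R * R) (c : R * R)
    (r theta : R) : Prop :=
  exists2 t : R, 0 < t < 1 &
    g t = circle_point c r theta /\
    (forall s : R, t < s <= 1 -> r < eucl_dist (g s) c).

(* The sequence s lists all the neighbors of v, each once, in counterclockwise
   cyclic order.  The arcs are merely continuous and may have no tangent at v
   and meet a circle around v many times; so the order is read off from the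
   points where they finally leave a disc around v.  For all small enough
   radii these points come in the same cyclic order, that of the embedding.
   The starting neighbor is arbitrary, as theta 0 is any real. *)
Definition ccw_neighbors (R : realType) (G : sgraph)
    (E : plane_embedding R G) (v : G) (s : seq G) : Prop :=
  [/\ uniq s,
      (forall w : G, (w \in s) = adj v w) &
      \forall r \near (0 : R)^'+, exists theta : nat -> R,
        [/\ (forall i j : nat, (i < j < size s)%N -> theta i < theta j),
            (forall i : nat, (i < size s)%N -> theta i < theta 0%N + 2 * pi) &
            (forall i : nat, (i < size s)%N ->
               leaves_disc (arc E v (nth v s i)) (pos E v) r (theta i))]].

Definition cyclic_neighbors (R : realType) (G : sgraph)
    (E : plane_embedding R G) (v : G) (s : seq G) : Prop :=
  ccw_neighbors E v s \/ ccw_neighbors E v (rev s).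

Inductive degree_bound := Bound of nat | Unbounded.

Coercion Bound : nat >-> degree_bound.

Definition at_most (d : nat) (k : degree_bound) : Prop :=
  if k is Bound m then (d <= m)%N else True.

Definition has_minor_star (R : realType) (G : sgraph) (E : plane_embedding R G)
    (k1 k2 k3 k4 k5 : degree_bound) : Prop :=
  exists v v1 v2 v3 v4 v5 : G,
    [/\ degree v = 5%N,
        cyclic_neighbors E v [:: v1; v2; v3; v4; v5] &
        [/\ at_most (degree v1) k1, at_most (degree v2) k2,
            at_most (degree v3) k3, at_most (degree v4) k4 &
            at_most (degree v5) k5]].

(* Main.v *)
(* The arcs are merely continuous, so planarity is used through winding numbers.
   Cut at a small radius, the drawing consists of disjoint cores of arcs, and the
   places where they leave the discs give a rotation n on the darts; e reverses
   darts.  If Euler's inequality E + V + F > 2 E failed, some nonzero z on the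
   darts would sum to 0 over every orbit of e, of n and of the face permutation.
   The z-weighted windings of the arcs around the vertices then yield a function c
   on the darts which is constant along faces and has c d - c (e d) = 2 pi z d;
   multiplying by z and summing forces sum z^2 = 0.  The same technique, applied
   in the annulus between two radii, shows that the cyclic order of the exits is
   the same for all small radii.

   Chords turn the map into a triangulation.  They never lower a degree and end at
   no 5-vertex of the result, so a star found there is a star of the original map.
   In a triangulation the charges deg x - 6 have negative sum.  Vertices of degree
   at least 7 pay their 5-neighbours, and some 5-vertices pass charge on to
   one another; without any of the listed stars every final charge would be
   nonnegative.  For 5-vertices this is a finite check.  For most donors it is a
   bound per neighbour; in degrees 7, 11, 13 and 14 the payments depend on vertices
   at distance two, and the total is the weight of a closed walk in a finite graph,
   bounded by dynamic programming. *)
From Stdlib Require Import BinNat Lia.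
Require Import Defs.
From mathcomp Require Import all_boot all_fingroup all_reals.
From mathcomp Require Import ring lra zify.
(* [path.arc] would otherwise hide the field [arc]. *)
Import Defs.

Set Implicit Arguments.
Unset Strict Implicit.
Unset Printing Implicit Defensive.
Local Open Scope N_scope.

(** * Stars and charges *)

(* Rounds a degree up to one that the stars can tell apart; 36 stands for an
   unbounded entry. *)
Definition ru (d : nat) : N :=
  if (d <= 5)%N then 5 else if (d <= 15)%N then N.of_nat d
  else if (d <= 17)%N then 17 else if (d <= 35)%N then 35 else 36.

Definition tops : seq N := [:: 5; 6; 7; 8; 9; 10; 11; 12; 13; 14; 15; 17; 35; 36].

Definition stars : seq (seq N) := [::
  [:: 5; 7; 7; 5; 17]; [:: 5; 7; 8; 5; 11]; [:: 5; 7; 5; 8; 8]; [:: 8; 5; 5; 11; 6];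
  [:: 8; 5; 5; 8; 7]; [:: 8; 5; 5; 7; 8]; [:: 8; 5; 5; 6; 9]; [:: 5; 6; 5; 8; 11];
  [:: 5; 6; 6; 5; 36]; [:: 5; 6; 6; 6; 17]; [:: 6; 6; 6; 6; 11]; [:: 6; 6; 6; 7; 8];
  [:: 6; 6; 7; 6; 8]; [:: 5; 6; 6; 11; 7]; [:: 5; 6; 11; 6; 7]; [:: 5; 6; 6; 8; 8];
  [:: 5; 6; 8; 6; 8]; [:: 5; 7; 6; 8; 7]; [:: 5; 6; 7; 7; 7]; [:: 5; 6; 6; 7; 11];
  [:: 5; 6; 7; 6; 11]; [:: 5; 7; 6; 7; 8]; [:: 5; 7; 7; 6; 8]; [:: 5; 7; 6; 6; 14];
  [:: 5; 8; 6; 6; 11]; [:: 5; 5; 7; 6; 14]; [:: 5; 6; 7; 5; 35]; [:: 5; 6; 8; 5; 15];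
  [:: 5; 6; 9; 5; 10]; [:: 5; 6; 11; 5; 9]; [:: 5; 5; 10; 5; 12]; [:: 5; 7; 11; 5; 8];
  [:: 5; 6; 5; 7; 14]; [:: 5; 5; 9; 5; 17]].

Definition dihedral (s : seq N) : seq (seq N) :=
  [seq rot i s | i <- iota 0 5] ++ [seq rev (rot i s) | i <- iota 0 5].

Definition all_stars : seq (seq N) := flatten (map dihedral stars).

Definition covered (s : seq N) : bool := has (fun t => all2 N.leb s t) all_stars.

Definition rate (k : N) : N :=
  if k <=? 8 then 210 else if k <=? 9 then 280 else if k <=? 10 then 336
  else if k <=? 14 then 420 else if k <=? 15 then 504 else if k <=? 17 then 525
  else if k <=? 35 then 560 else 700.

(* 840 times what a vertex of degree k gives to a 5-neighbour y; the star of y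
   reads k, b, d, c, a in cyclic order, and b5, a5 tell whether b, a are 5. *)
Definition pay (k : N) (b5 : bool) (d c : N) (a5 : bool) : N :=
  if k <=? 6 then 0
  else if k =? 7 then
    if b5 && a5 then
      if (d =? 5) || (c =? 5) then 140
      else if (36 <=? d) || (36 <=? c) then 0 else 120
    else if b5 || a5 then 140 else 280
  else if k =? 11 then
    if b5 && a5 then
      if (9 <=? d) && (9 <=? c) then 0
      else if (8 <=? d) && (8 <=? c) then 210
      else if (d =? 10) || (c =? 10) then 336 else 420
    else if b5 || a5 then
      let v := if a5 then c else d in
      if (v =? 8) || (v =? 10) then 504 else 420
    else 756
  else if (k =? 13) && b5 && a5 && (10 <=? d) && (10 <=? c) then 0
  else if (k =? 13) && a5 && ~~ b5 && (c =? 5) && (13 <=? d) then 546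
  else if (k =? 13) && b5 && ~~ a5 && (d =? 5) && (13 <=? c) then 546
  else if b5 && a5 then rate k
  else if b5 || a5 then N.div2 (rate k * 3) else rate k * 2.

Definition pay5 (s0 s1 s2 s3 s4 : N) : N := pay s0 (s1 =? 5) s2 s3 (s4 =? 5).

(* The uncovered stars 18+,5,8,5,5 and 13/14,5,10,5,5 lack 70 and 84. *)
Definition inc (s0 s1 s2 s3 s4 : N) : N :=
  if (s1 =? 5) && (s4 =? 5) then
    if (s3 =? 5) && (18 <=? s0) && (s2 =? 8) then 70
    else if (s3 =? 5) && ((s0 =? 13) || (s0 =? 14)) && (s2 =? 10) then 84
    else 0
  else 0.

Definition incs (s0 s1 s2 s3 s4 : N) : N := inc s0 s1 s2 s3 s4 + inc s0 s4 s3 s2 s1.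

(* An upper bound for what a 5-vertex passes on to its neighbour s0. *)
Definition give (s0 s1 s2 s3 s4 : N) : N :=
  if (s0 =? 5) && (s1 =? 5) then
    if (s4 =? 8) && ~~ (18 <=? s2) then 70
    else if (s4 =? 10) && ~~ (13 <=? s2) then 84
    else if (18 <=? s4) && (18 <=? s2) then 70 else 0
  else 0.

Definition gives (s0 s1 s2 s3 s4 : N) : N :=
  N.max (give s0 s1 s2 s3 s4) (give s0 s4 s3 s2 s1).

Definition cyclic_sum (F : N -> N -> N -> N -> N -> N) (s0 s1 s2 s3 s4 : N) : N :=
  F s0 s1 s2 s3 s4 + F s1 s2 s3 s4 s0 + F s2 s3 s4 s0 s1 + F s3 s4 s0 s1 s2 + F s4 s0 s1 s2 s3.

Definition balanced (s0 s1 s2 s3 s4 : N) : bool :=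
  840 + cyclic_sum gives s0 s1 s2 s3 s4 <=?
  cyclic_sum pay5 s0 s1 s2 s3 s4 + cyclic_sum incs s0 s1 s2 s3 s4.

Definition pay_min (k : N) (b5 a5 : bool) : N :=
  if k <=? 6 then 0
  else if (k =? 7) || (k =? 11) || (k =? 13) then
    if b5 && a5 then 0 else if b5 || a5 then (if k =? 7 then 140 else if k =? 11 then 420 else 546)
    else (if k =? 7 then 280 else if k =? 11 then 756 else 840)
  else if b5 && a5 then rate k
  else if b5 || a5 then N.div2 (rate k * 3) else rate k * 2.

Definition fitting (j : nat) (d : N) (l : seq (seq N)) : seq (seq N) :=
  [seq t <- l | d <=? nth 0 t j].

Definition upto (m : N) := [seq d <- tops | d <=? m].

(* A 5-vertex gives at most 84 to each neighbour, so receiving 1260 = 840 + 5 * 84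
   suffices; this prunes the search, which starts at a neighbour p1 of largest
   degree. *)
Definition star_check : bool :=
  all (fun p1 => let l1 := fitting 1 p1 all_stars in
  let U := upto p1 in
  all (fun p0 => let l0 := fitting 0 p0 l1 in
  all (fun p2 => let l2 := fitting 2 p2 l0 in
    let m1 := pay_min p1 (p2 =? 5) (p0 =? 5) in
    (1260 <=? m1) ||
  all (fun p3 => let l3 := fitting 3 p3 l2 in
    let m2 := m1 + pay_min p2 (p3 =? 5) (p1 =? 5) in
    (1260 <=? m2) ||
  all (fun p4 =>
    let m3 := m2 + pay_min p3 (p4 =? 5) (p2 =? 5) in
    (1260 <=? m3) || (0 < size (fitting 4 p4 l3))%N || balanced p0 p1 p2 p3 p4)
  U) U) U) U) tops.

Lemma star_checkP : star_check. Proof. by vm_compute. Qed.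

(* A circle of neighbours is read as a closed walk of length k whose states
   record the last two neighbours y0, y1 (5, or 36 for anything else), the
   labels v0, v1 behind the edges y0y1 and y1y2, and whether the label before
   v0 is at least 13. *)
Definition state : Type := N * N * N * N * bool.

Section Walks.
Variables (k : N) (ex : bool) (L : seq N).

Definition canon (y0 v0 y1 v1 : N) (f : bool) : state :=
  if y1 =? 5 then if y0 =? 5 then (5, v0, 5, v1, f) else (36, v0, 5, v1, false)
  else (36, 36, 36, v1, false).

Definition extra (y0 v0 v1 y2 v2 : N) (f : bool) : N :=
  if [&& ex, y0 =? 5 & y2 =? 5] then
    if [&& 10 <=? v0, v0 <=? 12, v1 =? 5 & 13 <=? v2] then 84
    else if [&& v0 =? 5, 10 <=? v1, v1 <=? 12 & f] then 84 else 0
  else 0.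

Definition succs (p : state) : seq (state * N) :=
  let: (y0, v0, y1, v1, f) := p in
  flatten [seq if (y1 =? 5) && covered [:: k; y0; v0; v1; y2] then [::] else
    [seq (canon y1 v1 y2 v2 (ex && (13 <=? v0)),
      if y1 =? 5 then pay k (y0 =? 5) v0 v1 (y2 =? 5) + extra y0 v0 v1 y2 v2 f else 0)
      | v2 <- L] | y2 <- [:: 5; 36]].

Definition states : seq state :=
  undup [seq canon p.1.1.1 p.1.1.2 p.1.2 p.2.1 p.2.2 |
    p <- [seq (a, b) | a <- [seq (a, b) | a <- [seq (a, b) | a <- [:: 5; 36], b <- L],
                                   b <- [:: 5; 36]],
               b <- [seq (a, b) | a <- L, b <- [:: true; false]]]].

Definition preds : seq (seq (nat * N)) :=
  let arcs := flatten [seq [seq (i, qw.1, qw.2) | qw <- succs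
    (nth (36, 36, 36, 36, false) states i)]
                 | i <- iota 0 (size states)] in
  [seq [seq (a.1.1, a.2) | a <- arcs & a.1.2 == q] | q <- states].

(* entry 0 means unreachable, entry v + 1 means best value v *)
Definition relax (pr : seq (seq (nat * N))) (cur : seq N) : seq N :=
  [seq foldr (fun a m => let v := nth 0 cur a.1 in
               if v =? 0 then m else N.max m (v + a.2)) 0 l | l <- pr].

Definition walk_check (n : nat) (B : N) : bool :=
  let pr := preds in let m := size states in
  all (fun i => nth 0 (iter n (relax pr) (set_nth 0 (nseq m 0) i 1)) i <=? B + 1)
    (iota 0 m).

End Walks.

Lemma walk_check7 : walk_check 7 false [:: 5; 35; 36] 7 840.
Proof. by vm_compute. Qed.
Lemma walk_check11 : walk_check 11 false [:: 7; 8; 9; 10; 36] 11 4200.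
Proof. by vm_compute. Qed.
Lemma walk_check13 : walk_check 13 true [:: 5; 9; 12; 36] 13 5880.
Proof. by vm_compute. Qed.
Lemma walk_check14 : walk_check 14 true [:: 5; 9; 12; 36] 14 6720.
Proof. by vm_compute. Qed.

Section WalkSound.
Variables (k : N) (ex : bool) (L : seq N) (n : nat) (B : N).
Variables (s : nat -> state) (w : nat -> N).
Hypothesis check : walk_check k ex L n B.
Hypothesis s_st : forall i, s i \in states L.
Hypothesis s_step : forall i, (i < n)%N -> (s i.+1, w i) \in succs k ex L (s i).
Hypothesis s_loop : s n = s 0%N.

Lemma pred_mem i : (i < n)%N ->
  (index (s i) (states L), w i) \in nth [::] (preds k ex L) (index (s i.+1) (states L)).
Proof.
move=> hi; have h1 : (index (s i.+1) (states L) < size (states L))%N by rewrite index_mem.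
rewrite /preds (nth_map (s 0%N)) // nth_index //.
apply/mapP; exists (index (s i) (states L), s i.+1, w i) => //.
rewrite mem_filter /= eqxx /=; apply/flattenP.
exists [seq (index (s i) (states L), qw.1, qw.2) | qw <- succs k ex L (s i)].
  apply/mapP; exists (index (s i) (states L)).
    by rewrite mem_iota index_mem s_st.
  by rewrite nth_index.
by apply/mapP; exists (s i.+1, w i) => //; apply: s_step.
Qed.

Lemma relax_ge pr cur q i w' : (q < size pr)%N -> (i, w') \in nth [::] pr q ->
  nth 0 cur i <> 0 -> nth 0 cur i + w' <= nth 0 (relax pr cur) q.
Proof.
move=> hq; rewrite /relax (nth_map [::]) //; elim: (nth [::] pr q) => //= a l IH.
rewrite inE => /orP[/eqP <- /= c0|/IH h /h{h} h].
  by case: N.eqb_spec => //; lia.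
by case: N.eqb_spec => //; lia.
Qed.

Lemma walk_sound : (\sum_(i < n) N.to_nat (w i) <= N.to_nat B)%N.
Proof.
set m := size (states L); set i0 := index (s 0%N) (states L).
set T := fun j => iter j (relax (preds k ex L)) (set_nth 0 (nseq m 0) i0 1).
have szp : size (preds k ex L) = m by rewrite size_map.
have hi0 : (i0 < m)%N by rewrite index_mem.
have key j : (j <= n)%N ->
   ((\sum_(i < j) N.to_nat (w i)).+1 <= N.to_nat (nth N0 (T j) (index (s j) (states L))))%N.
  elim: j => [|j IH] jn; first by rewrite big_ord0 /T /= nth_set_nth /= eqxx.
  rewrite big_ord_recr /=.
  have := @relax_ge (preds k ex L) (T j) (index (s j.+1) (states L)) _ _ _ (pred_mem jn).
  rewrite szp index_mem s_st => /(_ isT); have := IH (ltnW jn).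
  move: (nth 0 (T j) _) (nth 0 (relax _ _) _) => a b; move: (\sum_(i < j) _)%N => S.
  lia.
have := allP check i0; rewrite mem_iota /= hi0 => /(_ isT).
have := key n (leqnn n); rewrite s_loop -/i0 -/(T n).
move: (nth 0 _ _) (\sum_(i < n) _)%N => a S h /N.leb_spec0; lia.
Qed.

End WalkSound.

Lemma pay_min_le k b5 d c a5 : pay_min k b5 a5 <= pay k b5 d c a5.
Proof.
rewrite /pay_min /pay.
case: (k <=? 6) => //.
case: (N.eqb_spec k 7) => [-> /=|_].
  by case: b5; case: a5 => //=; repeat case: ifP => _ //.
case: (N.eqb_spec k 11) => [-> /=|_].
  by case: b5; case: a5 => //=; repeat case: ifP => _ //.
case: (N.eqb_spec k 13) => [-> /=|_] /=.
  by case: b5; case: a5 => //=; repeat case: ifP => _ //.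
by case: b5; case: a5 => /=; apply: N.le_refl.
Qed.

Lemma give_le s0 s1 s2 s3 s4 : give s0 s1 s2 s3 s4 <= 84.
Proof. by rewrite /give; repeat case: ifP => _ //. Qed.

Lemma gives_le s0 s1 s2 s3 s4 : gives s0 s1 s2 s3 s4 <= 84.
Proof.
by rewrite /gives; have := @give_le s0 s1 s2 s3 s4; have := @give_le s0 s4 s3 s2 s1; lia.
Qed.

Lemma all_stars5 : all (fun t => size t == 5) all_stars.
Proof. by vm_compute. Qed.

Lemma fittingP j d l t : reflect (t \in l /\ d <=? nth 0 t j) (t \in fitting j d l).
Proof. by rewrite mem_filter; apply: (iffP andP) => -[? ?]. Qed.

Lemma balancedP p0 p1 p2 p3 p4 :
  {subset [:: p0; p1; p2; p3; p4] <= tops} -> p0 <= p1 -> p2 <= p1 -> p3 <= p1 -> p4 <= p1 ->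
  ~~ covered [:: p0; p1; p2; p3; p4] -> balanced p0 p1 p2 p3 p4.
Proof.
move=> sub h0 h2 h3 h4 nc.
have up p : p \in [:: p0; p1; p2; p3; p4] -> p <= p1 -> p \in upto p1.
  by move=> hp hle; rewrite mem_filter sub // andbT; apply/N.leb_spec0.
have t1 : p1 \in tops by apply: sub; rewrite !inE eqxx orbT.
have u0 : p0 \in upto p1 by apply: up => //; rewrite !inE eqxx.
have u2 : p2 \in upto p1 by apply: up => //; rewrite !inE eqxx !orbT.
have u3 : p3 \in upto p1 by apply: up => //; rewrite !inE eqxx !orbT.
have u4 : p4 \in upto p1 by apply: up => //; rewrite !inE eqxx !orbT.
have big : 1260 <= cyclic_sum pay5 p0 p1 p2 p3 p4 -> balanced p0 p1 p2 p3 p4.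
  move=> h; apply/N.leb_spec0.
  have : cyclic_sum gives p0 p1 p2 p3 p4 <= 420.
    rewrite /cyclic_sum; have := @gives_le p0 p1 p2 p3 p4; have := @gives_le p1 p2 p3 p4 p0.
    have := @gives_le p2 p3 p4 p0 p1; have := @gives_le p3 p4 p0 p1 p2.
    by have := @gives_le p4 p0 p1 p2 p3; lia.
  lia.
have m1 := @pay_min_le p1 (p2 =? 5) p3 p4 (p0 =? 5).
have m2 := @pay_min_le p2 (p3 =? 5) p4 p0 (p1 =? 5).
have m3 := @pay_min_le p3 (p4 =? 5) p0 p1 (p2 =? 5).
have := star_checkP; rewrite /star_check => /allP /(_ p1 t1) /allP /(_ p0 u0) /allP /(_ p2 u2).
case/orP=> [/N.leb_spec0 h|]; first by apply: big; rewrite /cyclic_sum /pay5; lia.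
move=> /allP /(_ p3 u3).
case/orP=> [/N.leb_spec0 h|]; first by apply: big; rewrite /cyclic_sum /pay5; lia.
move=> /allP /(_ p4 u4) /orP[/orP[/N.leb_spec0 h|]|//].
  by apply: big; rewrite /cyclic_sum /pay5; lia.
rewrite -has_predT => /hasP [t + _]
  => /fittingP [/fittingP [/fittingP [/fittingP [/fittingP [ht e1] e0] e2] e3] e4].
case/negP: nc; apply/hasP; exists t => //.
have := allP all_stars5 t ht; case: t ht e0 e1 e2 e3 e4 => [|t0 [|t1' [|t2 [|t3 [|t4 [|]]]]]] //= _.
by move=> -> -> -> -> ->.
Qed.

(** * Discharging in triangulations *)

Lemma ru_tops d : ru d \in tops.
Proof.
rewrite /ru; case: (leqP d 5) => // h5; case: (leqP d 15) => [h15|h15].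
  by do 16! (case: d h5 h15 => [|d] h5 h15 //).
by case: ifP => // _; case: ifP.
Qed.

Lemma ru_eq5 d : (5 <= d)%N -> (ru d =? 5) = (d == 5%N).
Proof.
rewrite /ru => h; case: (leqP d 5) => h5; first by rewrite eqn_leq h h5.
have -> : (d == 5%N) = false by apply/eqP; lia.
case: (leqP d 15) => h15; first by apply/N.eqb_spec; lia.
by case: ifP => // _; case: ifP.
Qed.

Lemma ru_mono d d' : (d <= d')%N -> ru d <= ru d'.
Proof.
rewrite /ru => h; case: (leqP d 5) => h5; case: (leqP d' 5) => h5';
 case: (leqP d 15) => h15; case: (leqP d' 15) => h15';
 case: (leqP d 17) => h17; case: (leqP d' 17) => h17';
 case: (leqP d 35) => h35; case: (leqP d' 35) => h35'; lia.
Qed.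

Lemma covered_le s s' : all2 N.leb s s' -> covered s' -> covered s.
Proof.
move=> h /hasP [t ht hs]; apply/hasP; exists t => // {ht}.
elim: s s' t h hs => [|x s IH] [|x' s'] //= [|y t] //= /andP[h1 h2] /andP[h3 h4].
rewrite (IH _ _ h2 h4) andbT.
by move: h1 h3 => /N.leb_spec0 h1 /N.leb_spec0 h3; apply/N.leb_spec0; lia.
Qed.

Section OrbitSum.
Variables (T : finType) (s : {perm T}).

Lemma orbit_sum x (F : T -> nat) :
  (\sum_(d in porbit s x) F d = \sum_(i < #|porbit s x|) F (iter i s x))%N.
Proof.
rewrite (eq_bigl _ _ (porbit_traject s x)) -big_uniq ?uniq_traject_porbit //=.
rewrite -[in RHS](big_mkord xpredT (fun i => F (iter i s x))).
by rewrite (big_nth x) size_traject big_nat [RHS]big_nat; apply: eq_bigr => i /andP[_ h];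
  rewrite nth_traject.
Qed.

Lemma orbits_sum (F : T -> nat) :
  (\sum_d F d = \sum_(P in porbits s) \sum_(d in P) F d)%N.
Proof.
rewrite (partition_big (porbit s) (mem (porbits s))) /=; last by move=> d _; apply: imset_f.
apply: eq_bigr => P /imsetP [x _ ->]; apply: eq_bigl => d; exact: eq_porbit_mem.
Qed.

Lemma orbits_ge k : (forall x, k <= #|porbit s x|)%N -> (k * #|porbits s| <= #|T|)%N.
Proof.
move=> h; have -> : #|T| = (\sum_(x : T) 1)%N by rewrite sum_nat_const muln1.
rewrite (orbits_sum (fun=> 1%N)) mulnC -sum_nat_const.
by apply: leq_sum => P /imsetP [x _ ->]; rewrite sum1_card.
Qed.

End OrbitSum.

Section Triangulation.
Variables (D : finType) (e n : {perm D}).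
Hypothesis eK : forall d, e (e d) = d.
Hypothesis tri : forall d, e (n (e (n (e (n d))))) = d.

Let m := (n^-1)%g.
Definition deg d := #|porbit n d|.
Hypothesis deg5 : forall d, (5 <= deg d)%N.

Let t d := ru (deg (e d)).

Lemma prevK d : n (m d) = d. Proof. exact: permKV. Qed.
Lemma nextK d : m (n d) = d. Proof. exact: permK. Qed.

Lemma porbit_n d : porbit n (n d) = porbit n d.
Proof.
by apply/eqP; rewrite eq_porbit_mem; have := mem_porbit n 1 d; rewrite expg1.
Qed.

Lemma mem_porbit_n d x : (n d \in porbit n x) = (d \in porbit n x).
Proof. by rewrite -!eq_porbit_mem porbit_n. Qed.

Lemma deg_n d : deg (n d) = deg d.
Proof. by rewrite /deg porbit_n. Qed.

Lemma next5 d : deg d = 5%N -> n (n (n (n (n d)))) = d.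
Proof. by move=> h; have := iter_porbit n d; rewrite -/(deg d) h. Qed.

Lemma prev5 d : deg d = 5%N -> m d = n (n (n (n d))).
Proof. by move=> /next5 h; rewrite -{1}h nextK. Qed.

Lemma prev2_5 d : deg d = 5%N -> m (m d) = n (n (n d)).
Proof. by move=> h; rewrite (prev5 h) nextK. Qed.

Lemma face2 x : n (e (n x)) = e (m (e x)).
Proof. by rewrite -[in RHS](tri x) eK nextK. Qed.

Lemma apexE k : t (n (e k)) = t (m k).
Proof.
have := face2 (e k); rewrite eK /t => h.
by rewrite -(deg_n (e (n (e k)))) h.
Qed.

Lemma apex2 x : t (n (n (e (n x)))) = t (m (m (e x))).
Proof. by rewrite face2 apexE. Qed.

(* the degree of the vertex across the edge joining the targets of d and n d *)
Definition lab d := t (m (m (e d))).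

Lemma star_from d : deg (e d) = 5%N ->
  [/\ t (e d) = ru (deg d), t (n (e d)) = t (m d), t (n (n (e d))) = lab (m d),
      t (n (n (n (e d)))) = lab d & t (n (n (n (n (e d))))) = t (n d)].
Proof.
move=> h5; split.
- by rewrite /t eK.
- exact: apexE.
- by rewrite /lab -apex2 prevK.
- by rewrite /lab prev2_5.
by rewrite -(prev5 h5) -apexE eK.
Qed.

(* The amount [inc] for a star s0, ..., s4 is paid by s3, s4 or s0, depending on
   the degree c of the vertex across the edge s3 s4.  The first two definitions
   take the star read from the payer on. *)
Definition bonus_from3 (s0 s1 s2 s3 s4 c : N) : N :=
  if [&& s0 =? 5, s1 =? 5 & s3 =? 5] then
    if [&& s4 =? 8, 18 <=? s2 & ~~ (18 <=? c)] then 70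
    else if [&& s4 =? 10, (s2 =? 13) || (s2 =? 14) & ~~ (13 <=? c)] then 84 else 0
  else 0.
Definition bonus_from4 (s0 s1 s2 s3 s4 c : N) : N :=
  if [&& s0 =? 5, s2 =? 5, s4 =? 5, s3 =? 8, 18 <=? s1 & 18 <=? c] then 70 else 0.
Definition bonus_from0 (s0 s1 s2 s3 s4 c : N) : N :=
  if [&& (s0 =? 13) || (s0 =? 14), s1 =? 5, s2 =? 10, s3 =? 5, s4 =? 5 & 13 <=? c] then 84 else 0.

Definition on_star (F : N -> N -> N -> N -> N -> N) (h : D) : N :=
  F (t h) (t (n h)) (t (n (n h))) (t (n (n (n h)))) (t (n (n (n (n h))))).
Definition on_star_rev (F : N -> N -> N -> N -> N -> N) (h : D) : N :=
  F (t h) (t (n (n (n (n h))))) (t (n (n (n h)))) (t (n (n h))) (t (n h)).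

Definition bonus (d : D) : N :=
  on_star (fun a b c d' f => bonus_from3 a b c d' f (t (m (m d)))) (e d)
  + on_star (fun a b c d' f => bonus_from4 a b c d' f (t (n (n d)))) (e d)
  + on_star (fun a b c d' f => bonus_from0 a b c d' f (lab (n d))) (e d)
  + on_star_rev (fun a b c d' f => bonus_from3 a b c d' f (t (n (n d)))) (e d)
  + on_star_rev (fun a b c d' f => bonus_from4 a b c d' f (t (m (m d)))) (e d)
  + on_star_rev (fun a b c d' f => bonus_from0 a b c d' f (lab (m (m d)))) (e d).

(* 840 times the charge sent along d *)
Definition flow (d : D) : N := if deg (e d) == 5%N then on_star pay5 (e d) + bonus d else 0.

Lemma incP s0 s1 s2 s3 s4 c :
  inc s0 s1 s2 s3 s4 <=
  bonus_from3 s3 s4 s0 s1 s2 c + bonus_from4 s4 s0 s1 s2 s3 c + bonus_from0 s0 s1 s2 s3 s4 c.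
Proof.
rewrite /inc /bonus_from3 /bonus_from4 /bonus_from0.
by case: (s1 =? 5); case: (s4 =? 5); case: (s3 =? 5); case: (s2 =? 8);
  case: (N.eqb_spec s2 10) => // ?; case: (18 <=? s0); case: ((s0 =? 13) || _);
  case: (18 <=? c); case: (13 <=? c).
Qed.

Let B1 x := on_star (fun a b c d' f => bonus_from3 a b c d' f (t (m (m (e x))))) x.
Let B3 x := on_star (fun a b c d' f => bonus_from4 a b c d' f (t (n (n (e x))))) x.
Let BX x := on_star (fun a b c d' f => bonus_from0 a b c d' f (lab (n (e x)))) x.
Let C1 x := on_star_rev (fun a b c d' f => bonus_from3 a b c d' f (t (n (n (e x))))) x.
Let C3 x := on_star_rev (fun a b c d' f => bonus_from4 a b c d' f (t (m (m (e x))))) x.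
Let CX x := on_star_rev (fun a b c d' f => bonus_from0 a b c d' f (lab (m (m (e x))))) x.

Lemma inc_eq0 s0 s1 s2 s3 s4 : (s4 =? 5) = false -> inc s0 s1 s2 s3 s4 = 0.
Proof. by rewrite /inc => ->; rewrite andbF. Qed.

Lemma ru_deg5 x : (t x =? 5) = (deg (e x) == 5%N).
Proof. exact: ru_eq5. Qed.

Lemma inc_fwd x : deg x = 5%N ->
  on_star inc x <= B1 (n (n (n x))) + B3 (n (n (n (n x)))) + BX x.
Proof.
move=> x5; have xn := next5 x5; rewrite /on_star.
case h4: (t (n (n (n (n x)))) =? 5); last by rewrite (inc_eq0 _ _ _ _ h4); lia.
move: h4; rewrite ru_deg5 => /eqP h4.
have cz : t (m (m (e (n (n (n x)))))) = t (n (n (e (n (n (n (n x))))))) by rewrite apex2.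
have cx : lab (n (e x)) = t (n (n (e (n (n (n (n x))))))).
  have f : n (e (n (e x))) = e (n (n (n (n x)))) by rewrite face2 eK prev5.
  by rewrite /lab prev2_5 ?f // -deg_n f.
rewrite /B1 /B3 /BX /on_star !xn cz cx; exact: incP.
Qed.

Lemma inc_bwd x : deg x = 5%N ->
  on_star_rev inc x <= C1 (n (n x)) + C3 (n x) + CX x.
Proof.
move=> x5; have xn := next5 x5; rewrite /on_star_rev.
case h1: (t (n x) =? 5); last by rewrite (inc_eq0 _ _ _ _ h1); lia.
move: h1; rewrite ru_deg5 => /eqP h1.
have cz : t (n (n (e (n (n x))))) = t (m (m (e (n x)))) by rewrite apex2.
have cx : lab (m (m (e x))) = t (m (m (e (n x)))).
  have f : e (m (e x)) = n (e (n x)) by rewrite face2.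
  have q5 : deg (e (m (e x))) = 5%N by rewrite f deg_n.
  by have [_ _ <- _ _] := star_from q5; rewrite f prev2_5.
rewrite /C1 /C3 /CX /on_star_rev !xn cz cx; exact: incP.
Qed.

Lemma in_star h : deg h = 5%N ->
  on_star (cyclic_sum pay5) h + on_star (cyclic_sum incs) h <=
  flow (e h) + flow (e (n h)) + flow (e (n (n h))) + flow (e (n (n (n h))))
  + flow (e (n (n (n (n h))))).
Proof.
move=> h5; have hn := next5 h5.
have fl x : deg x = 5%N -> flow (e x) = on_star pay5 x + (B1 x + B3 x + BX x + C1 x + C3 x + CX x).
  by move=> hx; rewrite /flow /bonus !eK hx.
have := inc_fwd h5; have := inc_bwd h5.
have := @inc_fwd (n h); have := @inc_bwd (n h).
have := @inc_fwd (n (n h)); have := @inc_bwd (n (n h)).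
have := @inc_fwd (n (n (n h))); have := @inc_bwd (n (n (n h))).
have := @inc_fwd (n (n (n (n h)))); have := @inc_bwd (n (n (n (n h)))).
rewrite !fl ?deg_n //.
rewrite !h5 !hn => /(_ erefl) f1 /(_ erefl) f2 /(_ erefl) f3 /(_ erefl) f4 /(_ erefl) f5
  /(_ erefl) f6 /(_ erefl) f7 /(_ erefl) f8 f9 f10.
have e1 : on_star (cyclic_sum pay5) h =
   on_star pay5 h + on_star pay5 (n h) + on_star pay5 (n (n h)) + on_star pay5 (n (n (n h)))
   + on_star pay5 (n (n (n (n h)))) by rewrite /on_star /cyclic_sum !hn.
have e2 : on_star (cyclic_sum incs) h =
  (on_star inc h + on_star inc (n h) + on_star inc (n (n h)) + on_star inc (n (n (n h)))
   + on_star inc (n (n (n (n h))))) +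
     (on_star_rev inc h + on_star_rev inc (n h) + on_star_rev inc (n (n h))
   + on_star_rev inc (n (n (n h))) + on_star_rev inc (n (n (n (n h))))).
  by rewrite /on_star /on_star_rev /cyclic_sum /incs !hn; lia.
rewrite e1 e2; lia.
Qed.

Lemma give_cases d1 d2 d3 d4 s2 s3 c1 c2 :
  bonus_from3 5 d4 s2 s3 d1 d3 + bonus_from4 5 d4 s2 s3 d1 d2 + bonus_from0 5 d4 s2 s3 d1 c1
  + bonus_from3 5 d1 s3 s2 d4 d2 + bonus_from4 5 d1 s3 s2 d4 d3 + bonus_from0 5 d1 s3 s2 d4 c2
  <= gives 5 d1 d2 d3 d4.
Proof.
rewrite /gives /give /bonus_from3 /bonus_from4 /bonus_from0 /=.
case: (N.eqb_spec d1 5) => ?; case: (N.eqb_spec d4 5) => ?;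
  case: (N.eqb_spec s2 5) => ?; case: (N.eqb_spec s3 5) => ?; subst; rewrite /= ?andbF //=;
  repeat case: ifP => //=; lia.
Qed.

Lemma flow_five d : deg d = 5%N -> flow d <= on_star gives d.
Proof.
move=> d5; rewrite /flow; case: eqP => h5; last by rewrite /on_star; lia.
have [e0 e1 e2 e3 e4] := star_from h5.
have td : t d = 5 by rewrite /t h5.
rewrite /bonus /on_star /on_star_rev e0 e1 e2 e3 e4 d5 (prev2_5 d5) (prev5 d5) td /pay5 /=.
exact: give_cases.
Qed.

Lemma out_star h : deg h = 5%N ->
  flow h + flow (n h) + flow (n (n h)) + flow (n (n (n h))) + flow (n (n (n (n h))))
  <= on_star (cyclic_sum gives) h.
Proof.
move=> h5; have hn := next5 h5.
have := flow_five h5; have := @flow_five (n h); have := @flow_five (n (n h)).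
have := @flow_five (n (n (n h))); have := @flow_five (n (n (n (n h)))).
rewrite !deg_n h5 => /(_ erefl) f1 /(_ erefl) f2 /(_ erefl) f3 /(_ erefl) f4 f5.
have -> : on_star (cyclic_sum gives) h =
   on_star gives h + on_star gives (n h) + on_star gives (n (n h))
   + on_star gives (n (n (n h))) + on_star gives (n (n (n (n h)))).
  by rewrite /on_star /cyclic_sum !hn.
lia.
Qed.

Definition star_at (h : D) : seq N :=
  [:: t h; t (n h); t (n (n h)); t (n (n (n h))); t (n (n (n (n h))))].

Lemma orbit_sum5 (F : D -> nat) h : deg h = 5%N ->
  (\sum_(d in porbit n h) F d =
    F h + F (n h) + F (n (n h)) + F (n (n (n h))) + F (n (n (n (n h)))))%N.
Proof.
by move=> h5; rewrite orbit_sum; rewrite /deg in h5; rewrite h5 !big_ord_recr big_ord0.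
Qed.

Lemma five_balance x : deg x = 5%N ->
  (forall h, deg h = 5%N -> ~~ covered (star_at h)) ->
  (840 + \sum_(d in porbit n x) N.to_nat (flow d) <=
     \sum_(d in porbit n x) N.to_nat (flow (e d)))%N.
Proof.
move=> x5 nc.
have [h hx hmax] : exists2 h, h \in porbit n x & forall y, y \in porbit n x ->
    (N.to_nat (t y) <= N.to_nat (t (n h)))%N.
  have [h hx hmax] := @arg_maxnP D x (fun y => y \in porbit n x) (fun y => N.to_nat (t (n y)))
    (porbit_id n x).
  exists h => // y hy; have := hmax (m y); rewrite prevK; apply.
  by rewrite -mem_porbit_n prevK.
have hh : porbit n h = porbit n x by apply/eqP; rewrite eq_porbit_mem.
have h5 : deg h = 5%N by rewrite -x5 /deg hh.
have key (F G : D -> N) :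
    840 + (F h + F (n h) + F (n (n h)) + F (n (n (n h))) + F (n (n (n (n h))))) <=
    G h + G (n h) + G (n (n h)) + G (n (n (n h))) + G (n (n (n (n h)))) ->
    (840 + \sum_(d in porbit n h) N.to_nat (F d) <= \sum_(d in porbit n h) N.to_nat (G d))%N.
  by rewrite !orbit_sum5 //; lia.
rewrite -hh; apply: (key flow (fun d => flow (e d))).
have hin := in_star h5; have hout := out_star h5.
have : balanced (t h) (t (n h)) (t (n (n h))) (t (n (n (n h)))) (t (n (n (n (n h))))).
  have le y : y \in porbit n h -> t y <= t (n h).
    by rewrite hh => /hmax; lia.
  have pi i : iter i n h \in porbit n h by rewrite -permX mem_porbit.
  apply: balancedP; last exact: nc.
  - move=> z; rewrite !in_cons in_nil orbF.
    by case/or4P => [|||/orP[]] /eqP ->; exact: (ru_tops (deg (e _))).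
  - exact: le (pi 0%N).
  - exact: le (pi 2%N).
  - exact: le (pi 3%N).
  exact: le (pi 4%N).
move=> /N.leb_spec0; move: hin hout; rewrite /on_star.
move: (cyclic_sum _ _ _ _ _ _) (cyclic_sum _ _ _ _ _ _) (cyclic_sum _ _ _ _ _ _) => a b c.
move: (flow _) (flow _) (flow _) (flow _) (flow _) => f0 f1 f2 f3 f4.
move: (flow _) (flow _) (flow _) (flow _) (flow _) => g0 g1 g2 g3 g4.
lia.
Qed.

End Triangulation.

Section Donors.
Variables (D : finType) (e n : {perm D}).
Hypothesis eK : forall d, e (e d) = d.
Hypothesis tri : forall d, e (n (e (n (e (n d))))) = d.
Hypothesis deg5 : forall d, (5 <= deg n d)%N.

Let m := (n^-1)%g.
Local Notation deg := (deg n).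
Local Notation flow := (flow e n).
Local Notation lab := (lab e n).
Let t d := ru (deg (e d)).
Let y5 d := deg (e d) == 5%N.

Lemma y5E d : (t d =? 5) = y5 d.
Proof. exact: ru_eq5. Qed.

Lemma flow_donor d : deg d != 5%N -> y5 d ->
  flow d = pay (ru (deg d)) (y5 (m d)) (lab (m d)) (lab d) (y5 (n d))
    + bonus_from0 (ru (deg d)) (t (m d)) (lab (m d)) (lab d) (t (n d)) (lab (n d))
    + bonus_from0 (ru (deg d)) (t (n d)) (lab d) (lab (m d)) (t (m d)) (lab (m (m d))).
Proof.
move=> d5 h5; have [e0 e1 e2 e3 e4] := star_from eK tri (eqP h5).
rewrite /flow -/(y5 d) h5 /bonus /on_star /on_star_rev e0 e1 e2 e3 e4 /pay5 -/(t (m d))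
  -/(t (n d)) !y5E.
have k5 : (ru (deg d) =? 5) = false by rewrite ru_eq5 // (negbTE d5).
by rewrite /bonus_from3 /bonus_from4 k5 -/m /=; lia.
Qed.

Lemma pay_share k b5 d c a5 : 6 <= k -> k <> 7 -> k <> 11 -> k <> 13 ->
  2 * pay k b5 d c a5 <= rate k * ((if a5 then 1 else 2) + (if b5 then 1 else 2)).
Proof.
move=> k6 k7 k11 k13; rewrite /pay; case: (k <=? 6); first by lia.
move/N.eqb_spec: k7; case: (k =? 7) => // _.
case: N.eqb_spec => // _; case: N.eqb_spec => // _.
have := @N.div2_odd (rate k * 3); move: (rate k) => r.
have : N.b2n (N.odd (r * 3)) <= 1 by case: (N.odd _).
by move: (N.b2n _) (N.div2 _) => o h; case: b5; case: a5; cbn [andb orb negb]; lia.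
Qed.

Lemma rate_le k : (8 <= k)%N -> k != 11%N -> k != 13%N -> k != 14%N ->
  (N.to_nat (rate (ru k)) * k <= 840 * (k - 6))%N.
Proof.
rewrite /ru => k8 k11 k13 k14.
case: (leqP k 5) => h5; first by lia.
case: (leqP k 15) => h15.
  by do 16! (case: k k8 k11 k13 k14 h5 h15 => [|k] k8 k11 k13 k14 h5 h15 //).
case: (leqP k 17) => h17; first by have -> : N.to_nat (rate 17) = 525%N by []; lia.
case: (leqP k 35) => h35; first by have -> : N.to_nat (rate 35) = 560%N by []; lia.
by have -> : N.to_nat (rate 36) = 700%N by []; lia.
Qed.

Lemma ru_val k v : (5 < v <= 15)%N -> ru k = N.of_nat v -> k = v.
Proof.
rewrite /ru => hv; case: (leqP k 5) => h5; first by lia.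
case: (leqP k 15) => h15; first by lia.
by case: (leqP k 17) => h17; [lia|case: (leqP k 35) => ?; lia].
Qed.

Lemma share_budget x : (6 <= deg x)%N -> deg x != 7%N -> deg x != 11%N -> deg x != 13%N ->
  deg x != 14%N ->
  (6 * 840 + \sum_(d in porbit n x) N.to_nat (flow d) <= 840 * deg x)%N.
Proof.
move=> k6 k7 k11 k13 k14; set k := deg x.
have dx d : d \in porbit n x -> deg d = k.
  by rewrite -eq_porbit_mem => /eqP h; rewrite /deg h.
have K6 : 6 <= ru k by have := @ru_mono 6 k k6; rewrite /ru /=; lia.
pose r := N.to_nat (rate (ru k)).
pose a d : nat := if y5 d then if y5 (n d) then 1%N else 2%N else 0%N.
pose b d : nat := if y5 d then if y5 (m d) then 1%N else 2%N else 0%N.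
have le1 d : d \in porbit n x -> (2 * N.to_nat (flow d) <= r * (a d + b d))%N.
  move=> /dx hd; rewrite /a /b; case h: (y5 d); last by rewrite /flow -/(y5 d) h.
  rewrite flow_donor ?hd ?h //; last by apply/eqP; rewrite /k in hd *; lia.
  have nv v : (5 < v <= 15)%N -> k != v -> ru k <> N.of_nat v.
    by move=> hv kv /(ru_val hv) kE; rewrite kE eqxx in kv.
  have n13 := nv 13%N isT k13; have n14 := nv 14%N isT k14.
  have := @pay_share (ru k) (y5 (m d)) (lab (m d)) (lab d) (y5 (n d)) K6
    (nv 7%N isT k7) (nv 11%N isT k11) n13.
  have px s1 s2 s3 s4 c : bonus_from0 (ru k) s1 s2 s3 s4 c = 0.
    by rewrite /bonus_from0; case: N.eqb_spec => //; case: N.eqb_spec.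
  rewrite !px /r; case: (y5 (n d)); case: (y5 (m d)); lia.
have sb : (\sum_(d in porbit n x) b d = \sum_(d in porbit n x)
    if y5 (n d) then if y5 d then 1 else 2 else 0)%N.
  rewrite (reindex_inj (@perm_inj _ n)) /=.
  by apply: eq_big => d; rewrite ?mem_porbit_n // /b /m permK.
have sab : (\sum_(d in porbit n x) (a d + b d) <= 2 * k)%N.
  rewrite big_split /= sb -big_split /= mulnC -sum_nat_const.
  by apply: leq_sum => d _; rewrite /a; case: (y5 d); case: (y5 (n d)).
have : (2 * \sum_(d in porbit n x) N.to_nat (flow d) <= r * (2 * k))%N.
  rewrite big_distrr /=; apply: leq_trans (leq_mul (leqnn r) sab).
  by rewrite big_distrr /=; apply: leq_sum => d; exact: le1.
case: (ltnP k 8) => k8.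
  2: by have := rate_le k8 k11 k13 k14; rewrite -/r mulnCA;
    move: (r * k)%N (\sum_(d in _) _)%N => u v; lia.
have kE : k = 6%N by apply/eqP; rewrite /k in k8 *; lia.
have f0 d : d \in porbit n x -> N.to_nat (flow d) = 0%N.
  move=> /dx hd; case h: (y5 d); last by rewrite /flow -/(y5 d) h.
  by rewrite flow_donor ?hd ?kE.
by rewrite (eq_bigr (fun=> 0%N)) ?big1 // kE.
Qed.

End Donors.

Arguments covered : simpl never.
Arguments pay : simpl never.
Arguments canon : simpl never.

Definition coarse (L : seq N) (v : N) : N := nth 36 L (find (fun a => v <=? a) L).

Definition coarsens (k : N) (L : seq N) : bool :=
  all (fun v => [&& coarse L v \in L, v <=? coarse L v &
         all (fun b5 => all (fun a5 => all (fun v' =>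
           pay k b5 v v' a5 <=? pay k b5 (coarse L v) (coarse L v') a5) tops)
          [:: true; false]) [:: true; false]]) tops.

Definition coarsens_bonus (L : seq N) : bool :=
  all (fun v => [&& (v =? 5) ==> (coarse L v =? 5),
    (v =? 10) ==> (10 <=? coarse L v) && (coarse L v <=? 12) &
    (13 <=? v) ==> (13 <=? coarse L v)]) tops.

Lemma canon_states (L : seq N) y0 v0 y1 v1 f :
  y0 \in [:: 5; 36] -> y1 \in [:: 5; 36] -> v0 \in L -> v1 \in L ->
  canon y0 v0 y1 v1 f \in states L.
Proof.
move=> h0 h1 l0 l1; rewrite mem_undup.
apply/mapP; exists ((y0, v0, y1), (v1, f)) => //.
by apply: allpairs_f; apply: allpairs_f => //; [apply: allpairs_f|case: f].
Qed.

Lemma canon_succs k ex L y0 v0 y1 v1 f y2 v2 :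
  y0 \in [:: 5; 36] -> y1 \in [:: 5; 36] -> y2 \in [:: 5; 36] -> v2 \in L ->
  ~~ ((y1 =? 5) && covered [:: k; y0; v0; v1; y2]) ->
  (canon y1 v1 y2 v2 (ex && (13 <=? v0)),
   if y1 =? 5 then pay k (y0 =? 5) v0 v1 (y2 =? 5) + extra ex y0 v0 v1 y2 v2 f else 0)
  \in succs k ex L (canon y0 v0 y1 v1 f).
Proof.
move=> h0 h1 h2 l2; rewrite /canon.
move: h1; rewrite !inE => /orP[] /eqP -> /=.
  move: h0; rewrite !inE => /orP[] /eqP -> /=; move: h2; rewrite !inE => /orP[]
    /eqP -> /= /negbTE ->;
    rewrite !mem_cat; apply/or3P.
  - by apply: Or31; apply/mapP; exists v2.
  - by apply: Or32; apply/mapP; exists v2.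
  - by apply: Or31; apply/mapP; exists v2 => //; rewrite /extra /= andbF.
  - by apply: Or32; apply/mapP; exists v2 => //; rewrite /extra /= andbF.
move: h2; rewrite !inE => /orP[] /eqP -> _; rewrite !mem_cat; apply/or3P.
  by apply: Or31; apply/mapP; exists v2.
by apply: Or32; apply/mapP; exists v2.
Qed.

Lemma coarsens7 : coarsens 7 [:: 5; 35; 36]. Proof. by vm_compute. Qed.
Lemma coarsens11 : coarsens 11 [:: 7; 8; 9; 10; 36]. Proof. by vm_compute. Qed.
Lemma coarsens13 : coarsens 13 [:: 5; 9; 12; 36]. Proof. by vm_compute. Qed.
Lemma coarsens14 : coarsens 14 [:: 5; 9; 12; 36]. Proof. by vm_compute. Qed.
Lemma bonus13 : coarsens_bonus [:: 5; 9; 12; 36]. Proof. by vm_compute. Qed.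

Lemma bonus_extra L K ex y0 v0 v1 y2 v2 v : ((K =? 13) || (K =? 14) ==> ex && coarsens_bonus L) ->
  {subset [:: v0; v1; v2; v] <= tops} ->
  bonus_from0 K y0 v0 v1 y2 v2 + bonus_from0 K y2 v1 v0 y0 v <=
  extra ex (if y0 =? 5 then 5 else 36) (coarse L v0) (coarse L v1) (if y2 =? 5 then 5 else 36)
    (coarse L v2) (ex && (13 <=? coarse L v)).
Proof.
rewrite /bonus_from0 /extra; case: ((K =? 13) || (K =? 14)) => [/=|_ _ /=]; last exact: N.le_0_l.
move=> /andP[-> /allP cX] /allP /= /and5P[h0 h1 h2 h3 _].
case: (y0 =? 5); rewrite ?andbF //=; case: (y2 =? 5); rewrite ?andbF //= ?andbT.
have /and3P[a5 a10 _] := cX _ h0; have /and3P[b5 b10 _] := cX _ h1.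
have /and3P[_ _ c13] := cX _ h2; have /and3P[_ _ d13] := cX _ h3.
move: a5 a10 b5 b10 c13 d13.
case: (N.eqb_spec v0 10) => [-> _ /= /andP[-> ->] /=|_ /= a5 _ _].
  case: (v1 =? 5) => /= [-> _|_ _ *]; last by rewrite ?andbF; exact: N.le_0_l.
  by case: (13 <=? v2) => /= [->|*]; rewrite ?andbF; lia.
case: (v0 =? 5) a5 => /= [->|_]; last by rewrite ?andbF => *; exact: N.le_0_l.
case: (v1 =? 10) => /= [/andP[-> ->]|*]; last by rewrite ?andbF; exact: N.le_0_l.
case: (13 <=? v) => /= [_ ->|*]; last by rewrite ?andbF; exact: N.le_0_l.
by rewrite ?andbT; case: ifP.
Qed.

Section Circle.
Variables (D : finType) (e n : {perm D}).
Hypothesis eK : forall d, e (e d) = d.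
Hypothesis tri : forall d, e (n (e (n (e (n d))))) = d.
Hypothesis deg5 : forall d, (5 <= deg n d)%N.
Hypothesis uncovered : forall h, deg n h = 5%N -> ~~ covered (star_at e n h).

Let m := (n^-1)%g.
Local Notation deg := (deg n).
Local Notation flow := (flow e n).
Local Notation lab := (lab e n).
Let t d := ru (deg (e d)).
Let y5 d := deg (e d) == 5%N.
Let Y d : N := if y5 d then 5 else 36.

Lemma circle_budget x k ex L B : deg x = k -> (6 <= k <= 15)%N ->
  coarsens (ru k) L -> ((ru k =? 13) || (ru k =? 14) ==> ex && coarsens_bonus L) ->
  walk_check (ru k) ex L k B ->
  (\sum_(d in porbit n x) N.to_nat (flow d) <= N.to_nat B)%N.
Proof.
move=> xk k15 cL cX check.
pose V d := coarse L (lab d).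
pose s i := let d := iter i n x in canon (Y (m d)) (V (m d)) (Y d) (V d)
  (ex && (13 <=? V (m (m d)))).
pose w i := let d := iter i n x in if Y d =? 5 then
  pay (ru k) (Y (m d) =? 5) (V (m d)) (V d) (Y (n d) =? 5)
  + extra ex (Y (m d)) (V (m d)) (V d) (Y (n d)) (V (n d)) (ex && (13 <=? V (m (m d)))) else 0.
have hY d : Y d \in [:: 5; 36] by rewrite /Y; case: ifP.
have Y5 d : (Y d =? 5) = y5 d by rewrite /Y; case: ifP.
have lt d : lab d \in tops by exact: ru_tops.
have hV d : V d \in L by have /andP[] := allP cL _ (lt d).
have leV d : lab d <=? V d by have /and3P[] := allP cL _ (lt d).
have dk i : deg (iter i n x) = k.
  by elim: i => //= i IH; rewrite deg_n.
have mnx d : m (n d) = d by exact: permK.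
have leY d : t d <=? Y d.
  rewrite /Y /t /y5; case: eqP => [-> //|_]; rewrite /ru.
  by repeat case: ifP => //; move=> h _; apply/N.leb_spec0; lia.
have flow_le i : (N.to_nat (flow (iter i n x)) <= N.to_nat (w i))%N.
  rewrite /w /=; set d := iter i n x; rewrite !Y5.
  case h: (y5 d); last by rewrite /flow -/(y5 d) h.
  rewrite flow_donor ?dk //; last by lia.
  have hp : pay (ru k) (y5 (m d)) (lab (m d)) (lab d) (y5 (n d))
     <= pay (ru k) (y5 (m d)) (V (m d)) (V d) (y5 (n d)).
    have /and3P[_ _ /allP /(_ (y5 (m d)))] := allP cL _ (lt (m d)).
    rewrite !inE; case: (y5 _) => /(_ isT) /allP /(_ (y5 (n d))); rewrite !inE;
      by case: (y5 _) => /(_ isT) /allP /(_ _ (lt d)) /N.leb_spec0.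
  have := @bonus_extra L (ru k) ex (t (m d)) (lab (m d)) (lab d) (t (n d)) (lab (n d))
    (lab (m (m d))) cX.
  have tY z : (if t z =? 5 then 5 else 36) = Y z by rewrite y5E.
  rewrite !tY => /(_ _)/wrap[]; last first.
    rewrite -/m -!/(t _) -!/(y5 _);
      move: (bonus_from0 _ _ _ _ _ _) (bonus_from0 _ _ _ _ _ _) hp => p1 p2 hp px.
    move: (pay _ _ _ _ _) (pay _ _ _ _ _) (extra _ _ _ _ _ _ _) hp px; clear; lia.
  by apply/allP; rewrite /= !lt.
have : (\sum_(i < k) N.to_nat (w i) <= N.to_nat B)%N.
  apply: (walk_sound check (s := s)).
  - by move=> i; apply: canon_states.
  - move=> i ik; rewrite /s /w /=; set d := iter i n x.
    rewrite !mnx; apply: canon_succs => //.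
    rewrite Y5; case h: (y5 d) => //=.
    apply: contra (uncovered (eqP h)) => /=; apply: covered_le.
    have [e0 e1 e2 e3 e4] := star_from eK tri (eqP h).
    by rewrite /star_at e0 e1 e2 e3 e4 /= dk leY !leV leY N.leb_refl.
  - by rewrite /s /= -xk iter_porbit.
apply: leq_trans; rewrite orbit_sum -/(deg x) xk.
by apply: leq_sum => i _; exact: flow_le.
Qed.

Lemma vertex_balance x :
  (6 * 840 + \sum_(d in porbit n x) N.to_nat (flow d)
   <= 840 * deg x + \sum_(d in porbit n x) N.to_nat (flow (e d)))%N.
Proof.
have big C : (6 * 840 + C <= 840 * deg x -> 6 * 840 + C
    <= 840 * deg x + \sum_(d in porbit n x) N.to_nat (flow (e d)))%N.
  by move/leq_trans; apply; exact: leq_addr.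
have [x5|/eqP n5] := eqVneq (deg x) 5%N.
  by have := five_balance eK tri deg5 x5 uncovered; lia.
have [x7|n7] := eqVneq (deg x) 7%N.
  by apply: big; have := circle_budget x7 isT coarsens7 isT walk_check7; lia.
have [x11|n11] := eqVneq (deg x) 11%N.
  by apply: big; have := circle_budget x11 isT coarsens11 isT walk_check11; lia.
have [x13|n13] := eqVneq (deg x) 13%N.
  by apply: big; have := circle_budget x13 isT coarsens13 bonus13 walk_check13; lia.
have [x14|n14] := eqVneq (deg x) 14%N.
  by apply: big; have := circle_budget x14 isT coarsens14 bonus13 walk_check14; lia.
by apply: big; apply: share_budget => //; have := deg5 x; lia.
Qed.

Lemma six_vertices : (6 * #|porbits n| <= #|D|)%N.
Proof.
have : (\sum_(P in porbits n) (6 * 840 + \sum_(d in P) N.to_nat (flow d)) <=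
  \sum_(P in porbits n) \sum_(d in P) (840 + N.to_nat (flow (e d))))%N.
  apply: leq_sum => P /imsetP[x _ ->]; apply: leq_trans (vertex_balance x) _.
  by rewrite big_split /= sum_nat_const mulnC.
rewrite big_split /= -!orbits_sum big_split /= !sum_nat_const.
rewrite [X in (_ + X <= _)%N](reindex_inj (can_inj eK)) /=;
  move: (\sum_d _)%N #|D| #|porbits n| => S a b; lia.
Qed.

End Circle.

Lemma porbit_ge3 (D : finType) (s : {perm D}) x : s x != x -> s (s x) != x ->
  (3 <= #|porbit s x|)%N.
Proof.
move=> h1 h2; have := iter_porbit s x; have : (0 < #|porbit s x|)%N.
  by apply/card_gt0P; exists x; exact: porbit_id.
by case: #|_| => [|[|[|k]]] //= _ h; rewrite h eqxx in h1 h2.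
Qed.

Lemma triangulated_star (D : finType) (e n : {perm D}) :
  (forall d, e (e d) = d) -> (forall d, e d != d) ->
  (forall d, e (n (e (n (e (n d))))) = d) ->
  (forall d, e (n d) != d) -> (forall d, e (n (e (n d))) != d) ->
  (forall d, 5 <= #|porbit n d|)%N ->
  (#|D| < #|porbits e| + #|porbits n| + #|porbits (n * e)|)%N ->
  exists2 h, #|porbit n h| = 5%N & covered (star_at e n h).
Proof.
move=> eK e1 tri g1 g2 deg5 pl; apply/not_exists2P => none.
have unc h : deg n h = 5%N -> ~~ covered (star_at e n h).
  by move=> h5; case: (none h) => // /negP.
have V := six_vertices eK tri deg5 unc.
have E2 : (2 * #|porbits e| <= #|D|)%N.
  apply: orbits_ge => x; have := iter_porbit e x; have : (0 < #|porbit e x|)%N.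
    by apply/card_gt0P; exists x; exact: porbit_id.
  by have := e1 x; case: #|_| => [|[|k]] //= /eqP.
have F3 : (3 * #|porbits (n * e)| <= #|D|)%N.
  by apply: orbits_ge => x; apply: porbit_ge3; rewrite !permM.
lia.
Qed.

(** * Triangulating a map *)

Local Open Scope nat_scope.

Section Extend.
Variable D : finType.

Definition extend_fun (s : {perm D}) (x : D + bool) : D + bool :=
  if x is inl d then inl (s d) else x.

Lemma extend_inj s : injective (extend_fun s).
Proof. by case=> x [] y //= [] /perm_inj ->. Qed.

Definition extend s : {perm (D + bool)} := perm (@extend_inj s).

Lemma extendE s d : extend s (inl d) = inl (s d). Proof. by rewrite permE. Qed.
Lemma extend_inr s c : extend s (inr c) = inr c. Proof. by rewrite permE. Qed.

Lemma porbit_fix (T : finType) (s : {perm T}) x : s x = x -> porbit s x = [set x].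
Proof.
move=> sx; apply/setP => y; rewrite inE; apply/porbitP/eqP => [[i ->]|->].
  by rewrite permX; elim: i => //= i ->.
by exists 0; rewrite expg0 perm1.
Qed.

Lemma porbit_extend s x : porbit (extend s) (inl x) = [set inl y | y in porbit s x].
Proof.
have it i : (extend s ^+ i)%g (inl x) = inl ((s ^+ i)%g x).
  by rewrite !permX; elim: i => //= i ->; rewrite extendE.
apply/setP => y; apply/porbitP/imsetP => [[i ->]|[z /porbitP[i ->] ->]].
  by exists ((s ^+ i)%g x); rewrite ?mem_porbit.
by exists i; rewrite it.
Qed.

Lemma card_porbits_extend s : #|porbits (extend s)| = #|porbits s| + 2.
Proof.
pose J (A : {set D}) : {set D + bool} := [set inl y | y in A].
have Jinj : injective J.
  by apply: imset_inj => x y [].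
have -> : porbits (extend s) = [set J A | A in porbits s] :|: [set [set inr true]; [set inr false]].
  apply/setP => P; rewrite !inE;
    apply/imsetP/idP => [[[x|[]] _ ->]|/or3P[/imsetP[A /imsetP[x _ ->] ->]|/eqP->|/eqP->]].
  - by apply/orP; left; rewrite porbit_extend; do 2 apply: imset_f.
  - by rewrite porbit_fix ?extend_inr // eqxx orbT.
  - by rewrite porbit_fix ?extend_inr // eqxx !orbT.
  - by exists (inl x); rewrite // porbit_extend.
  - by exists (inr true); rewrite // porbit_fix ?extend_inr.
  by exists (inr false); rewrite // porbit_fix ?extend_inr.
rewrite cardsU card_imset // cards2.
have -> : [set inr true] != [set inr false] :> {set D + bool}.
  by apply/eqP => /setP /(_ (inr true)); rewrite !inE.
have -> : [set J A | A in porbits s] :&: [set [set inr true]; [set inr false]] = finset.set0.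
  apply/setP => P; rewrite !inE; apply/negP => /andP[/imsetP[A /imsetP[x _ ->] ->]] /orP[]
    /eqP /setP /(_ (inl x));
  by rewrite !inE => /negbT/negP; apply; apply/imsetP; exists x; rewrite ?porbit_id.
by rewrite cards0 subn0.
Qed.

End Extend.

Section Chord.
Variables (D : finType) (e n : {perm D}) (b : D).
Hypothesis eK : forall d, e (e d) = d.
Hypothesis e1 : forall d, e d != d.
Hypothesis g1 : forall d, e (n d) != d.
Hypothesis g2 : forall d, e (n (e (n d))) != d.
Hypothesis deg5 : forall d, 5 <= #|porbit n d|.
Let g := (n * e)%g.
Let a := g (g b).
Hypothesis g3 : g a != b.

Let A : D + bool := inr true.
Let A' : D + bool := inr false.
Definition chord_n : {perm D + bool} := (tperm (inl a) A * (tperm (inl b) A' * extend n))%g.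
Definition chord_e : {perm D + bool} := (tperm A A' * extend e)%g.
Local Notation n' := chord_n.
Local Notation e' := chord_e.

Lemma chord_faceE d : g d = e (n d). Proof. by rewrite permM. Qed.
Lemma chord_face_neq d : g d != d. Proof. by rewrite chord_faceE. Qed.
Lemma chord_face2_neq d : g (g d) != d. Proof. by rewrite !chord_faceE. Qed.

Lemma chord_neq : a != b. Proof. exact: chord_face2_neq. Qed.

Lemma chord_nE x : n' x = extend n (tperm (inl b) A' (tperm (inl a) A x)).
Proof. by rewrite !permM. Qed.

Lemma chord_nA : n' A = inl (n a).
Proof.
rewrite chord_nE tpermR tpermD ?extendE //.
by apply/eqP => -[] /eqP; rewrite eq_sym (negbTE chord_neq).
Qed.

Lemma chord_nA' : n' A' = inl (n b).
Proof. by rewrite chord_nE (tpermD (z := A')) // tpermR extendE. Qed.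

Lemma chord_na : n' (inl a) = A.
Proof. by rewrite chord_nE tpermL tpermD // extend_inr. Qed.

Lemma chord_nb : n' (inl b) = A'.
Proof.
rewrite chord_nE (tpermD (z := inl b)) ?tpermL ?extend_inr //.
by apply/eqP => -[] /eqP; rewrite (negbTE chord_neq).
Qed.

Lemma chord_nD d : d != a -> d != b -> n' (inl d) = inl (n d).
Proof.
move=> da db; have il d' : d != d' -> inl d' != inl d :> D + bool.
  by rewrite eq_sym; apply: contra => /eqP[->].
by rewrite chord_nE (tpermD (z := inl d)) ?tpermD ?il // extendE.
Qed.

Lemma chord_eA : e' A = A'. Proof. by rewrite permM tpermL extend_inr. Qed.
Lemma chord_eA' : e' A' = A. Proof. by rewrite permM tpermR extend_inr. Qed.
Lemma chord_eD d : e' (inl d) = inl (e d). Proof. by rewrite permM tpermD ?extendE. Qed.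

Lemma chord_eK x : e' (e' x) = x.
Proof.
by case: x => [d|[]]; rewrite ?chord_eD ?eK // -/A -/A' ?chord_eA ?chord_eA' ?chord_eA.
Qed.

Lemma chord_e1 x : e' x != x.
Proof.
case: x => [d|[]]; rewrite ?chord_eD -/A -/A' ?chord_eA ?chord_eA' //.
by apply: contra (e1 d) => /eqP[->].
Qed.

Lemma chord_gD d : d != a -> d != b -> e' (n' (inl d)) = inl (g d).
Proof. by move=> da db; rewrite chord_nD // chord_eD -chord_faceE. Qed.
Lemma chord_ga : e' (n' (inl a)) = A'. Proof. by rewrite chord_na chord_eA. Qed.
Lemma chord_gb : e' (n' (inl b)) = A. Proof. by rewrite chord_nb chord_eA'. Qed.
Lemma chord_gA : e' (n' A) = inl (g a). Proof. by rewrite chord_nA chord_eD chord_faceE. Qed.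
Lemma chord_gA' : e' (n' A') = inl (g b). Proof. by rewrite chord_nA' chord_eD chord_faceE. Qed.

Lemma chord_g1 x : e' (n' x) != x.
Proof.
case: x => [d|[]]; rewrite -/A -/A' ?chord_gA ?chord_gA' //.
have [->|da] := eqVneq d a; first by rewrite chord_ga.
have [->|db] := eqVneq d b; first by rewrite chord_gb.
by rewrite chord_gD //; apply: contra (chord_face_neq d) => /eqP[->].
Qed.

Lemma chord_g2 x : e' (n' (e' (n' x))) != x.
Proof.
have il d d' : d != d' -> inl d != inl d' :> D + bool by apply: contra => /eqP[->].
case: x => [d|[]]; rewrite -/A -/A' ?chord_gA ?chord_gA'; last first.
- by rewrite chord_gD ?chord_face_neq // eq_sym chord_face_neq.
- have [->|da] := eqVneq (g a) a; first by rewrite chord_ga.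
  by rewrite chord_gD.
have [->|da] := eqVneq d a; first by rewrite chord_ga chord_gA' il // eq_sym chord_face_neq.
have [->|db] := eqVneq d b; first by rewrite chord_gb chord_gA il.
rewrite chord_gD //.
have [->|ga] := eqVneq (g d) a; first by rewrite chord_ga.
have [->|gb] := eqVneq (g d) b; first by rewrite chord_gb.
by rewrite chord_gD // il // chord_face2_neq.
Qed.

Lemma chord_porbits_e : #|porbits e'| = #|porbits e| + 1.
Proof.
have := porbits_mul_tperm (extend e) A A'.
rewrite porbit_fix ?extend_inr // inE card_porbits_extend /= -/e'; lia.
Qed.

Lemma chord_porbits_n : #|porbits n'| = #|porbits n|.
Proof.
pose h := (tperm (inl b) A' * extend n)%g.
have := porbits_mul_tperm (extend n) (inl b) A'.
rewrite porbit_fix ?extend_inr // inE card_porbits_extend /= -/h.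
have := porbits_mul_tperm h (inl a) A.
have hA : h A = A by rewrite permM tpermD // extend_inr.
rewrite porbit_fix // inE /= -/chord_n /reverse_coercion; lia.
Qed.

Lemma chord_porbits_g : #|porbits (n' * e')| = #|porbits g| + 1.
Proof.
pose h1 := (tperm A A' * extend g)%g; pose h2 := (tperm (inl b) A' * h1)%g.
have -> : (n' * e' = tperm (inl a) A * h2)%g.
  have key y : extend e (tperm A A' (extend n y)) = extend g (tperm A A' y).
    case: y => [d|[]]; rewrite -/A -/A' ?extend_inr ?tpermL ?tpermR ?extend_inr //.
    by rewrite extendE !tpermD // !extendE chord_faceE.
  by apply/perm.permP => x; rewrite !permM key.
pose F (s : {perm D + bool}) := #|porbits s|; rewrite -/(F _).
have h1D d : h1 (inl d) = inl (g d) by rewrite permM tpermD // extendE.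
have h1A : h1 A = A' by rewrite permM tpermL extend_inr.
have h1A' : h1 A' = A by rewrite permM tpermR extend_inr.
have h2A : h2 A = A' by rewrite permM tpermD // h1A.
have h2A' : h2 A' = inl (g b) by rewrite permM tpermR h1D.
have h2g : h2 (inl (g b)) = inl a.
  rewrite permM tpermD ?h1D //.
  by apply/eqP => -[] /eqP; rewrite eq_sym (negbTE (chord_face_neq b)).
have E1 : F h1 + 2 = F (extend g) + 1.
  by have := porbits_mul_tperm (extend g) A A'; rewrite porbit_fix ?extend_inr // inE.
have E2 : F h2 + 2 = F h1 + 1.
  have := porbits_mul_tperm h1 (inl b) A'.
  have -> // : (inl b \notin porbit h1 A').
  apply/negP => /porbitP[i]; rewrite permX => hi.
  have : iter i h1 A' \in [:: A; A'].
    by elim: i {hi} => //= i; rewrite !inE => /orP[] /eqP ->; rewrite ?h1A ?h1A' eqxx ?orbT.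
  by rewrite -hi !inE.
have E3 : F (tperm (inl a) A * h2)%g + 0 = F h2 + 1.
  have := porbits_mul_tperm h2 (inl a) A.
  have -> // : inl a \in porbit h2 A.
  by apply/porbitP; exists 3; rewrite permX /= h2A h2A' h2g.
have E0 : F (extend g) = #|porbits g| + 2 := card_porbits_extend g.
by move: E0 E1 E2 E3; move: (F _) (F _) (F _) (F _); lia.
Qed.

Lemma chord_step d : inl (n d) \in porbit n' (inl d).
Proof.
have st x : n' x \in porbit n' x by have := mem_porbit n' 1 x; rewrite expg1.
have st2 x : n' (n' x) \in porbit n' x.
  by have := mem_porbit n' 2 x; rewrite expgS expg1 permM.
have [->|da] := eqVneq d a; first by have := st2 (inl a); rewrite chord_na chord_nA.
have [->|db] := eqVneq d b; first by have := st2 (inl b); rewrite chord_nb chord_nA'.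
by rewrite -chord_nD.
Qed.

Lemma chord_sub d y : y \in porbit n d -> inl y \in porbit n' (inl d).
Proof.
case/porbitP => i ->{y}; rewrite permX; elim: i => [|i IH] /=; first exact: porbit_id.
by move: IH; rewrite -eq_porbit_mem => /eqP <-; exact: chord_step.
Qed.

Lemma chord_deg d : #|porbit n d| <= #|porbit n' (inl d)|.
Proof.
rewrite -(card_imset _ (@inl_inj _ bool));
  apply/subset_leq_card/fintype.subsetP => y /imsetP[z hz ->].
exact: chord_sub.
Qed.

Lemma chord_deg_inr d c : inr c \in porbit n' (inl d) -> #|porbit n d| < #|porbit n' (inl d)|.
Proof.
move=> hc; rewrite -(card_imset _ (@inl_inj _ bool)); apply/proper_card/properP; split.
  by apply/fintype.subsetP => y /imsetP[z hz ->]; exact: chord_sub.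
by exists (inr c) => //; apply/imsetP => -[].
Qed.

Lemma chord_deg5 x : 5 <= #|porbit n' x|.
Proof.
case: x => [d|c]; first exact: leq_trans (deg5 d) (chord_deg d).
have [d hd] : exists d, n' (inr c) = inl d.
  by case: c; rewrite -/A -/A' ?chord_nA ?chord_nA'; [exists (n a)|exists (n b)].
by have := porbit_n n' (inr c); rewrite hd => <-; exact: leq_trans (deg5 d) (chord_deg d).
Qed.

Lemma chord_star x : #|porbit n' x| = 5 -> covered (star_at e' n' x) ->
  exists2 h, #|porbit n h| = 5 & covered (star_at e n h).
Proof.
have nin d : #|porbit n' (inl d)| = 5 -> forall c, inr c \notin porbit n' (inl d).
  by move=> h c; apply/negP => /chord_deg_inr; have := deg5 d; lia.
case: x => [d|c] x5 cov; last first.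
  have [d hd] : exists d, n' (inr c) = inl d.
    by case: c {x5 cov}; rewrite -/A -/A' ?chord_nA ?chord_nA'; [exists (n a)|exists (n b)].
  have pE := porbit_n n' (inr c); rewrite hd in pE.
  by have := @nin d; rewrite pE => /(_ x5 c); rewrite porbit_id.
exists d; first by have := chord_deg d; have := deg5 d; lia.
have it i : iter i n' (inl d) = inl (iter i n d).
  elim: i => //= i IH; rewrite IH; case E : (n' _) => [z|c]; last first.
    case/negP: (nin d x5 c); rewrite -E -IH -iterS -permX; exact: mem_porbit.
  move: E; have [->|da] := eqVneq (iter i n d) a; first by rewrite chord_na.
  have [->|db] := eqVneq (iter i n d) b; first by rewrite chord_nb.
  by rewrite chord_nD.
apply: covered_le cov; rewrite /star_at /deg.
have := it 1; have := it 2; have := it 3; have := it 4; rewrite /= => -> -> -> ->.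
rewrite !chord_eD.
by do 5 (apply/andP; split; first (apply/N.leb_spec0; exact/ru_mono/chord_deg)).
Qed.

End Chord.

Lemma map_star (D : finType) (e n : {perm D}) :
  (forall d, e (e d) = d) -> (forall d, e d != d) ->
  (forall d, e (n d) != d) -> (forall d, e (n (e (n d))) != d) ->
  (forall d, 5 <= #|porbit n d|) ->
  #|D| < #|porbits e| + #|porbits n| + #|porbits (n * e)| ->
  exists2 h, #|porbit n h| = 5 & covered (star_at e n h).
Proof.
have [m] : exists m, #|D| < 3 * #|porbits (n * e)| + m.
  by exists #|D|.+1; rewrite addnS ltnS leq_addl.
elim: m D e n => [|m IH] D e n Dm eK e1 g1 g2 deg5 pl.
  have : 3 * #|porbits (n * e)| <= #|D|.
    by apply: orbits_ge => x; apply: porbit_ge3; rewrite !permM.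
  by rewrite leqNgt -[X in _ < X]addn0 Dm.
have [/forallP tri|] := boolP [forall b, e (n (e (n (e (n b))))) == b].
  by apply: triangulated_star => // d; apply/eqP.
rewrite negb_forall => /existsP[b bn].
have g3 : (n * e)%g ((n * e)%g ((n * e)%g b)) != b by rewrite !permM.
have cD : #|{: D + bool}| = #|D| + 2 by rewrite card_sum card_bool.
have pg := chord_porbits_g g1 g3; have pn := chord_porbits_n g3; have pe := chord_porbits_e g3.
have [x x5 cov] : exists2 h,
  #|porbit (chord_n e n b) h| = 5 & covered (star_at (chord_e e) (chord_n e n b) h).
  apply: IH.
  - by rewrite pg cD; lia.
  - exact: chord_eK.
  - exact: chord_e1.
  - exact: chord_g1.
  - exact: chord_g2.
  - exact: chord_deg5.
  - by rewrite pg pn pe cD; lia.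
exact: chord_star x5 cov.
Qed.

Import Order.TTheory GRing.Theory Num.Theory.
Import numFieldNormedType.Exports.
Local Open Scope classical_set_scope.
Local Open Scope ring_scope.

(** * Angles and windings *)

Section Angle.
Variable R : realType.
Implicit Types (p q a b : R * R) (A B : R).

Definition nrm p : R := Num.sqrt (p.1 ^+ 2 + p.2 ^+ 2).
Definition dot a b : R := a.1 * b.1 + a.2 * b.2.
Definition cross a b : R := a.1 * b.2 - a.2 * b.1.
Definition is_ang p A : Prop := p.1 = nrm p * cos A /\ p.2 = nrm p * sin A.

Lemma nrm_ge0 p : 0 <= nrm p. Proof. exact: sqrtr_ge0. Qed.

Lemma nrm_sqr p : nrm p ^+ 2 = p.1 ^+ 2 + p.2 ^+ 2.
Proof. by rewrite sqr_sqrtr // addr_ge0 // sqr_ge0. Qed.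

Lemma nrm_eq0 p : (nrm p == 0) = (p == 0).
Proof.
rewrite -(sqrf_eq0 (nrm p)) nrm_sqr paddr_eq0 ?sqr_ge0 // !sqrf_eq0.
by case: p.
Qed.

Lemma nrm_gt0 p : (0 < nrm p) = (p != 0).
Proof. by rewrite lt_def nrm_ge0 andbT nrm_eq0. Qed.

Lemma cross_dot a b : cross a b ^+ 2 + dot a b ^+ 2 = (nrm a * nrm b) ^+ 2.
Proof. by rewrite exprMn !nrm_sqr /cross /dot; ring. Qed.

(* The signed angle from a to b, valid unless they point in opposite directions. *)
Definition turn a b : R := 2 * atan (cross a b / (nrm a * nrm b + dot a b)).

Lemma cos_dbl_atan (x : R) : cos (2 * atan x) = (1 - x ^+ 2) / (1 + x ^+ 2).
Proof.
have h : 0 < 1 + x ^+ 2 by rewrite ltr_pwDl // sqr_ge0.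
have -> : 2 * atan x = atan x *+ 2 by rewrite mulr2n mulrDl mul1r.
rewrite cos_mulr2n cos_atan exprVn sqr_sqrtr; last exact: ltW.
by field; rewrite gt_eqF.
Qed.

Lemma sin_dbl_atan (x : R) : sin (2 * atan x) = 2 * x / (1 + x ^+ 2).
Proof.
have h : 0 < 1 + x ^+ 2 by rewrite ltr_pwDl // sqr_ge0.
have -> : 2 * atan x = atan x *+ 2 by rewrite mulr2n mulrDl mul1r.
have c0 : cos (atan x) != 0.
  by rewrite gt_eqF // cos_gt0_pihalf // atan_gtNpi2 atan_ltpi2.
have -> : sin (atan x *+ 2) = 2 * (tan (atan x) * cos (atan x) ^+ 2).
  by rewrite sin_mulr2n /tan; field.
rewrite atanK cos_atan exprVn sqr_sqrtr; last exact: ltW.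
by field; rewrite gt_eqF.
Qed.

Lemma turnP a b A : a != 0 -> b != 0 -> 0 < nrm a * nrm b + dot a b ->
  is_ang a A -> is_ang b (A + turn a b).
Proof.
move=> a0 b0 h [a1 a2].
have na : 0 < nrm a by rewrite nrm_gt0.
have nb : 0 < nrm b by rewrite nrm_gt0.
set n := nrm a * nrm b; set d := dot a b; set c := cross a b.
have n0 : 0 < n by exact: mulr_gt0.
have cd : c ^+ 2 = n ^+ 2 - d ^+ 2 by rewrite -cross_dot addrK.
have nd : n + d != 0 by rewrite gt_eqF.
have e1 : 1 + (c / (n + d)) ^+ 2 = 2 * n / (n + d).
  by rewrite expr_div_n cd; field.
have e2 : 1 - (c / (n + d)) ^+ 2 = 2 * d / (n + d).
  by rewrite expr_div_n cd; field.
have ec : cos (turn a b) = d / n.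
  rewrite /turn cos_dbl_atan -/n -/d -/c e1 e2; field.
  by rewrite nd gt_eqF.
have es : sin (turn a b) = c / n.
  rewrite /turn sin_dbl_atan -/n -/d -/c e1; field.
  by rewrite nd gt_eqF.
have ed : d = nrm a * (cos A * b.1 + sin A * b.2).
  by rewrite /d /dot {1}a1 {1}a2; ring.
have ecr : c = nrm a * (cos A * b.2 - sin A * b.1).
  by rewrite /c /cross {1}a1 {1}a2; ring.
have s2 : sin A ^+ 2 = 1 - cos A ^+ 2 by rewrite sin2cos2.
split.
  rewrite cosD ec es ed ecr /n.
  have -> : nrm b * (cos A * (nrm a * (cos A * b.1 + sin A * b.2) / (nrm a * nrm b))
     - sin A * (nrm a * (cos A * b.2 - sin A * b.1) / (nrm a * nrm b)))
     = (cos A ^+ 2 + sin A ^+ 2) * b.1.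
    by field; rewrite !gt_eqF.
  by rewrite cos2Dsin2 mul1r.
rewrite sinD ec es ed ecr /n.
have -> : nrm b * (sin A * (nrm a * (cos A * b.1 + sin A * b.2) / (nrm a * nrm b))
     + cos A * (nrm a * (cos A * b.2 - sin A * b.1) / (nrm a * nrm b)))
     = (cos A ^+ 2 + sin A ^+ 2) * b.2.
  by field; rewrite !gt_eqF.
by rewrite cos2Dsin2 mul1r.
Qed.

Lemma nrm_dir A : nrm (cos A, sin A) = 1.
Proof. by rewrite /nrm /= cos2Dsin2 sqrtr1. Qed.

Lemma is_ang_dir A : is_ang (cos A, sin A) A.
Proof. by rewrite /is_ang nrm_dir !mul1r. Qed.

Lemma dir_neq0 A : (cos A, sin A) != 0 :> R * R.
Proof. by rewrite -nrm_gt0 nrm_dir. Qed.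

Lemma is_ang_ex p : exists A, is_ang p A.
Proof.
case: (eqVneq p 0) => [->|p0].
  by exists 0; rewrite /is_ang /nrm /= expr0n /= addr0 sqrtr0 !mul0r.
have h x := @turnP (cos x, sin x) p x (dir_neq0 x) p0.
have : 0 < nrm p + p.1 \/ 0 < nrm p - p.1.
  by have := p0; rewrite -nrm_gt0 => ?; case: (leP 0 p.1) => ?; [left|right]; lra.
case=> hp.
  exists (0 + turn (cos 0, sin 0) p); apply: h (is_ang_dir _).
  by rewrite nrm_dir /dot /= cos0 sin0 !mul1r mul0r addr0.
exists (pi + turn (cos pi, sin pi) p); apply: h (is_ang_dir _).
by rewrite nrm_dir /dot /= cospi sinpi mul1r mul0r addr0 mulN1r.
Qed.

Lemma is_ang_eq p A B : p != 0 -> is_ang p A -> is_ang p B -> cos (A - B) = 1.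
Proof.
rewrite -nrm_gt0 => n0 [h1 h2] [h3 h4].
have e1 : cos A = cos B.
  by apply: (mulfI (lt0r_neq0 n0)); rewrite -h1 -h3.
have e2 : sin A = sin B.
  by apply: (mulfI (lt0r_neq0 n0)); rewrite -h2 -h4.
by rewrite cosB e1 e2 -!expr2 cos2Dsin2.
Qed.

Lemma is_ang_shift p A B : cos (A - B) = 1 -> is_ang p B -> is_ang p A.
Proof.
move=> h [h1 h2].
have s : sin (A - B) = 0 by apply: cos1sin0; rewrite h normr1.
have -> : A = (A - B) + B by rewrite subrK.
split; first by rewrite cosD h s mul0r mul1r subr0.
by rewrite sinD h s mul0r mul1r add0r.
Qed.

Definition lifts (f : R -> R * R) (L : R -> R) : Prop :=
  continuous L /\ forall t, 0 <= t <= 1 -> is_ang (f t) (L t).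

Lemma cos_eq1_small (x : R) : 0 < x <= pi -> cos x < 1.
Proof.
move=> /andP[x0 xpi]; rewrite -(@cos0 R) ltr_cos ?in_itv /= ?lexx ?pi_ge0 //.
by rewrite (ltW x0).
Qed.

Lemma cos1_const (g : R -> R) : continuous g ->
  (forall t, 0 <= t <= 1 -> cos (g t) = 1) -> g 1 = g 0.
Proof.
wlog le01 : g / g 0 <= g 1.
  move=> H cg h; have [le|/ltW le] := leP (g 0) (g 1); first exact: H.
  have := H (fun x => - g x); rewrite lerN2 => /(_ le) H'.
  apply: oppr_inj; apply: H' => [x|t /h]; last by rewrite cosN.
  by apply: cvgN; exact: cg.
move=> cg h; apply/eqP; rewrite eq_le le01 andbT leNgt; apply/negP => lt01.
pose v := Num.min (g 1) (g 0 + pi).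
have v0 : 0 < v - g 0 <= pi.
  by rewrite /v; have := @pi_gt0 R; case: (ltP (g 1) (g 0 + pi)) => ? ?; lra.
have [t t01 tv] : exists2 t, t \in `[0, 1] & g t = v.
  apply: IVT => //; first exact: continuous_subspaceT.
  rewrite min_l // max_r // /v ge_min lexx andbT le_min le01 /=.
  by rewrite lerDl pi_ge0.
have := cos_eq1_small v0.
have h0 : cos (g 0) = 1 by apply: h; rewrite lexx ler01.
have s0 : sin (g 0) = 0 by apply: cos1sin0; rewrite h0 normr1.
rewrite cosB -tv h; last by rewrite in_itv in t01.
by rewrite h0 s0 mulr0 addr0 mulr1 ltxx.
Qed.

Lemma lifts_uniq (f f' : R -> R * R) (L L' : R -> R) :
  (forall t, 0 <= t <= 1 -> f t != 0) ->
  (forall t, 0 <= t <= 1 -> exists2 l, 0 < l & f' t = (l * (f t).1, l * (f t).2)) ->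
  lifts f L -> lifts f' L' -> L' 1 - L' 0 = L 1 - L 0.
Proof.
move=> f0 ff' [cL hL] [cL' hL'].
have : (fun t => L' t - L t) 1 = (fun t => L' t - L t) 0.
  apply: (@cos1_const (fun t => L' t - L t)) => [x|t t01].
    by apply: cvgB; [exact: cL'|exact: cL].
  have [l l0 e] := ff' t t01.
  apply: is_ang_eq (f0 t t01) _ (hL t t01).
  have [h1 h2] := hL' t t01.
  have nl : nrm (f' t) = l * nrm (f t).
    rewrite e /nrm /= !exprMn -mulrDr sqrtrM ?sqr_ge0 // sqrtr_sqr.
    by rewrite gtr0_norm.
  by split; apply: (mulfI (lt0r_neq0 l0)); rewrite mulrA -nl -?h1 -?h2 e.
by move=> /= /eqP; rewrite subr_eq => /eqP ->; ring.
Qed.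

(* The angle swept by f around 0, and 0 if f has no continuous argument. *)
Definition var (f : R -> R * R) : R :=
  xget 0 [set v | exists2 L, lifts f L & v = L 1 - L 0].

Lemma varE f L : (forall t, 0 <= t <= 1 -> f t != 0) -> lifts f L ->
  var f = L 1 - L 0.
Proof.
move=> f0 hL; rewrite /var; case: xgetP => [v _ [L' hL' ->]|]; last first.
  by move=> /(_ (L 1 - L 0)) []; exists L.
apply: (lifts_uniq f0 _ hL hL') => t _; exists 1 => //.
by rewrite !mul1r; case: (f t).
Qed.

Definition clamp (t : R) : R := Num.max 0 (Num.min t 1).

Lemma clamp_itv t : 0 <= clamp t <= 1.
Proof.
rewrite /clamp le_max lexx /= ge_max ler01 /= ge_min lexx.
by rewrite orbT.
Qed.

Lemma clampE t : 0 <= t <= 1 -> clamp t = t.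
Proof. by move=> /andP[t0 t1]; rewrite /clamp (min_l t1) (max_r t0). Qed.

Lemma clamp_cont : continuous clamp.
Proof.
have -> : clamp = cst 0 \max (id \min cst 1) by [].
move=> x; apply: continuous_max; first exact: cvg_cst.
by apply: continuous_min; [exact: cvg_id|exact: cvg_cst].
Qed.

Section Limits.
Variables (T : Type) (F : set_system T).
Hypothesis FF : Filter F.
Variables (u v : T -> R * R) (a b : R * R).
Hypotheses (ua : u @ F --> a) (vb : v @ F --> b).

Lemma cvg_1 : (fun y => (u y).1) @ F --> a.1.
Proof. by apply: cvg_comp ua _; exact: cvg_fst. Qed.

Lemma cvg_2 : (fun y => (u y).2) @ F --> a.2.
Proof. by apply: cvg_comp ua _; exact: cvg_snd. Qed.

Lemma cvg_nrm : (fun y => nrm (u y)) @ F --> nrm a.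
Proof.
apply: (@cvg_comp _ _ _ (fun y => (u y).1 ^+ 2 + (u y).2 ^+ 2) Num.sqrt).
  by apply: cvgD; apply: cvgM; (apply: cvg_1 || apply: cvg_2).
exact: sqrt_continuous.
Qed.
End Limits.

Section Limits2.
Variables (T : Type) (F : set_system T).
Hypothesis FF : Filter F.
Variables (u v : T -> R * R) (a b : R * R).
Hypotheses (ua : u @ F --> a) (vb : v @ F --> b).

Lemma cvg_dot : (fun y => dot (u y) (v y)) @ F --> dot a b.
Proof.
by apply: cvgD; apply: cvgM; apply: cvg_1 || apply: cvg_2.
Qed.

Lemma cvg_cross : (fun y => cross (u y) (v y)) @ F --> cross a b.
Proof.
by apply: cvgB; apply: cvgM; apply: cvg_1 || apply: cvg_2.
Qed.

Lemma cvg_turn_den : (fun y => nrm (u y) * nrm (v y) + dot (u y) (v y)) @ F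
  --> nrm a * nrm b + dot a b.
Proof.
by apply: cvgD; [apply: cvgM; apply: cvg_nrm|apply: cvg_dot].
Qed.

Lemma cvg_turn : 0 < nrm a * nrm b + dot a b ->
  (fun y => turn (u y) (v y)) @ F --> turn a b.
Proof.
move=> h; apply: cvgM; first exact: cvg_cst.
apply: (@cvg_comp _ _ _ (fun y => cross (u y) (v y) /
   (nrm (u y) * nrm (v y) + dot (u y) (v y))) atan); last exact: continuous_atan.
apply: cvgM; first exact: cvg_cross.
by apply: cvgV; [rewrite gt_eqF|exact: cvg_turn_den].
Qed.
End Limits2.

End Angle.

Section Lift.
Variable R : realType.

Lemma cvg_sum_ord (T : Type) (F : set_system T) (FF : Filter F) n (u : nat -> T -> R)
  (a : nat -> R) :
  (forall k, (k < n)%N -> u k @ F --> a k) ->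
  (fun t => \sum_(k < n) u k t) @ F --> \sum_(k < n) a k.
Proof.
elim: n => [|n IH] h.
  under eq_fun do rewrite big_ord0.
  by rewrite big_ord0; exact: cvg_cst.
under eq_fun do rewrite big_ord_recr /=.
rewrite big_ord_recr /=; apply: cvgD; last exact: h.
by apply: IH => k kn; apply: h; rewrite ltnS ltnW.
Qed.

Definition clamp2 (p : R * R) : R * R := (clamp p.1, clamp p.2).
Definition scale2 (c : R) (p : R * R) : R * R := (c * p.1, c * p.2).

Lemma cvg2 (T : Type) (F : set_system T) (FF : Filter F) (u1 u2 : T -> R) (a : R * R) :
  u1 @ F --> a.1 -> u2 @ F --> a.2 -> (fun t => (u1 t, u2 t)) @ F --> a.
Proof. by case: a => a1 a2 /= h1 h2; apply: (cvg_pair h1 h2). Qed.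

Lemma clamp2_cont : continuous clamp2.
Proof.
move=> p; apply: cvg2.
  by apply: (@cvg_comp _ _ _ fst (@clamp R)); [exact: cvg_fst|exact: clamp_cont].
by apply: (@cvg_comp _ _ _ snd (@clamp R)); [exact: cvg_snd|exact: clamp_cont].
Qed.

Lemma scale2_cont c : continuous (scale2 c).
Proof.
by move=> p; apply: cvg2; apply: cvgM; (exact: cvg_cst || exact: cvg_fst || exact: cvg_snd).
Qed.

Variable F : R * R -> R * R.
Hypothesis F0 : forall p, F p != 0.
Hypothesis cF : continuous F.

Let K : set (R * R) := `[0, 1] `*` `[0, 1].

Lemma turn_small : exists2 d : R, 0 < d & forall p q : R * R, 0 <= p.1 <= 1 -> 0 <= p.2 <= 1 ->
  `|p.1 - q.1| < d -> `|p.2 - q.2| < d -> 0 < nrm (F p) * nrm (F q) + dot (F p) (F q).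
Proof.
have cK : compact K by apply: compact_setX; exact: segment_compact.
pose P (d : R) (p : R * R) := forall q, `|p.1 - q.1| < d -> `|p.2 - q.2| < d ->
   0 < nrm (F p) * nrm (F q) + dot (F p) (F q).
have : \forall d \near (0 : R)^'+, K `<=` P d.
  move/compact_near_coveringP : cK; apply => x _.
  have h : 0 < nrm (F x) * nrm (F x) + dot (F x) (F x).
    have n0 : 0 < nrm (F x) by rewrite nrm_gt0.
    by rewrite ltr_wpDr ?mulr_gt0 // /dot -!expr2 addr_ge0 ?sqr_ge0.
  pose G (z : (R * R) * (R * R)) :=
    nrm (F z.1) * nrm (F z.2) + dot (F z.1) (F z.2).
  have cG : G @ (x, x) --> G (x, x).
    apply: cvg_turn_den.
      by apply: (@cvg_comp _ _ _ fst F); [exact: cvg_fst|exact: cF].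
    by apply: (@cvg_comp _ _ _ snd F); [exact: cvg_snd|exact: cF].
  have nG : nbhs (x, x) [set z | 0 < G z].
    have := cvgr_gt (G (x, x)) cG 0; apply.
    exact: h.
  have [e /= e0 he] := (nbhs_ballP _ _).1 nG.
  have e20 : 0 < e / 2 by apply: divr_gt0.
  exists (ball x (e / 2), [set d : R | d < e / 2]) => /=.
    split; first by apply/nbhs_ballP; exists (e / 2).
    exact: nbhs_right_lt.
  move=> [x' d] /= [[b1 b2] de] q h1 h2.
  apply: (he (x', q)); split; split => /=.
  - by apply: le_ball b1; lra.
  - by apply: le_ball b2; lra.
  - rewrite /ball /= in b1 *.
    by rewrite -(subrK x'.1 x.1) -addrA (le_lt_trans (ler_normD _ _)) //; lra.
  - rewrite /ball /= in b2 *.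
    by rewrite -(subrK x'.2 x.2) -addrA (le_lt_trans (ler_normD _ _)) //; lra.
move=> H.
have [d [Hd d0]] : exists d, K `<=` P d /\ 0 < d.
  have : \forall d \near (0 : R)^'+, K `<=` P d /\ 0 < d.
    by apply: filterI; [exact: H|exact: nbhs_right_gt].
  by move=> h; have [d ?] := @filter_ex _ _ (at_right_proper_filter 0) _ h; exists d.
exists d => // p q h1 h2; apply: Hd.
by split; rewrite /= in_itv.
Unshelve. all: by end_near. Qed.

Lemma lift2 : exists2 L : R * R -> R, continuous L &
  forall p : R * R, 0 <= p.1 <= 1 -> 0 <= p.2 <= 1 -> is_ang (F p) (L p).
Proof.
have [d d0 hd] := turn_small.
have [N hN] : exists N : nat, d^-1 < N.+1%:R.
  by exists (Num.truncn d^-1); apply: truncnS_gt.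
have Nd : N.+1%:R^-1 < d by rewrite -(invrK d) ltf_pV2 // posrE ?invr_gt0.
have [A0 hA0] := is_ang_ex (F 0).
pose G k p := F (scale2 (k%:R / N.+1%:R) (clamp2 p)).
have cG k : continuous (G k).
  move=> p; apply: (@cvg_comp _ _ _ (fun p => scale2 (k%:R / N.+1%:R) (clamp2 p)) F);
    last exact: cF.
  apply: (@cvg_comp _ _ _ clamp2 (scale2 (k%:R / N.+1%:R))); last exact: scale2_cont.
  exact: clamp2_cont.
have hG k p : (k < N.+1)%N -> 0 < nrm (G k p) * nrm (G k.+1 p) + dot (G k p) (G k.+1 p).
  move=> kN; have ki : 0 <= (k%:R / N.+1%:R : R) <= 1.
    by rewrite divr_ge0 //= ler_pdivrMr // mul1r ler_nat ltnW.
  have st (t : R) : `|k%:R / N.+1%:R * clamp t - k.+1%:R / N.+1%:R * clamp t| < d.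
    rewrite -mulrBl -mulrBl -opprB -natrB // subSnn mulN1r mulNr normrN.
    have := clamp_itv t => /andP[t0 t1].
    rewrite ger0_norm ?mulr_ge0 // ?invr_ge0 //; apply: le_lt_trans Nd.
    by rewrite ler_piMr // invr_ge0.
  have it (t : R) : 0 <= k%:R / N.+1%:R * clamp t <= 1.
    move/andP: ki => [k0 k1]; have /andP[t0 t1] := clamp_itv t.
    by rewrite mulr_ge0 //= mulr_ile1.
  by apply: hd; rewrite /= ?it ?st.
pose L p := A0 + \sum_(k < N.+1) turn (G k p) (G k.+1 p).
have hL n p : (n <= N.+1)%N -> is_ang (G n p) (A0 + \sum_(k < n) turn (G k p) (G k.+1 p)).
  elim: n => [|n IH] nN.
    by rewrite big_ord0 addr0 /G mul0r /scale2 !mul0r.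
  rewrite big_ord_recr /= addrA; apply: turnP; [exact: F0|exact: F0|exact: hG|exact: IH (ltnW nN)].
exists L => [p|p p1 p2].
  apply: cvgD; first exact: cvg_cst.
  apply: (@cvg_sum_ord _ (nbhs p) _ N.+1 (fun k q => turn (G k q) (G k.+1 q))
    (fun k => turn (G k p) (G k.+1 p))) => k kN.
  by apply: cvg_turn; [exact: cG|exact: cG|exact: hG].
have e : G N.+1 p = F p.
  by rewrite /G divff ?pnatr_eq0 // /scale2 /clamp2 /= !mul1r !clampE // -surjective_pairing.
by rewrite -e; exact: hL.
Qed.

End Lift.

Section Var.
Variable R : realType.
Implicit Types (f : R -> R * R) (P Q : R -> R * R).

Lemma cvgB2 (T : Type) (F : set_system T) (FF : Filter F) (u v : T -> R * R) (a b : R * R) :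
  u @ F --> a -> v @ F --> b -> (fun t => u t - v t) @ F --> a - b.
Proof.
by move=> h1 h2; apply: cvg2; apply: cvgB; (apply: cvg_1 || apply: cvg_2).
Qed.

Lemma lifts_ex f : continuous f -> (forall t, f t != 0) -> exists L, lifts f L.
Proof.
move=> cf f0; have [|L cL hL] := @lift2 R (fun p => f p.1) (fun p => f0 p.1).
  by move=> p; apply: (@cvg_comp _ _ _ fst f); [exact: cvg_fst|exact: cf].
exists (fun t => L (t, 0)); split=> [t|t t01].
  apply: (@cvg_comp _ _ _ (fun t : R => (t, 0 : R)) L); last exact: cL.
  by apply: cvg2; [exact: cvg_id|exact: cvg_cst].
by apply: (hL (t, 0)) => //=; rewrite lexx ler01.
Qed.

Lemma var_neg f : continuous f -> (forall t, f t != 0) -> var (fun t => - f t) = var f.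
Proof.
move=> cf f0; have [L hL] := lifts_ex cf f0.
rewrite (varE _ hL) // (@varE _ _ (fun t => L t + pi)).
- by ring.
- by move=> t _; rewrite oppr_eq0.
case: hL => cL hL; split=> [t|t /hL [h1 h2]].
  by apply: cvgD; [exact: cL|exact: cvg_cst].
have nN : nrm (- f t) = nrm (f t) by rewrite /nrm /= !sqrrN.
by split; rewrite nN /= ?cosDpi ?sinDpi mulrN -?h1 -?h2.
Qed.

Lemma var_rev f : continuous f -> (forall t, f t != 0) ->
  var (fun t => f (1 - t)) = - var f.
Proof.
move=> cf f0; have [L hL] := lifts_ex cf f0.
rewrite (varE _ hL) // (@varE _ _ (fun t => L (1 - t))).
- by rewrite subrr subr0 opprB.
- by move=> t _.
case: hL => cL hL; split=> [t|t t01]; last by apply: hL; lra.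
apply: (@cvg_comp _ _ _ (fun t => 1 - t) L); last exact: cL.
by apply: cvgB; [exact: cvg_cst|exact: cvg_id].
Qed.

Lemma var_square (F : R * R -> R * R) : continuous F -> (forall p, F p != 0) ->
  var (fun s => F (s, 0)) + var (fun t => F (1, t))
  = var (fun t => F (0, t)) + var (fun s => F (s, 1)).
Proof.
move=> cF F0; have [L cL hL] := lift2 F0 cF.
have h1 (c : R) : 0 <= c <= 1 -> lifts (fun s => F (s, c)) (fun s => L (s, c)).
  move=> c01; split=> [t|t t01]; last exact: (hL (t, c)).
  apply: (@cvg_comp _ _ _ (fun t : R => (t, c)) L); last exact: cL.
  by apply: cvg2; [exact: cvg_id|exact: cvg_cst].
have h2 (c : R) : 0 <= c <= 1 -> lifts (fun s => F (c, s)) (fun s => L (c, s)).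
  move=> c01; split=> [t|t t01]; last exact: (hL (c, t)).
  apply: (@cvg_comp _ _ _ (fun t : R => (c, t)) L); last exact: cL.
  by apply: cvg2; [exact: cvg_cst|exact: cvg_id].
have i0 : 0 <= (0 : R) <= 1 by rewrite lexx ler01.
have i1 : 0 <= (1 : R) <= 1 by rewrite lexx ler01.
rewrite (varE _ (h1 0 i0)) // (varE _ (h1 1 i1)) // (varE _ (h2 0 i0)) //.
by rewrite (varE _ (h2 1 i1)) //; ring.
Qed.

Definition wnd P (x : R * R) : R := var (fun t => P t - x).

Lemma wnd_sym P Q : continuous P -> continuous Q -> (forall s t, P s != Q t) ->
  wnd P (Q 1) - wnd P (Q 0) = wnd Q (P 1) - wnd Q (P 0).
Proof.
move=> cP cQ PQ; pose F (p : R * R) := P p.1 - Q p.2.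
have cF : continuous F.
  move=> p; apply: cvgB2.
    by apply: (@cvg_comp _ _ _ fst P); [exact: cvg_fst|exact: cP].
  by apply: (@cvg_comp _ _ _ snd Q); [exact: cvg_snd|exact: cQ].
have F0 p : F p != 0 by rewrite subr_eq0.
have e (c : R) : var (fun t => F (c, t)) = wnd Q (P c).
  rewrite /F /wnd /= -[RHS]var_neg.
  - by congr var; apply/funext => t; rewrite opprB.
  - by move=> t; apply: cvgB2; [exact: cQ|exact: cvg_cst].
  by move=> t; rewrite subr_eq0 eq_sym.
by have := var_square cF F0; rewrite !e /wnd /F /=; lra.
Qed.

Lemma wnd_rev P x : continuous P -> (forall t, P t != x) ->
  wnd (fun t => P (1 - t)) x = - wnd P x.
Proof.
move=> cP P0; rewrite /wnd -(@var_rev (fun t => P t - x)) //.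
  by move=> t; apply: cvgB2; [exact: cP|exact: cvg_cst].
by move=> t; rewrite subr_eq0.
Qed.

Definition dir (a : R) : R * R := (cos a, sin a).

Lemma var_cut f (mu : R) : continuous f -> (forall t, f t != 0) ->
  (forall t, 0 <= t <= 1 -> 0 < nrm (f t) + dot (dir mu) (f t)) ->
  var f = turn (dir mu) (f 1) - turn (dir mu) (f 0).
Proof.
move=> cf f0 h.
pose L (t : R) := mu + turn (dir mu) (f (clamp t)).
have h' t : 0 < nrm (dir mu) * nrm (f (clamp t)) + dot (dir mu) (f (clamp t)).
  by rewrite nrm_dir mul1r; apply: h; exact: clamp_itv.
rewrite (@varE _ _ L) => [|//|].
  by rewrite /L !clampE ?lexx ?ler01 //; ring.
split=> [t|t t01].
  apply: cvgD; first exact: cvg_cst.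
  apply: cvg_turn; [exact: cvg_cst| |exact: h'].
  apply: (@cvg_comp _ _ _ (@clamp R) f); last exact: cf.
  exact: clamp_cont.
by rewrite /L clampE //; apply: turnP; rewrite ?nrm_dir ?mul1r ?dir_neq0 //;
  [exact: h|exact: is_ang_dir].
Qed.

Lemma turn_dir (mu phi l : R) : 0 < l -> - pi < phi < pi ->
  turn (dir mu) (l * cos (mu + phi), l * sin (mu + phi)) = phi.
Proof.
move=> l0 hphi; set b := (_, _).
have nb : nrm b = l.
  rewrite /nrm /= !exprMn -mulrDr cos2Dsin2 mulr1 sqrtr_sqr gtr0_norm //.
have cp : 0 < cos (phi / 2).
  by apply: cos_gt0_pihalf; lra.
have dt : dot (dir mu) b = l * cos phi.
  have := cosB (mu + phi) mu; rewrite addrC addKr => ->.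
  by rewrite /dot /b /=; ring.
have cr : cross (dir mu) b = l * sin phi.
  have := sinB (mu + phi) mu; rewrite addrC addKr => ->.
  by rewrite /cross /b /=; ring.
have e2 : phi = (phi / 2) *+ 2 by rewrite -mulr_natr divfK.
have c2 : 1 + cos phi = 2 * cos (phi / 2) ^+ 2.
  by rewrite {1}e2 cos_mulr2n -mulr_natl; ring.
have s2 : sin phi = 2 * (cos (phi / 2) * sin (phi / 2)).
  by rewrite {1}e2 sin_mulr2n -mulr_natl.
rewrite /turn nrm_dir mul1r nb dt cr -{2}(mulr1 l) -mulrDr c2 s2.
have -> : l * (2 * (cos (phi / 2) * sin (phi / 2))) / (l * (2 * cos (phi / 2) ^+ 2))
   = tan (phi / 2).
  by rewrite /tan; field; rewrite !gt_eqF.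
by rewrite tanK ?in_itv /=; lra.
Qed.

End Var.

Section Radial.
Variable R : realType.

Definition radial (c : R * R) (r a t : R) : R * R :=
  (c.1 + clamp t * (r * cos a), c.2 + clamp t * (r * sin a)).

Lemma clamp0 : clamp (0 : R) = 0. Proof. by rewrite clampE // lexx ler01. Qed.
Lemma clamp1 : clamp (1 : R) = 1. Proof. by rewrite clampE // lexx ler01. Qed.

Lemma radial0 c r a : radial c r a 0 = c.
Proof. by rewrite /radial clamp0 !mul0r !addr0 -surjective_pairing. Qed.

Lemma radial1 c r a : radial c r a 1 = circle_point c r a.
Proof. by rewrite /radial clamp1 !mul1r. Qed.

Lemma radial_cont c r a : continuous (radial c r a).
Proof.
move=> t; apply: cvg2; apply: cvgD; try exact: cvg_cst;
  by apply: cvgM; [exact: clamp_cont|exact: cvg_cst].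
Qed.

Lemma nrm_radial c r a t : 0 <= r -> nrm (radial c r a t - c) = clamp t * r.
Proof.
move=> r0; have /andP[t0 _] := clamp_itv t.
rewrite /nrm /= -[RHS]ger0_norm ?mulr_ge0 // -sqrtr_sqr; congr Num.sqrt.
have -> : (clamp t * r) ^+ 2 = (clamp t * r) ^+ 2 * (cos a ^+ 2 + sin a ^+ 2).
  by rewrite cos2Dsin2 mulr1.
by ring.
Qed.

Lemma cos_lt1_2pi (a : R) : 0 < a < 2 * pi -> cos a < 1.
Proof.
move=> /andP[a0 a2]; have [ap|ap] := leP a pi; first by apply: cos_eq1_small; rewrite a0.
have -> : cos a = cos (2 * pi - a).
  rewrite -[LHS]cosN -(cosD2pi (- a)); congr cos; rewrite -mulr_natl; ring.
by apply: cos_eq1_small; lra.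
Qed.

Lemma wnd_radial (c : R * R) (r a b : R) : 0 < r -> 0 < b - a < 2 * pi ->
  wnd (radial c r a) (circle_point c r b) = pi / 2 - (b - a) / 2.
Proof.
move=> r0 hab; have c1 := cos_lt1_2pi hab.
set f := fun t => radial c r a t - circle_point c r b.
have fE t : f t = (r * (clamp t * cos a - cos b), r * (clamp t * sin a - sin b)).
  by rewrite /f /radial /circle_point; congr (_, _) => /=; ring.
have cf : continuous f.
  by move=> t; apply: cvgB2; [exact: radial_cont|exact: cvg_cst].
have cosE : cos (b - pi) = - cos b by rewrite -{2}(subrK pi b) cosDpi opprK.
have sinE : sin (b - pi) = - sin b by rewrite -{2}(subrK pi b) sinDpi opprK.
have hd t : 0 < dot (dir (b - pi)) (f t).
  have /andP[t0 t1] := clamp_itv t.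
  have -> : dot (dir (b - pi)) (f t) = r * (1 - clamp t * cos (b - a)).
    rewrite fE /dot /dir /= cosE sinE cosB -(cos2Dsin2 b); ring.
  rewrite mulr_gt0 // subr_gt0.
  have [c0|c0] := leP (cos (b - a)) 0.
    by apply: le_lt_trans ltr01; rewrite mulr_ge0_le0.
  by apply: le_lt_trans c1; rewrite ler_piMl // ltW.
have f0 t : f t != 0.
  apply/eqP => e; have := hd t.
  by rewrite e /dot /= !mulr0 addr0 ltxx.
have h t : 0 <= t <= 1 -> 0 < nrm (f t) + dot (dir (b - pi)) (f t).
  by move=> _; rewrite ltr_wpDl // nrm_ge0.
rewrite /wnd (var_cut cf f0 h) !fE clamp0 clamp1.
have -> : (r * (0 * cos a - cos b), r * (0 * sin a - sin b)) =
    (r * cos (b - pi + 0), r * sin (b - pi + 0)).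
  by rewrite addr0 cosE sinE !mul0r !sub0r.
have p0 := @pi_gt0 R.
rewrite turn_dir //; last lra.
set m := (a + b) / 2; set h2 := (b - a) / 2.
have ea : a = m - h2 by rewrite /m /h2; field.
have eb : b = m + h2 by rewrite /m /h2; field.
have s0 : 0 < sin h2 by apply: sin_gt0_pi; rewrite /h2; lra.
have em : b - pi + (pi / 2 - h2) = m - pi / 2 by rewrite eb; field.
have -> : (r * (1 * cos a - cos b), r * (1 * sin a - sin b)) =
   ((2 * r * sin h2) * cos (b - pi + (pi / 2 - h2)),
     (2 * r * sin h2) * sin (b - pi + (pi / 2 - h2))).
  rewrite em cosBpihalf sinBpihalf ea eb cosB cosD sinB sinD; congr (_, _); ring.
rewrite turn_dir ?subr0 //; first by rewrite !mulr_gt0.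
by rewrite /h2; lra.
Qed.

Lemma wnd_radial2 (c : R * R) (r a b : R) : 0 < r -> 0 < b - a < 2 * pi ->
  wnd (radial c r a) (circle_point c r b) - wnd (radial c r b) (circle_point c r a)
  = pi + a - b.
Proof.
move=> r0 hab; rewrite wnd_radial //.
have -> : circle_point c r a = circle_point c r (a + 2 * pi).
  by rewrite /circle_point mulr_natl cosD2pi sinD2pi.
by rewrite wnd_radial //; [field|lra].
Qed.

Lemma radial2pi (c : R * R) (r a : R) : radial c r (a + 2 * pi) = radial c r a.
Proof.
by apply/funext => t; rewrite /radial mulr_natl cosD2pi sinD2pi.
Qed.

End Radial.

(** * Drawings *)

Section Drawing.
Variables (R : realType) (V D : finType) (o : D -> V) (e : D -> D).
Variables (r : R) (c : V -> R * R) (th : D -> R) (K : D -> R -> R * R).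

Let tip d := circle_point (c (o d)) r (th d).
Let rho d := radial (c (o d)) r (th d).

Hypothesis r0 : 0 < r.
Hypothesis eK : involutive e.
Hypothesis loopless : forall d, o (e d) != o d.
Hypothesis th_itv : forall d, 0 <= th d < 2 * pi.
Hypothesis K_cont : forall d, continuous (K d).
Hypothesis K0 : forall d, K d 0 = tip d.
Hypothesis K_rev : forall d t, K (e d) t = K d (1 - t).
Hypothesis K_disj : forall d g s t, g != d -> g != e d -> K d s != K g t.
Hypothesis K_far : forall d x t, r <= nrm (K d t - c x).
Hypothesis c_far : forall x y, x != y -> 2 * r < nrm (c x - c y).

Lemma K1 d : K d 1 = tip (e d).
Proof. by rewrite -K0 K_rev subr0. Qed.

Lemma neq_e d : e d != d.
Proof. by apply: contra_neq (loopless d) => ->. Qed.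

Lemma rho0 d : rho d 0 = c (o d). Proof. exact: radial0. Qed.
Lemma rho1 d : rho d 1 = tip d. Proof. exact: radial1. Qed.
Lemma rho_cont d : continuous (rho d). Proof. exact: radial_cont. Qed.

Lemma K_rho d g s t : g != d -> g != e d -> K d s != rho g t.
Proof.
move=> gd ged; apply/eqP => h.
have hr := nrm_radial (c (o g)) (th g) t (ltW r0).
have := K_far d (o g) s; rewrite h [nrm _]hr => le1.
have /andP[t0 t1] := clamp_itv t.
have ct : clamp t = 1.
  by apply/eqP; rewrite eq_le t1 /= -(ler_pM2r r0) mul1r.
have hK : K d s = K g 0.
  by rewrite h K0 -rho1 /rho /radial ct clamp1.
by have := K_disj s 0 gd ged; rewrite hK eqxx.
Qed.

Lemma nrm_sym (p q : R * R) : nrm (p - q) = nrm (q - p).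
Proof. by rewrite /nrm /= -(sqrrN (p.1 - q.1)) -(sqrrN (p.2 - q.2)) !opprB. Qed.

Lemma nrmD (p q : R * R) : nrm (p + q) <= nrm p + nrm q.
Proof.
have h : 0 <= nrm p + nrm q by rewrite addr_ge0 ?nrm_ge0.
have : dot p q <= nrm p * nrm q.
  apply: le_trans (ler_norm _) _; rewrite -ler_sqr ?nnegrE ?mulr_ge0 ?nrm_ge0 //.
  by rewrite real_normK ?num_real // -cross_dot lerDr sqr_ge0.
have : nrm (p + q) ^+ 2 = nrm p ^+ 2 + nrm q ^+ 2 + 2 * dot p q.
  by rewrite !nrm_sqr /dot /=; ring.
by move=> h1 h2; rewrite -ler_sqr ?nnegrE ?nrm_ge0 // h1 sqrrD; lra.
Qed.

Lemma rho_rho d g s t : o g != o d -> rho d s != rho g t.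
Proof.
move=> gd; apply/eqP => h; have := c_far gd; rewrite ltNge => /negP; apply.
have -> : c (o g) - c (o d) = (c (o g) - rho g t) + (rho d s - c (o d)).
  by rewrite h addrA subrK.
apply: le_trans (nrmD _ _) _; rewrite nrm_sym.
rewrite !nrm_radial ?(ltW r0) // mulrDl mul1r.
have /andP[_ s1] := clamp_itv s; have /andP[_ t1] := clamp_itv t.
by apply: lerD; rewrite ler_piMl // ltW.
Qed.

Section Cycle.
Variable z : D -> R.
Hypothesis z_e : forall d, z (e d) = - z d.
Hypothesis z_o : forall x, \sum_(g | o g == x) z g = 0.

(* Both darts of an edge contribute its core, hence the factor 1/2. *)
Definition wsum (x : V) : R :=
  2^-1 * (\sum_g z g * wnd (K g) (c x)) +
  \sum_(g | o g != x) z g * wnd (rho g) (c x).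

Let rep d g : R := if g == d then th d + pi
  else th g + (if th g < th d then 2 * pi else 0).
Let ind (b : bool) : R := if b then 1 else 0.
Let M d := \sum_(g | o g == o d) z g * rep d g.

Lemma th_neq d g : o g = o d -> g != d -> th g != th d.
Proof.
move=> og gd; apply/eqP => h.
have ge : g != e d by apply: contra_neq (loopless d) => <-.
by have := K_disj 0 0 gd ge; rewrite !K0 /tip og h eqxx.
Qed.

Lemma th_rep d g : o g = o d -> g != d -> 0 < rep d g - th d < 2 * pi.
Proof.
move=> og gd; rewrite /rep (negbTE gd).
have := th_neq og gd; have := th_itv d; have := th_itv g; have := @pi_gt0 R.
case: (ltgtP (th g) (th d)) => //; lra.
Qed.

Lemma tip_rep d g : g != d -> tip g = circle_point (c (o g)) r (rep d g).
Proof.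
move=> gd; rewrite /rep (negbTE gd) /tip /circle_point.
by case: ifP => _; rewrite ?addr0 // mulr_natl cosD2pi sinD2pi.
Qed.

Lemma rho_rep d g : g != d -> rho g = radial (c (o g)) r (rep d g).
Proof.
move=> gd; rewrite /rep (negbTE gd) /rho.
by case: ifP => _; rewrite ?addr0 // radial2pi.
Qed.

(* The winding around x of the whole drawn edge of d. *)
Let beta d x := wnd (rho d) x + wnd (K d) x - wnd (rho (e d)) x.

Lemma K_avoids d x t : K d t != c x.
Proof.
apply/eqP => h; have := K_far d x t.
rewrite h subrr /nrm /= expr0n /= addr0 sqrtr0 => h2.
by have := lt_le_trans r0 h2; rewrite ltxx.
Qed.

Lemma wnd_Ke d x : (forall t, K d t != x) -> wnd (K (e d)) x = - wnd (K d) x.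
Proof.
move=> h; rewrite -wnd_rev //; congr (wnd _ x).
by apply/funext => t; rewrite K_rev.
Qed.

Lemma beta_e d x : (forall t, K d t != x) -> beta (e d) x = - beta d x.
Proof. by move=> h; rewrite /beta eK wnd_Ke //; lra. Qed.

Lemma core_step d g : g != d -> g != e d ->
  wnd (K g) (c (o (e d))) - wnd (K g) (c (o d)) = beta d (tip (e g)) - beta d (tip g).
Proof.
move=> gd ged.
have dg : d != g by rewrite eq_sym.
have deg : d != e g by apply: contra_neq ged => ->; rewrite eK.
have edg : e d != g by rewrite eq_sym.
have edeg : e d != e g by rewrite (inj_eq (can_inj eK)) eq_sym.
have := wnd_sym (@K_cont g) (@rho_cont d) (fun s t => K_rho s t dg deg).
have := wnd_sym (@K_cont g) (@K_cont d) (fun s t => K_disj s t dg deg).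
have := wnd_sym (@K_cont g) (@rho_cont (e d)) (fun s t => K_rho s t edg edeg).
by rewrite !rho0 !rho1 !K1 !K0 /beta; lra.
Qed.

Lemma radial_step d g : o g != o d -> o g != o (e d) ->
  wnd (rho g) (c (o (e d))) - wnd (rho g) (c (o d)) = beta d (tip g) - beta d (c (o g)).
Proof.
move=> gd ged.
have gd' : g != d by apply: contra_neq gd => ->.
have ged' : g != e d by apply: contra_neq ged => ->.
have := wnd_sym (@rho_cont d) (@rho_cont g) (fun s t => rho_rho s t gd).
have := wnd_sym (@K_cont d) (@rho_cont g) (fun s t => K_rho s t gd' ged').
have := wnd_sym (@rho_cont (e d)) (@rho_cont g) (fun s t => rho_rho s t ged).
by rewrite !rho0 !rho1 !K1 !K0 /beta; lra.
Qed.

Let B d := wnd (K d) (c (o d)) - wnd (rho (e d)) (c (o d)).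

Lemma corner_step d g : o g = o d -> g != d ->
  beta d (tip g) = th d + pi - rep d g + B d + wnd (rho g) (c (o (e d))).
Proof.
move=> og gd.
have ged : g != e d by apply: contra_neq (loopless d) => <-.
have ogd : o g != o (e d) by rewrite og eq_sym.
have := wnd_sym (@K_cont d) (@rho_cont g) (fun s t => K_rho s t gd ged).
have := wnd_sym (@rho_cont (e d)) (@rho_cont g) (fun s t => rho_rho s t ogd).
have := wnd_radial2 (c (o d)) r0 (th_rep og gd).
have -> : wnd (radial (c (o d)) r (th d)) (circle_point (c (o d)) r (rep d g)) =
   wnd (rho d) (tip g) by rewrite (tip_rep gd) og.
have -> : wnd (radial (c (o d)) r (rep d g)) (circle_point (c (o d)) r (th d)) =
   wnd (rho g) (tip d) by rewrite (rho_rep gd) og.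
by rewrite !rho0 !rho1 !K1 !K0 /beta /B og; lra.
Qed.

Lemma wsum_step d : wsum (o d) + M d = wsum (o (e d)) + M (e d).
Proof.
set v := o d; set w := o (e d).
have wv : w != v by exact: loopless.
have ed := neq_e d.
pose b g := if (g == d) || (g == e d) then 0 else beta d (tip g).
pose dl := wnd (K d) (c w) - wnd (K d) (c v).
have be g : wnd (K g) (c w) - wnd (K g) (c v) =
   b (e g) - b g + (ind (g == d) - ind (g == e d)) * dl.
  rewrite /b /ind; case: (eqVneq g d) => [->|gd].
    by rewrite ?eqxx ?orbT ?(eq_sym d (e d)) ?(negbTE ed) /= /dl subrr add0r subr0 mul1r.
  case: (eqVneq g (e d)) => [->|ged] /=.
    by rewrite eK ?eqxx ?orbT /= /dl !wnd_Ke;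
      [ring|move=> ?; exact: K_avoids|move=> ?; exact: K_avoids].
  have -> : (e g == d) = false by apply: contra_neqF ged => /eqP <-; rewrite eK.
  have -> : (e g == e d) = false by rewrite (inj_eq (can_inj eK)) (negbTE gd).
  by rewrite /= core_step //; ring.
pose Q x := if x == v then - (th d + pi) - B d
  else if x == w then th (e d) + pi + B (e d) else - beta d (c x).
pose k1 := B d + wnd (rho d) (c w).
pose k2 := - B (e d) - wnd (rho (e d)) (c v).
have step g :
  ind (o g != w) * wnd (rho g) (c w) - ind (o g != v) * wnd (rho g) (c v) =
  b g + Q (o g) + ind (o g == v) * rep d g - ind (o g == w) * rep (e d) g
  + ind (g == d) * k1 + ind (g == e d) * k2.
  rewrite /b /Q /k1 /k2 /ind; case: (eqVneq (o g) v) => [gv|gv].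
    have gw : (o g == w) = false by rewrite gv eq_sym (negbTE wv).
    have ged : (g == e d) = false by apply: contraFF gw => /eqP ->.
    rewrite gw ged /=; case: (eqVneq g d) => [->|gd] /=.
      by rewrite /rep eqxx; ring.
    by rewrite (corner_step gv gd) -/w; ring.
  have gd : (g == d) = false by apply: contra_neqF gv => /eqP ->.
  rewrite gd; case: (eqVneq (o g) w) => [gw|gw] /=.
    case: (eqVneq g (e d)) => [->|ged] /=.
      by rewrite /rep eqxx; ring.
    have := corner_step gw ged; rewrite beta_e => [|t]; last first.
      by rewrite -K0; apply: K_disj; rewrite ?gd.
    by move=> /(congr1 -%R); rewrite opprK eK => ->; rewrite -/v; ring.
  have ged : (g == e d) = false by apply: contra_neqF gw => /eqP ->.
  rewrite ged /= !mul1r; have := radial_step gv gw; rewrite -/v -/w => ->.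
  by ring.
have S0 : \sum_g z g * b (e g) = - \sum_g z g * b g.
  rewrite (reindex_inj (can_inj eK)) /= -sumrN; apply: eq_bigr => g _.
  by rewrite eK z_e mulNr.
have Sd (h : D) (k : R) : \sum_g z g * (ind (g == h) * k) = z h * k.
  rewrite /ind (bigD1 h) //= eqxx mul1r big1 ?addr0 // => g /negbTE ->.
  by rewrite mul0r mulr0.
have So (u : V) (F : D -> R) : \sum_(g | o g == u) z g * F g =
    \sum_g z g * (ind (o g == u) * F g).
  rewrite big_mkcond; apply: eq_bigr => g _; rewrite /ind; case: ifP => _; first by rewrite mul1r.
  by rewrite mul0r mulr0.
have So' (u : V) : \sum_(g | o g != u) z g * wnd (rho g) (c u) =
    \sum_g z g * (ind (o g != u) * wnd (rho g) (c u)).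
  rewrite big_mkcond; apply: eq_bigr => g _; rewrite /ind; case: ifP => _; first by rewrite mul1r.
  by rewrite mul0r mulr0.
have SQ : \sum_g z g * Q (o g) = 0.
  rewrite (partition_big o xpredT) //= big1 // => x _.
  under eq_bigr => g /eqP -> do [].
  by rewrite -mulr_suml z_o mul0r.
have S1 : \sum_g z g * wnd (K g) (c w) - \sum_g z g * wnd (K g) (c v) =
   - 2 * \sum_g z g * b g + 2 * (z d * dl).
  rewrite -sumrB.
  under eq_bigr => g _ do rewrite -mulrBr be mulrDr mulrBr mulrBl mulrBr.
  rewrite big_split /= !sumrB S0 !Sd z_e; ring.
have S2 : \sum_(g | o g != w) z g * wnd (rho g) (c w) -
     \sum_(g | o g != v) z g * wnd (rho g) (c v) =
   \sum_g z g * b g + M d - M (e d) + z d * k1 + z (e d) * k2.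
  rewrite /M !So' !So -/v -/w -sumrB.
  under eq_bigr => g _ do rewrite -mulrBr step 5!mulrDr mulrN.
  by rewrite !big_split /= sumrN !Sd SQ; ring.
rewrite /wsum -/v -/w.
have : k1 - k2 + dl = 0.
  rewrite /k1 /k2 /B eK -/v -/w (@wnd_Ke d (c w)); last by move=> ?; exact: K_avoids.
  by rewrite /dl; ring.
have := z_e d; move: S1 S2; set s1 := \sum_g _; set s2 := \sum_g _; set s3 := \sum_g _.
set s4 := \sum_(_ | _) _; set s5 := \sum_(_ | _) _ => S1 S2 h1 h2.
have h3 : z d * (k1 - k2 + dl) = 0 by rewrite h2 mulr0.
have h4 : z d * (k1 - k2 + dl) = z d * k1 - z d * k2 + z d * dl by ring.
have h5 : z (e d) * k2 = - (z d * k2) by rewrite h1 mulNr.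
by lra.
Qed.

Definition corner (d : D) : R := wsum (o d) +
  \sum_(g | o g == o d) z g * (th g + if th g <= th d then 2 * pi else 0).

Lemma corner_M d : corner d = wsum (o d) + M d + z d * pi.
Proof.
rewrite /corner /M; move: (wsum _) => W.
rewrite (bigD1 d) //= [in RHS](bigD1 d) //= lexx /rep eqxx.
have -> : \sum_(g | (o g == o d) && (g != d))
    z g * (if g == d then th d + pi else th g + (if th g < th d then 2 * pi else 0)) =
  \sum_(g | (o g == o d) && (g != d)) z g * (th g + (if th g <= th d then 2 * pi else 0)).
  apply: eq_bigr => g /andP[/eqP og gd].
  by rewrite (negbTE gd) lt_neqAle (th_neq og gd).
by ring.
Qed.

Lemma corner_e d : corner d - corner (e d) = 2 * pi * z d.
Proof.
rewrite !corner_M z_e; have := wsum_step d; move: (wsum _) (wsum _) (M _) (M _).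
by move=> a b x y h; have -> : a + x = b + y by []; ring.
Qed.

Lemma corner_next d d' : o d' = o d ->
  (th d < th d' /\ (forall g, o g = o d -> (th g <= th d) || (th d' <= th g))) \/
  (forall g, o g = o d -> th d' <= th g <= th d) ->
  corner d' - corner d = 2 * pi * z d'.
Proof.
move=> od' H; rewrite /corner od' opprD addrACA subrr add0r -sumrB.
have e1 : \sum_(g | o g == o d) (z g * (if g == d' then 2 * pi else 0)) = 2 * pi * z d'.
  rewrite (bigD1 d') ?od' //= eqxx big1 ?addr0; first by rewrite mulrC.
  by move=> g /andP[_ /negbTE ->]; rewrite mulr0.
rewrite -{}e1; case: H => [[lt1 H]|H].
  apply: eq_bigr => g /eqP og; rewrite -mulrBr opprD addrACA subrr add0r.
  case: (eqVneq g d') => [->|gd'].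
    by rewrite lexx leNgt lt1 subr0.
  have gd2 : th g != th d' by apply: th_neq => //; rewrite og.
  case: (leP (th g) (th d)) => h; first by rewrite (le_trans h (ltW lt1)) subrr.
  have := H g og; rewrite leNgt h /= => h2.
  by rewrite leNgt lt_neqAle eq_sym gd2 h2 /= subrr.
have -> : \sum_(g | o g == o d) z g * (if g == d' then 2 * pi else 0) =
  \sum_(g | o g == o d) (z g * (if g == d' then 2 * pi else 0) - z g * (2 * pi)).
  by rewrite sumrB -mulr_suml z_o mul0r subr0.
apply: eq_bigr => g /eqP og; have /andP[h1 h2] := H g og.
rewrite -!mulrBr opprD addrACA subrr add0r h2.
case: (eqVneq g d') => [->|gd']; first by rewrite lexx.
have gd2 : th g != th d' by apply: th_neq => //; rewrite og.
by rewrite leNgt lt_neqAle eq_sym gd2 h1.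
Qed.

End Cycle.
End Drawing.

(** * Euler's inequality *)

Section OrbitSums.
Variables (R : realFieldType) (D : finType).

Definition orbit_mx (s : {perm D}) : 'M[R]_(#|D|, #|porbits s|) :=
  \matrix_(i, j) if porbit s (enum_val i) == enum_val j then 1 else 0.

Lemma orbit_mx1 s (a : R) : orbit_mx s *m const_mx a = (const_mx a : 'cV_#|D|).
Proof.
apply/matrixP => i j; rewrite !mxE.
have h : porbit s (enum_val i) \in porbits s by apply: imset_f.
rewrite (bigD1 (enum_rank_in h (porbit s (enum_val i)))) //= !mxE enum_rankK_in //.
rewrite eqxx mul1r big1 ?addr0 // => k kn; rewrite !mxE.
case: eqP => [hk|_]; last by rewrite mul0r.
by case/eqP: kn; apply: enum_val_inj; rewrite enum_rankK_in.
Qed.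

Lemma orbit_sums0 (e n f : {perm D}) : (0 < #|D|)%N ->
  (#|porbits e| + #|porbits n| + #|porbits f| <= #|D|)%N ->
  exists z : D -> R, (exists d, z d != 0) /\
    forall s, s \in [:: e; n; f] -> forall x, \sum_(d | porbit s d == porbit s x) z d = 0.
Proof.
move=> D0 le; pose A := row_mx (row_mx (orbit_mx e) (orbit_mx n)) (orbit_mx f).
pose u : 'cV[R]_(#|porbits e| + #|porbits n| + #|porbits f|) :=
  col_mx (col_mx (const_mx 1) (const_mx (-1))) 0.
have Au : A *m u = 0.
  rewrite !mul_row_col mulmx0 addr0 !orbit_mx1.
  by apply/matrixP => i j; rewrite !mxE subrr.
have [d0 _] : exists d : D, d \in D by apply/card_gt0P.
have u0 : u != 0.
  apply/eqP => /matrixP h.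
  have hd : porbit e d0 \in porbits e by apply: imset_f.
  have := h (lshift _ (lshift _ (enum_rank_in hd (porbit e d0)))) 0.
  by rewrite !(col_mxEu, mxE) => /eqP; rewrite oner_eq0.
have rA : (\rank A < #|D|)%N.
  apply: leq_trans le.
  have : ~~ row_free A^T.
    apply/negP => /row_freeP [B hB].
    have : u^T *m A^T = 0 by rewrite -trmx_mul Au trmx0.
    move=> /(congr1 (mulmx^~ B)); rewrite -mulmxA hB mulmx1 mul0mx.
    by move=> /(congr1 trmx); rewrite trmxK trmx0 => /eqP; rewrite (negbTE u0).
  by rewrite /row_free mxrank_tr ltn_neqAle => -> /=; exact: rank_leq_col.
have : kermx A != 0 by rewrite kermx_eq0 /row_free neq_ltn rA.
case/rowV0Pn => v /sub_kermxP vA v0.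
exists (fun d => v 0 (enum_rank d)); split.
  have [i vi] : exists i, v 0 i != 0.
    apply/existsP; apply: contraR v0 => /existsPn h; apply/eqP/matrixP => i j.
    by rewrite ord1 mxE; apply/eqP; have := h j; rewrite negbK.
  by exists (enum_val i); rewrite enum_valK.
have hs s : v *m orbit_mx s = 0 -> forall x,
    \sum_(d | porbit s d == porbit s x) v 0 (enum_rank d) = 0.
  move=> vs x; have hx : porbit s x \in porbits s by apply: imset_f.
  have := congr1 (fun M : 'rV_ _ => M 0 (enum_rank_in hx (porbit s x))) vs.
  rewrite !mxE => h; rewrite -[RHS]h big_mkcond (reindex (@enum_val D D)) /=; last first.
    by exists enum_rank => i _; rewrite ?enum_valK ?enum_rankK.
  apply: eq_bigr => i _; rewrite enum_valK mxE enum_rankK_in //.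
  by case: ifP => _; rewrite ?mulr1 ?mulr0.
move: vA; rewrite !mul_mx_row -row_mx0 => /eq_row_mx [].
rewrite -row_mx0 => /eq_row_mx [ve vn] vf s; rewrite !inE.
by move=> /or3P[] /eqP ->; exact: hs.
Qed.

Lemma planar_count (e n f : {perm D}) (k : R) :
  (0 < #|D|)%N -> k != 0 ->
  (forall d, e (e d) = d) -> (forall d, e d != d) -> (forall d, n (f d) = e d) ->
  (forall z : D -> R, (forall d, z (e d) = - z d) ->
     (forall x, \sum_(d | porbit n d == porbit n x) z d = 0) ->
     exists C : D -> R, (forall d, C d - C (e d) = k * z d) /\
       (forall d, C (n d) - C d = k * z (n d))) ->
  (#|D| < #|porbits e| + #|porbits n| + #|porbits f|)%N.
Proof.
move=> D0 k0 eK en nf H; rewrite ltnNge; apply/negP => /(orbit_sums0 D0).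
move=> [z [[d0 zd0] hz]].
have ze d : z (e d) = - z d.
  have := hz e; rewrite inE eqxx => /(_ isT d).
  rewrite (bigD1 d) //= (bigD1 (e d)) /=; last first.
    by rewrite en andbT eq_porbit_mem; have := mem_porbit e 1 d; rewrite expg1.
  rewrite big1 ?addr0 => [h|g]; first by apply/eqP; rewrite -addr_eq0 addrC h.
  rewrite eq_porbit_mem => /andP[/andP[/porbitP [i gi] gd] ged].
  have : g = d \/ g = e d.
    rewrite gi; elim: i {gi} => [|i [IH|IH]]; first by left; rewrite expg0 perm1.
      by right; rewrite expgSr permM IH.
    by left; rewrite expgSr permM IH eK.
  by case=> h; move: gd ged; rewrite h eqxx.
have zn := hz n; rewrite !inE eqxx orbT in zn.
have zf := hz f; rewrite !inE eqxx !orbT in zf.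
have [C [C1 C2]] := H z ze (zn isT).
have Cf d : C (f d) = C d.
  by have := C2 (f d); rewrite nf ze mulrN -C1; lra.
have Cfo x y : porbit f x == porbit f y -> C x = C y.
  rewrite eq_porbit_mem => /porbitP [i ->].
  by elim: i => [|i IH]; rewrite ?expg0 ?perm1 // expgSr permM Cf.
have S0 : \sum_d z d * C d = 0.
  rewrite (partition_big (porbit f) (mem (porbits f))) /=; last by move=> d _; apply: imset_f.
  apply: big1 => P /imsetP [x _ ->].
  under eq_bigr => d /Cfo -> do [].
  by rewrite -mulr_suml (zf isT) mul0r.
have : k * \sum_d z d ^+ 2 = 0.
  rewrite mulr_sumr.
  under eq_bigr => d _ do rewrite expr2 mulrA -C1 mulrC mulrBr.
  rewrite sumrB S0 sub0r (reindex_inj (@perm_inj _ e)) /=.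
  under eq_bigr => d _ do rewrite eK ze mulNr.
  by rewrite sumrN S0 !oppr0.
move=> /eqP; rewrite mulf_eq0 (negbTE k0) /= psumr_eq0 => [|d _]; last exact: sqr_ge0.
by move=> /allP /(_ d0); rewrite mem_index_enum sqrf_eq0 (negbTE zd0) => /(_ isT).
Qed.

End OrbitSums.

(** * Arcs leaving small discs *)

Section Reals.
Variable R : realType.

Lemma fin_pos (I : finType) (P : I -> R -> Prop) :
  (forall i, exists2 e, 0 < e & forall r, 0 < r <= e -> P i r) ->
  exists2 e, 0 < e & forall i r, 0 < r <= e -> P i r.
Proof.
move=> /(_ _)/cid2 H; pose e i := projT1 (H i).
have e0 i : 0 < e i by rewrite /e; case: (H i).
have He i r : 0 < r <= e i -> P i r by rewrite /e; case: (H i) => x /= _; apply.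
have se0 : 0 <= \sum_i (e i)^-1 by apply: sumr_ge0 => i _; rewrite invr_ge0 ltW.
exists (1 + \sum_i (e i)^-1)^-1; first by rewrite invr_gt0 ltr_pwDl.
move=> i r /andP[r0 rle]; apply: He; rewrite r0 (le_trans rle) //.
rewrite -[leRHS]invrK lef_pV2 ?posrE ?invr_gt0 ?ltr_pwDl //.
rewrite (bigD1 i) //= addrCA lerDl addr_ge0 // sumr_ge0 // => j _.
by rewrite invr_ge0 ltW.
Qed.

Lemma pos_min (g : R -> R) (a b : R) : a <= b -> continuous g ->
  (forall t, a <= t <= b -> 0 < g t) ->
  exists2 m, 0 < m & forall t, a <= t <= b -> m < g t.
Proof.
move=> ab cg g0.
have [c cab hc] := EVT_min ab (continuous_subspaceT cg).
have gc : 0 < g c by apply: g0; move: cab; rewrite in_itv.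
exists (g c / 2); first by apply: divr_gt0.
move=> t tab; apply: lt_le_trans (hc t _); last by rewrite in_itv.
by lra.
Qed.

Lemma last_le (g : R -> R) (a b r : R) : a <= b -> continuous g -> g a <= r -> r < g b ->
  exists t, [/\ a <= t < b, g t = r & forall s, t < s <= b -> r < g s].
Proof.
move=> ab cg ga gb.
pose S := `[a, b] `&` [set t | g t <= r].
have cS : compact S.
  apply: (@subclosed_compact _ _ `[a, b]) => [||x []//]; last exact: segment_compact.
  apply: closedI; first exact: interval_closed.
  by apply: (@closed_comp _ _ g [set x | x <= r]) => [t _|]; [exact: cg|exact: closed_le].
have S0 : S !=set0 by exists a; split => //=; rewrite in_itv /= lexx ab.
have cid' : {within S, continuous (@idfun R)} by apply: continuous_subspaceT => x; exact: cvg_id.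
have [t /set_mem [tab tr] ht] := compact_EVT_max S0 cS cid'.
rewrite /= in_itv /= in tab; move/andP: tab => [at_ tb].
have [s sab gs] : exists2 s, s \in `[t, b] & g s = r.
  apply: IVT => //; first exact: continuous_subspaceT.
  by rewrite min_l ?max_r ?(ltW gb) ?(le_trans tr (ltW gb)) // andbT.
have st : s = t.
  move: sab; rewrite in_itv /= => /andP[ts sb].
  apply/le_anti; rewrite ts andbT; apply: ht; rewrite inE; split => /=.
    by rewrite in_itv /= sb (le_trans at_ ts).
  by rewrite gs.
rewrite st in gs; exists t; split => //.
  rewrite at_ lt_neqAle tb andbT; apply: contraTneq gb => <-.
  by rewrite gs ltxx.
move=> x /andP[tx xb]; rewrite ltNge; apply/negP => gx.
have : x <= t.
  by apply: ht; rewrite inE; split => //=; rewrite in_itv /= xb (le_trans at_ (ltW tx)).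
by rewrite leNgt tx.
Qed.

Lemma first_ge (g : R -> R) (a b r : R) : a <= b -> continuous g -> g a < r -> r <= g b ->
  exists t, [/\ a < t <= b, g t = r & forall s, a <= s < t -> g s < r].
Proof.
move=> ab cg ga gb.
have [|||| t [/andP[h1 h2] h3 h4]] := @last_le (fun t => - g (- t)) (- b) (- a) (- r).
- by rewrite lerN2.
- move=> x; apply: cvgN; apply: (@cvg_comp _ _ _ (@GRing.opp R) g); last exact: cg.
  by apply: cvgN; exact: cvg_id.
- by rewrite opprK lerN2.
- by rewrite opprK ltrN2.
exists (- t); split.
- by lra.
- by apply: oppr_inj.
move=> s hs; have := h4 (- s); rewrite opprK ltrN2; apply; lra.
Qed.

Lemma is_ang_ex2 (p : R * R) : exists2 a, 0 <= a < 2 * pi & is_ang p a.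
Proof.
have p0 := @pi_gt0 R.
have [e|ne] := eqVneq p.1 (nrm p).
  exists 0; first by rewrite lexx /=; lra.
  split; first by rewrite cos0 mulr1.
  rewrite sin0 mulr0; apply/eqP; rewrite -sqrf_eq0.
  by have := nrm_sqr p; rewrite -e -[LHS]addr0 => /addrI <-.
have h : 0 < nrm p - p.1.
  rewrite subr_gt0 lt_neqAle ne /=.
  apply: le_trans (ler_norm _) _; rewrite -ler_sqr ?nnegrE ?nrm_ge0 //.
  by rewrite real_normK ?num_real // nrm_sqr lerDl sqr_ge0.
have pn0 : p != 0 by apply: contraTneq ne => ->; rewrite negbK /nrm /= expr0n /= addr0 sqrtr0.
exists (pi + turn (cos pi, sin pi) p).
  have := atan_gtNpi2 (cross (cos pi, sin pi) p /
    (nrm (cos pi, sin pi) * nrm p + dot (cos pi, sin pi) p)).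
  have := atan_ltpi2 (cross (cos pi, sin pi) p /
    (nrm (cos pi, sin pi) * nrm p + dot (cos pi, sin pi) p)).
  by rewrite /turn => ? ?; lra.
apply: turnP (dir_neq0 _) pn0 _ (is_ang_dir _).
by rewrite nrm_dir /dot /= cospi sinpi mul1r mul0r addr0 mulN1r.
Qed.

Lemma clamp_comp_cont (f : R -> R * R) : {within `[0, 1], continuous f} ->
  continuous (fun t => f (clamp t)).
Proof.
move=> /subspace_continuousP cf x.
have h y : `[0, 1]%classic (clamp y : R) by rewrite /= in_itv /= clamp_itv.
apply: (@cvg_comp _ _ _ (@clamp R) f) (cf _ (h x)).
move=> B hB.
have : nbhs x [set y | `[0, 1]%classic (clamp y) -> B (clamp y)] := clamp_cont hB.
by change (nbhs x [set y | `[0, 1]%classic (clamp y) -> B (clamp y)] ->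
  nbhs x [set y | B (clamp y)]); apply: filterS => y; apply; exact: h.
Qed.

Lemma clampN (t : R) : clamp (1 - t) = 1 - clamp t.
Proof.
rewrite /clamp; have [h|h] := leP t 1; have [k|k] := leP 0 t.
- by rewrite min_l ?max_r; lra.
- by rewrite min_r ?max_r; lra.
- by rewrite (max_r ler01) min_l ?max_l; lra.
by lra.
Qed.

End Reals.

Section Embedding.
Variables (R : realType) (G : sgraph) (E : plane_embedding R G).
Implicit Types (u v w x y : G) (r t s a : R).

Definition clarc u v t := arc E u v (clamp t).

Lemma clarc_cont u v : adj u v -> continuous (clarc u v).
Proof. by move=> uv; apply: clamp_comp_cont; exact: arc_continuous. Qed.

Lemma clarc0 u v : adj u v -> clarc u v 0 = pos E u.
Proof. by move=> uv; rewrite /clarc clamp0 arc_start. Qed.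

Lemma clarc_rev u v t : adj u v -> clarc v u t = clarc u v (1 - t).
Proof. by move=> uv; rewrite /clarc arc_rev ?clamp_itv // clampN. Qed.

Definition cdist u v w t := nrm (clarc u v t - pos E w).

Lemma cdist_cont u v w : adj u v -> continuous (cdist u v w).
Proof.
by move=> uv t; apply: cvg_nrm; apply: cvgB2; [exact: clarc_cont|exact: cvg_cst].
Qed.

Lemma cdist_clamp u v w t : cdist u v w t = cdist u v w (clamp t).
Proof. by rewrite /cdist /clarc (clampE (clamp_itv t)). Qed.

Lemma adj_neq u v : adj u v -> u != v.
Proof. by apply: contraTneq => ->; rewrite adj_irrefl. Qed.

Lemma cdist_gt0 u v w t : adj u v -> (0 < t -> t < 1 -> True) ->
  (t <= 0 -> w != u) -> (1 <= t -> w != v) -> 0 < cdist u v w t.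
Proof.
move=> uv _ h0 h1; rewrite nrm_gt0 subr_eq0 /clarc.
have [t0|t0] := leP t 0.
  rewrite /clamp (min_l (le_trans t0 ler01)) (max_l t0) arc_start //.
  by rewrite (inj_eq (@pos_inj _ _ E)) eq_sym h0.
have [t1|t1] := leP 1 t.
  rewrite /clamp (min_r t1) (max_r ler01) arc_end //.
  by rewrite (inj_eq (@pos_inj _ _ E)) eq_sym h1.
rewrite clampE ?(ltW t0) ?(ltW t1) //; apply/eqP.
by apply: arc_avoids_vertices => //; rewrite t0 t1.
Qed.

Definition small r := [/\ 0 < r,
  forall x y, x != y -> 2 * r < nrm (pos E x - pos E y),
  forall u v w t, adj u v -> w != u -> w != v -> r < cdist u v w t &
  forall u v t, adj u v -> 2^-1 <= t -> r < cdist u v u t].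

Lemma small_ex : exists2 r0, 0 < r0 & forall r, 0 < r <= r0 -> small r.
Proof.
have [r1 r10 h1] : exists2 e, 0 < e & forall (i : G * G) r, 0 < r <= e ->
    i.1 != i.2 -> 2 * r < nrm (pos E i.1 - pos E i.2).
  apply: fin_pos => -[x y] /=; have [->|xy] := eqVneq x y.
    by exists 1 => // r _ /negP.
  have n0 : 0 < nrm (pos E x - pos E y).
    by rewrite nrm_gt0 subr_eq0 (inj_eq (@pos_inj _ _ E)).
  by exists (nrm (pos E x - pos E y) / 4) => [|r /andP[h1 h2] _]; lra.
have [r2 r20 h2] : exists2 e, 0 < e & forall (i : G * G * G) r, 0 < r <= e ->
    forall t, adj i.1.1 i.1.2 -> i.2 != i.1.1 -> i.2 != i.1.2 -> r < cdist i.1.1 i.1.2 i.2 t.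
  apply: fin_pos => -[[u v] w] /=.
  have [/and3P[uv wu wv]|h] := boolP [&& adj u v, w != u & w != v]; last first.
    by exists 1 => // r _ t uv wu wv; rewrite uv wu wv in h.
  have [|m m0 hm] := @pos_min R _ 0 1 ler01 (@cdist_cont u v w uv).
    by move=> t _; apply: cdist_gt0.
  exists m => // r /andP[_ rm] t _ _ _; rewrite cdist_clamp.
  exact: le_lt_trans rm (hm _ (clamp_itv t)).
have [r3 r30 h3] : exists2 e, 0 < e & forall (i : G * G) r, 0 < r <= e ->
    forall t, adj i.1 i.2 -> 2^-1 <= t -> r < cdist i.1 i.2 i.1 t.
  apply: fin_pos => -[u v] /=.
  have [uv|h] := boolP (adj u v); last by exists 1 => // r _ t uv; rewrite uv in h.
  have h12 : 2^-1 <= (1 : R) by lra.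
  have [|m m0 hm] := @pos_min R _ 2^-1 1 h12 (@cdist_cont u v u uv).
    move=> t t0; apply: cdist_gt0 => // h; first by lra.
    exact: adj_neq.
  exists m => // r /andP[_ rm] t _ t2; rewrite cdist_clamp.
  apply: le_lt_trans rm (hm _ _); rewrite /clamp.
  have [t1|t1] := leP t 1; first by rewrite max_r; lra.
  by rewrite (max_r ler01); lra.
exists (Num.min r1 (Num.min r2 r3)); first by rewrite !lt_min r10 r20 r30.
move=> r /andP[r0]; rewrite !le_min => /and3P[l1 l2 l3]; split => //.
- by move=> x y; apply: (h1 (x, y)); rewrite r0.
- by move=> u v w t; apply: (h2 (u, v, w)); rewrite r0.
by move=> u v t; apply: (h3 (u, v)); rewrite r0.
Qed.

Definition exit_at u v r a t := [/\ 0 < t < 1, arc E u v t = circle_point (pos E u) r a &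
  forall s, t < s <= 1 -> r < eucl_dist (arc E u v s) (pos E u)].

Lemma exit_leaves u v r a t : exit_at u v r a t ->
  leaves_disc (arc E u v) (pos E u) r a.
Proof. by move=> [h1 h2 h3]; exists t. Qed.

Lemma circle_nrm c r a : 0 <= r -> nrm (circle_point c r a - c) = r.
Proof. by move=> r0; rewrite -radial1 nrm_radial // clamp1 mul1r. Qed.

Lemma exit_ex u v r : small r -> adj u v ->
  exists a t, [/\ 0 <= a < 2 * pi, exit_at u v r a t & t < 2^-1].
Proof.
move=> [r0 _ _ h] uv.
have [||t [/andP[t0 t1] ht hs]] := @last_le R (cdist u v u) 0 1 r ler01 (@cdist_cont u v u uv).
- by rewrite /cdist clarc0 // subrr /nrm /= expr0n /= addr0 sqrtr0 ltW.
- by apply: h => //; lra.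
have t2 : t < 2^-1 by rewrite ltNge; apply/negP => /(h u v t uv); rewrite ht ltxx.
have tp : 0 < t.
  rewrite lt_neqAle t0 andbT; apply/eqP => e; move: ht.
  rewrite -e /cdist clarc0 // subrr /nrm /= expr0n /= addr0 sqrtr0 => e0.
  by rewrite -e0 ltxx in r0.
have ct : clarc u v t = arc E u v t by rewrite /clarc clampE // t0 ltW.
have [a a0 [e1 e2]] := is_ang_ex2 (clarc u v t - pos E u).
exists a, t; split => //; split; first by rewrite tp t1.
  have hn : nrm (clarc u v t - pos E u) = r by exact: ht.
  rewrite hn in e1 e2; rewrite -ct /circle_point -e1 -e2 /=.
  by rewrite [X in (X, _)]addrC subrK [X in (_, X)]addrC subrK -surjective_pairing.
move=> s /andP[ts s1]; have := hs s; rewrite ts s1 => /(_ isT).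
by rewrite /cdist /clarc clampE // s1 andbT (le_trans t0 (ltW ts)).
Qed.

End Embedding.

(** * The cyclic order does not depend on the radius *)

Section Order.
Variable R : realType.

(* Two disjoint curves crossing an annulus, given by angle and radius, keep their
   order: otherwise the difference vector would turn by pi and by -pi along the
   two ways around the unit square. *)
Lemma order_keep (LP LQ rP rQ : R -> R) (r rho : R) :
  continuous LP -> continuous LQ -> continuous rP -> continuous rQ ->
  (forall t, r <= rP t <= rho) -> (forall t, r <= rQ t <= rho) ->
  rP 0 = r -> rQ 0 = r -> rP 1 = rho -> rQ 1 = rho ->
  (forall s t, rP s = rQ t -> LP s != LQ t) ->
  LP 0 < LQ 0 -> LP 1 < LQ 1.
Proof.
move=> cLP cLQ crP crQ hP hQ P0 Q0 P1 Q1 hne lt0; rewrite ltNge le_eqVlt.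
rewrite eq_sym (negbTE (hne 1 1 _)) ?P1 ?Q1 //=; apply/negP => lt1.
pose F (p : R * R) := (LQ p.2 - LP p.1, rQ p.2 - rP p.1).
have cF : continuous F.
  move=> p; apply: cvg2; apply: cvgB.
  - by apply: (@cvg_comp _ _ _ snd LQ); [exact: cvg_snd|exact: cLQ].
  - by apply: (@cvg_comp _ _ _ fst LP); [exact: cvg_fst|exact: cLP].
  - by apply: (@cvg_comp _ _ _ snd rQ); [exact: cvg_snd|exact: crQ].
  by apply: (@cvg_comp _ _ _ fst rP); [exact: cvg_fst|exact: crP].
have F0 p : F p != 0.
  apply/eqP => -[/eqP h1 /eqP h2]; move: h1 h2; rewrite !subr_eq0 => /eqP h1 /eqP h2.
  by have := hne p.1 p.2 (esym h2); rewrite h1 eqxx.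
have c1 (c : R) : continuous (fun s => F (s, c)).
  move=> t; apply: (@cvg_comp _ _ _ (fun t : R => (t, c)) F); last exact: cF.
  by apply: cvg2; [exact: cvg_id|exact: cvg_cst].
have c2 (c : R) : continuous (fun s => F (c, s)).
  move=> t; apply: (@cvg_comp _ _ _ (fun t : R => (c, t)) F); last exact: cF.
  by apply: cvg2; [exact: cvg_cst|exact: cvg_id].
have p0 := @pi_gt0 R.
have up (f : R -> R * R) : continuous f -> (forall t, f t != 0) -> (forall t, 0 <= (f t).2) ->
    var f = turn (dir (pi / 2)) (f 1) - turn (dir (pi / 2)) (f 0).
  move=> cf f0 hf; apply: var_cut => // t _.
  rewrite /dot /dir /= cos_pihalf sin_pihalf mul0r add0r mul1r.
  by rewrite ltr_wpDr ?nrm_gt0.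
have dn (f : R -> R * R) : continuous f -> (forall t, f t != 0) -> (forall t, (f t).2 <= 0) ->
    var f = turn (dir (- (pi / 2))) (f 1) - turn (dir (- (pi / 2))) (f 0).
  move=> cf f0 hf; apply: var_cut => // t _.
  rewrite /dot /dir /= cosN sinN cos_pihalf sin_pihalf mul0r add0r mulN1r.
  by rewrite ltr_wpDr ?nrm_gt0 // oppr_ge0.
have := var_square cF F0.
rewrite (dn (fun s => F (s, 0))) //; last by move=> t; rewrite /= Q0 subr_le0; case/andP: (hP t).
rewrite (dn (fun s => F (1, s))) //; last by move=> t; rewrite /= P1 subr_le0; case/andP: (hQ t).
rewrite (up (fun s => F (0, s))) //; last by move=> t; rewrite /= P0 subr_ge0; case/andP: (hQ t).
rewrite (up (fun s => F (s, 1))) //; last by move=> t; rewrite /= Q1 subr_ge0; case/andP: (hP t).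
set a := LQ 0 - LP 0; set b := LP 1 - LQ 1.
have a0 : 0 < a by rewrite subr_gt0.
have b0 : 0 < b by rewrite subr_gt0.
have e00 : F (0, 0) = (a * cos 0, a * sin 0).
  by rewrite /F /= cos0 sin0 P0 Q0 subrr mulr1 mulr0.
have e11 : F (1, 1) = (b * cos pi, b * sin pi).
  by rewrite /F /= cospi sinpi P1 Q1 subrr mulr0 mulrN1 opprB.
have e11' : F (1, 1) = (b * cos (- pi), b * sin (- pi)).
  by rewrite e11 cosN sinN sinpi oppr0.
have tn (mu phi x l : R) : 0 < l -> - pi < phi < pi -> x = mu + phi ->
    turn (dir mu) (l * cos x, l * sin x) = phi.
  by move=> l0 hphi ->; exact: turn_dir.
have -> : turn (dir (pi / 2)) (F (0, 0)) = - (pi / 2) by rewrite e00; apply: tn => //; lra.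
have -> : turn (dir (- (pi / 2))) (F (0, 0)) = pi / 2 by rewrite e00; apply: tn => //; lra.
have -> : turn (dir (pi / 2)) (F (1, 1)) = pi / 2 by rewrite e11; apply: tn => //; lra.
have -> : turn (dir (- (pi / 2))) (F (1, 1)) = - (pi / 2).
  by rewrite e11'; apply: tn => //; lra.
by lra.
Qed.

Lemma lifts_at (f : R -> R * R) (c a : R) : continuous f -> (forall t, f t != 0) ->
  0 <= c <= 1 -> is_ang (f c) a ->
  exists L, [/\ continuous L, L c = a & forall t, is_ang (f (clamp t)) (L t)].
Proof.
move=> cf f0 c01 ha; have [L [cL hL]] := lifts_ex cf f0.
have h1 := is_ang_eq (f0 c) ha (hL c c01).
exists (fun t => L (clamp t) + (a - L c)); split.
- move=> t; apply: cvgD; last exact: cvg_cst.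
  by apply: (@cvg_comp _ _ _ (@clamp R) L); [exact: clamp_cont|exact: cL].
- by rewrite clampE // addrC subrK.
by move=> t; apply: is_ang_shift (hL _ (clamp_itv t)); rewrite addrAC subrr add0r.
Qed.

End Order.

Section Consistency.
Variables (R : realType) (G : sgraph) (E : plane_embedding R G) (v : G).

Definition ordered_exits (r : R) (s : seq G) := exists theta : nat -> R,
  [/\ (forall i j : nat, (i < j < size s)%N -> theta i < theta j),
      (forall i : nat, (i < size s)%N -> theta i < theta 0%N + 2 * pi) &
      (forall i : nat, (i < size s)%N ->
         leaves_disc (arc E v (nth v s i)) (pos E v) r (theta i))].

Lemma first_hit (w : G) (rho : R) : adj v w -> small E rho ->
  exists sg, [/\ 0 < sg < 1, cdist E v w v sg = rho &
    forall t, 0 <= t < sg -> cdist E v w v t < rho].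
Proof.
move=> vw [r0 _ _ h].
have [||t [/andP[t0 t1] ht hs]]
  := @first_ge R (cdist E v w v) 0 1 rho ler01 (@cdist_cont _ _ E v w v vw).
- by rewrite /cdist clarc0 // subrr /nrm /= expr0n /= addr0 sqrtr0.
- by apply/ltW/h => //; lra.
exists t; split => //; rewrite t0 /= ltNge; apply/negP => t1'.
have := h v w t vw; rewrite ht ltxx; suff -> : 2^-1 <= t by move=> /(_ isT).
by apply: le_trans t1'; lra.
Qed.

(* the part of the arc from the last exit at radius r to the first hit of radius rho *)
Definition piece (w : G) (t sg x : R) := clarc E v w (t + clamp x * (sg - t)) - pos E v.

Section Piece.
Variables (rho : R) (sg : G -> R).
Hypothesis sg_spec : forall w, adj v w -> [/\ 0 < sg w < 1, cdist E v w v (sg w) = rho &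
    forall t, 0 <= t < sg w -> cdist E v w v t < rho].

Definition below (r : R) := 0 < r /\ forall w, adj v w ->
  forall t, sg w <= t <= 1 -> r < cdist E v w v t.

Lemma piece_spec w r a t : adj v w -> below r -> exit_at E v w r a t ->
  let f := piece w t (sg w) in
  [/\ continuous f, (forall x, r <= nrm (f x) <= rho), nrm (f 0) = r, nrm (f 1) = rho &
    [/\ is_ang (f 0) a, f 1 = clarc E v w (sg w) - pos E v &
      forall x, exists2 q, 0 < q < 1 & f x = arc E v w q - pos E v]].
Proof.
move=> vw [r0 br] [/andP[t0 t1] ht hs] f.
have [/andP[s0 s1] sr sl] := sg_spec vw.
have ct q : 0 <= q <= 1 -> clarc E v w q = arc E v w q by move=> h; rewrite /clarc clampE.
have dt : cdist E v w v t = r.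
  by rewrite /cdist ct ?(ltW t0) ?(ltW t1) // ht circle_nrm // ltW.
have tsg : t < sg w.
  rewrite ltNge; apply/negP => h; have := br w vw t; rewrite dt ltxx h (ltW t1).
  by move=> /(_ isT).
have tm x : t <= t + clamp x * (sg w - t) <= sg w.
  have /andP[c0 c1] := clamp_itv x.
  have h : 0 <= sg w - t by rewrite subr_ge0 ltW.
  rewrite lerDl mulr_ge0 //= -lerBrDl.
  by rewrite ler_piMl.
have f0 : f 0 = clarc E v w t - pos E v by rewrite /f /piece clamp0 mul0r addr0.
have f1 : f 1 = clarc E v w (sg w) - pos E v.
  by rewrite /f /piece clamp1 mul1r (addrC t) subrK.
split.
- move=> x; apply: cvgB2; last exact: cvg_cst.
  apply: (@cvg_comp _ _ _ (fun x => t + clamp x * (sg w - t)) (clarc E v w));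
    last exact: clarc_cont.
  apply: cvgD; first exact: cvg_cst.
  by apply: cvgM; [exact: clamp_cont|exact: cvg_cst].
- move=> x; have /andP[h1 h2] := tm x; set q := t + _ in h1 h2.
  change (r <= cdist E v w v q <= rho); apply/andP; split.
    move: h1; rewrite le_eqVlt => /orP[/eqP <-|h1]; first by rewrite dt.
    have q1 : q <= 1 by apply: le_trans h2 (ltW s1).
    have := hs q; rewrite h1 q1 => /(_ isT) /ltW.
    by rewrite /cdist ct // q1 andbT ltW // (lt_trans t0).
  move: h2; rewrite le_eqVlt => /orP[/eqP ->|h2]; first by rewrite sr.
  by apply/ltW/sl; rewrite h2 andbT ltW // (lt_le_trans t0).
- by rewrite f0; exact: dt.
- by rewrite f1; exact: sr.
split => //.
- rewrite /is_ang f0 -/(cdist E v w v t) ; split.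
    have := dt; rewrite /cdist => ->; rewrite ct ?(ltW t0) ?(ltW t1) // ht /=.
    by rewrite addrC addKr.
  have := dt; rewrite /cdist => ->; rewrite ct ?(ltW t0) ?(ltW t1) // ht /=.
  by rewrite addrC addKr.
move=> x; have /andP[h1 h2] := tm x; exists (t + clamp x * (sg w - t)).
  by rewrite (lt_le_trans t0 h1) (le_lt_trans h2 s1).
by rewrite /f /piece ct // (le_trans (ltW t0) h1) (le_trans h2 (ltW s1)).
Qed.

Definition track w r a t L := [/\ exit_at E v w r a t, continuous L, L 0 = a &
  forall x, is_ang (piece w t (sg w) x) (L x)].

Lemma piece_clamp w t y x : piece w t y (clamp x) = piece w t y x.
Proof. by rewrite /piece clampE // clamp_itv. Qed.

Lemma track_from w r a t : adj v w -> below r -> exit_at E v w r a t ->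
  exists L, track w r a t L.
Proof.
move=> vw br ex; have [cf hr _ _ [ha _ _]] := piece_spec vw br ex.
have fn x : piece w t (sg w) x != 0.
  by rewrite -nrm_gt0; apply: lt_le_trans (proj1 br) _; case/andP: (hr x).
have i0 : 0 <= (0 : R) <= 1 by rewrite lexx ler01.
have [L [cL L0 hL]] := lifts_at cf fn i0 ha.
by exists L; split => // x; rewrite -piece_clamp.
Qed.

Lemma track_to w r psi : adj v w -> small E r -> below r ->
  is_ang (clarc E v w (sg w) - pos E v) psi ->
  exists a t L, track w r a t L /\ L 1 = psi.
Proof.
move=> vw sr br hpsi; have [a [t [_ ex _]]] := exit_ex sr vw.
have [cf hr f0 _ [ha f1 hq]] := piece_spec vw br ex.
have fn x : piece w t (sg w) x != 0.
  by rewrite -nrm_gt0; apply: lt_le_trans (proj1 br) _; case/andP: (hr x).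
have i1 : 0 <= (1 : R) <= 1 by rewrite lexx ler01.
rewrite -f1 in hpsi.
have [L [cL L1 hL]] := lifts_at cf fn i1 hpsi.
exists (L 0), t, L; split => //; split => //; last by move=> x; rewrite -piece_clamp.
case: ex => h1 h2 h3; split => //; rewrite h2 /circle_point.
have h := hL 0; rewrite piece_clamp in h.
have := is_ang_eq (fn 0) h ha; move: ha => [e1 e2]; move: h => [e3 e4] _.
by rewrite f0 in e1 e2 e3 e4; rewrite -e1 -e2 -e3 -e4.
Qed.

Lemma track_neq w w' r a t L a' t' L' (k : R) x y :
  cos k = 1 -> adj v w -> adj v w' -> w != w' -> below r ->
  track w r a t L -> track w' r a' t' L' ->
  nrm (piece w t (sg w) x) = nrm (piece w' t' (sg w') y) ->
  L x != L' y + k.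
Proof.
move=> ck vw vw' ww br [ex cL L0 hL] [ex' cL' L0' hL'] hn; apply/eqP => e.
have [_ _ _ _ [_ _ hq]] := piece_spec vw br ex.
have [_ _ _ _ [_ _ hq']] := piece_spec vw' br ex'.
have [h1 h2] := hL x; have [h3 h4] := hL' y.
have sk : sin k = 0 by apply: cos1sin0; rewrite ck normr1.
have ec : cos (L x) = cos (L' y) by rewrite e cosD ck sk mulr1 mulr0 subr0.
have es : sin (L x) = sin (L' y) by rewrite e sinD ck sk mulr1 mulr0 addr0.
have : piece w t (sg w) x = piece w' t' (sg w') y.
  by rewrite [LHS]surjective_pairing [RHS]surjective_pairing h1 h2 h3 h4 hn ec es.
have [q q01 ->] := hq x; have [q' q01' ->] := hq' y => /addIr hh.
have [[_ h]|[h _]] := arc_no_crossing vw vw' q01 q01' hh.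
  by rewrite h eqxx in ww.
by have := adj_neq vw'; rewrite h eqxx.
Qed.

Lemma track_order w w' r a t L a' t' L' (k : R) : cos k = 1 -> adj v w -> adj v w' -> w != w' ->
  below r ->
  track w r a t L -> track w' r a' t' L' ->
  L 0 < L' 0 + k -> L 1 < L' 1 + k.
Proof.
move=> ck vw vw' ww br tr tr'.
have [[ex cL L0 hL] [ex' cL' L0' hL']] := (tr, tr').
have [cf hr f0 f1 _] := piece_spec vw br ex.
have [cf' hr' f0' f1' _] := piece_spec vw' br ex'.
apply: (@order_keep R L (fun x => L' x + k)
  (fun x => nrm (piece w t (sg w) x)) (fun x => nrm (piece w' t' (sg w') x)) r rho) => //.
- by move=> x; apply: cvgD; [exact: cL'|exact: cvg_cst].
- by move=> x; apply: cvg_nrm; exact: cf.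
- by move=> x; apply: cvg_nrm; exact: cf'.
by move=> x y; exact: (track_neq ck vw vw' ww br tr tr').
Qed.

End Piece.

Lemma exits_consistent (s : seq G) : uniq s -> (forall w, w \in s -> adj v w) ->
  exists2 r1, 0 < r1 & forall r r', 0 < r <= r1 -> 0 < r' <= r1 ->
    ordered_exits r s -> ordered_exits r' s.
Proof.
move=> us sv; have [rho rho0 hrho] := small_ex E.
have srho : small E rho by apply: hrho; rewrite rho0 lexx.
have [sg hsg] : {sg : G -> R & forall w, adj v w ->
    [/\ 0 < sg w < 1, cdist E v w v (sg w) = rho &
    forall t, 0 <= t < sg w -> cdist E v w v t < rho]}.
  apply: (@choice _ _ (fun w x => adj v w -> [/\ 0 < x < 1, cdist E v w v x = rho &
    forall t, 0 <= t < x -> cdist E v w v t < rho])) => w.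
  have [vw|h] := boolP (adj v w); last by exists 0.
  by have [x hx] := first_hit vw srho; exists x.
have [m m0 hm] : exists2 e, 0 < e & forall (w : G) r, 0 < r <= e -> adj v w ->
    forall t, sg w <= t <= 1 -> r < cdist E v w v t.
  apply: fin_pos => w; have [vw|h] := boolP (adj v w); last by exists 1.
  have [/andP[s0 s1] _ _] := hsg w vw.
  have [|m m0 hm] := @pos_min R _ (sg w) 1 (ltW s1) (@cdist_cont _ _ E v w v vw).
    move=> t /andP[t1 t2]; apply: cdist_gt0 => // h; last exact: adj_neq.
    by have := lt_le_trans s0 (le_trans t1 h); rewrite ltxx.
  by exists m => // r /andP[_ rm] _ t /hm; exact: le_lt_trans.
exists (Num.min m rho); first by rewrite lt_min m0.
move=> r r' /andP[r0]; rewrite le_min => /andP[rm rr].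
move=> /andP[r0']; rewrite le_min => /andP[rm' rr'] [theta [th1 th2 th3]].
have br : below sg r by split => // w vw t; apply: hm; rewrite // r0.
have br' : below sg r' by split => // w vw t; apply: hm; rewrite // r0'.
have sr' : small E r' by apply: hrho; rewrite r0'.
have sadj i : (i < size s)%N -> adj v (nth v s i) by move=> h; apply: sv; exact: mem_nth.
have [L hL] : {L : nat -> R -> R & forall i, (i < size s)%N ->
    exists t, track sg (nth v s i) r (theta i) t (L i)}.
  apply: (@choice _ _ (fun i L => (i < size s)%N ->
    exists t, track sg (nth v s i) r (theta i) t L)) => i.
  have [h|h] := ltnP i (size s); last by exists (fun=> 0).
  have [t t01 [ht hs]] := th3 i h.
  have ex : exit_at E v (nth v s i) r (theta i) t by split.
  by have [L hL] := track_from hsg (sadj i h) br ex; exists L => _; exists t.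
have [L' hL'] : {L' : nat -> R -> R & forall i, (i < size s)%N ->
    exists a t, track sg (nth v s i) r' a t (L' i) /\ L' i 1 = L i 1}.
  apply: (@choice _ _ (fun i L' => (i < size s)%N ->
    exists a t, track sg (nth v s i) r' a t L' /\ L' 1 = L i 1)) => i.
  have [h|h] := ltnP i (size s); last by exists (fun=> 0).
  have [t [ex _ _ hl]] := hL i h.
  have [_ _ _ _ [_ f1 _]] := piece_spec hsg (sadj i h) br ex.
  have := hl 1; rewrite f1 => hpsi.
  have [a' [t' [L' [h1 h2]]]] := track_to hsg (sadj i h) sr' br' hpsi.
  by exists L' => _; exists a', t'.
have ne i j : (i < size s)%N -> (j < size s)%N -> i != j -> nth v s i != nth v s j.
  by move=> hi hj; rewrite nth_uniq.
have fw i j k : cos k = 1 -> (i < size s)%N -> (j < size s)%N -> i != j ->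
    L i 0 < L j 0 + k -> L i 1 < L j 1 + k.
  move=> ck hi hj ij; have [t ht] := hL i hi; have [t' ht'] := hL j hj.
  exact: (track_order hsg ck (sadj i hi) (sadj j hj) (ne i j hi hj ij) br ht ht').
have bw i j k : cos k = 1 -> (i < size s)%N -> (j < size s)%N -> i != j ->
    L i 1 < L j 1 + k -> L' i 0 < L' j 0 + k.
  move=> ck hi hj ij; have [a [t [ht <-]]] := hL' i hi; have [a' [t' [ht' <-]]] := hL' j hj => h.
  have [ex _ _ _] := ht; have [ex' _ _ _] := ht'.
  have [_ _ f0 _ _] := piece_spec hsg (sadj i hi) br' ex.
  have [_ _ f0' _ _] := piece_spec hsg (sadj j hj) br' ex'.
  have nij := ne i j hi hj ij; have nji := nij; rewrite eq_sym in nji.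
  rewrite lt_neqAle (track_neq hsg ck (sadj i hi) (sadj j hj) nij br' ht ht') ?f0 ?f0' //=.
  rewrite leNgt; apply/negP => h2.
  have ckN : cos (- k) = 1 by rewrite cosN.
  have := track_order hsg ckN (sadj j hj) (sadj i hi) nji br' ht' ht.
  by lra.
have c0 : cos 0 = 1 :> R := cos0 R.
have c2 : cos (2 * pi) = 1 :> R by rewrite mulr_natl cos2pi.
have L0 i : (i < size s)%N -> L i 0 = theta i by move=> hi; have [t []] := hL i hi.
exists (fun i => L' i 0); split.
- move=> i j /andP[ij js]; have is_ := ltn_trans ij js.
  have nij : i != j by rewrite neq_ltn ij.
  rewrite -[ltRHS]addr0; apply: bw => //; apply: fw => //.
  by rewrite addr0 !L0 //; apply: th1; rewrite ij.
- move=> i hi; case: (posnP i) => [->|i0]; first by rewrite ltrDl mulr_gt0 ?pi_gt0.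
  have h0 : (0 < size s)%N by apply: leq_ltn_trans hi.
  have ni : i != 0%N by rewrite -lt0n.
  by apply: bw => //; apply: fw => //; rewrite !L0 //; apply: th2.
move=> i hi; have [a [t [[ex _ e _] _]]] := hL' i hi.
by rewrite e; exact: exit_leaves ex.
Qed.

End Consistency.

(** * The rotation system of an embedding *)

Section Rotation.
Variables (R : realType) (V D : finType) (o : D -> V) (th : D -> R).
Hypothesis th_neq : forall d g, o g = o d -> g != d -> th g != th d.

Definition around (v : V) : seq D :=
  sort (fun d g => th d <= th g) [seq d <- enum D | o d == v].

Lemma mem_around v d : (d \in around v) = (o d == v).
Proof. by rewrite mem_sort mem_filter mem_enum andbT. Qed.

Lemma uniq_around v : uniq (around v).
Proof. by rewrite sort_uniq filter_uniq // enum_uniq. Qed.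

Lemma sorted_around v : sorted (fun d g => th d <= th g) (around v).
Proof. by apply: sort_sorted => d g; exact: le_total. Qed.

Definition rot_next (d : D) : D := next (around (o d)) d.

Lemma rot_next_o d : o (rot_next d) = o d.
Proof. by apply/eqP; rewrite -mem_around mem_next mem_around. Qed.

Lemma rot_next_inj : injective rot_next.
Proof.
move=> d g h; have og : o d = o g by rewrite -rot_next_o h rot_next_o.
move: h; rewrite /rot_next og => h.
by rewrite -(prev_next (uniq_around (o g)) d) h prev_next // uniq_around.
Qed.

Definition rotation : {perm D} := perm rot_next_inj.

Lemma rotation_o d : o (rotation d) = o d.
Proof. by rewrite permE rot_next_o. Qed.

Lemma rotationX_o i d : o ((rotation ^+ i)%g d) = o d.
Proof. by elim: i => [|i IH]; rewrite ?expg0 ?perm1 // expgSr permM rotation_o. Qed.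

Lemma porbit_rotation d g : (g \in porbit rotation d) = (o g == o d).
Proof.
apply/porbitP/eqP => [[i ->]|og]; first exact: rotationX_o.
have hd : d \in around (o d) by rewrite mem_around.
have hg : g \in around (o d) by rewrite mem_around og.
have := fconnect_cycle (cycle_next (uniq_around (o d))) hd g.
rewrite hg => /iter_findex <-; move: (findex _ _ _) => k; exists k.
elim: k => [|k IH]; first by rewrite expg0 perm1.
by rewrite expgSr permM -IH iterS permE /rot_next IH rotationX_o.
Qed.

Lemma rotation_next d :
  (th d < th (rotation d) /\
     (forall g, o g = o d -> (th g <= th d) || (th (rotation d) <= th g))) \/
  (forall g, o g = o d -> th (rotation d) <= th g <= th d).
Proof.
rewrite permE /rot_next; set p := around (o d).
have hd : d \in p by rewrite mem_around.
have sp : {in p &, forall x y, (index x p <= index y p)%N -> th x <= th y}.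
  move=> x y xp yp; have := sorted_leq_index (fun y x z => @le_trans _ R (th y) (th x) (th z)) _.
  by move=> /(_ (fun x => lexx (th x)) _ (sorted_around (o d)) _ _ xp yp).
have mem g : o g = o d -> g \in p by rewrite mem_around => ->.
have [i1|i1] := ltnP (index d p).+1 (size p).
  have e : next p d = nth d p (index d p).+1.
    rewrite next_nth hd; case: (p) i1 => //= y p'.
    by case: eqP => // _ ?; apply: set_nth_default.
  have ei : index (next p d) p = (index d p).+1.
    by rewrite e index_uniq // uniq_around.
  have np : next p d \in p by rewrite mem_next.
  left; split.
    rewrite lt_neqAle sp ?ei // andbT eq_sym; apply: th_neq.
      by apply/eqP; rewrite -mem_around.
    by apply/eqP => h; have := ei; rewrite h => /n_Sn.
  move=> g /mem gp; case: (leqP (index g p) (index d p)) => h.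
    by rewrite sp.
  by rewrite orbC sp // ei.
right => g /mem gp; have [q e] : exists q, p = next p d :: q.
  rewrite next_nth hd; case: (p) hd i1 => //= y p'; case: eqP => [->|_] _.
    by rewrite !ltnS leqn0 size_eq0 => /eqP ->; exists [::].
  by rewrite ltnS => h; exists p'; rewrite nth_default.
have gi : (index g p <= index d p)%N.
  by rewrite -ltnS; apply: leq_trans i1; rewrite index_mem.
have np : next p d \in p by rewrite mem_next.
have i0 : index (next p d) p = 0%N.
  by move: e; move: (next p d) => y ->; rewrite /= eqxx.
by rewrite !sp // i0.
Qed.

End Rotation.

Section Darts.
Variable G : sgraph.

Definition dart : finType := {p : G * G | adj p.1 p.2}.
Definition org (d : dart) : G := (val d).1.
Definition trg (d : dart) : G := (val d).2.

Lemma dart_adj d : adj (org d) (trg d). Proof. exact: valP d. Qed.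

Definition flip (d : dart) : dart :=
  exist _ (trg d, org d) (eq_ind_r is_true (dart_adj d) (adj_sym _ _)).

Lemma flipK : involutive flip.
Proof. by move=> d; apply: val_inj; rewrite /= -surjective_pairing. Qed.

Lemma org_flip d : org (flip d) = trg d. Proof. by []. Qed.
Lemma trg_flip d : trg (flip d) = org d. Proof. by []. Qed.

Lemma dart_eq (d g : dart) : org d = org g -> trg d = trg g -> d = g.
Proof.
by move=> h1 h2; apply: val_inj; rewrite [LHS]surjective_pairing [RHS]surjective_pairing;
  congr (_, _).
Qed.

Lemma org_neq_trg d : trg d != org d.
Proof. by apply: contraTneq (dart_adj d) => ->; rewrite adj_irrefl. Qed.

Lemma card_darts v : #|[set d : dart | org d == v]%SET| = degree v.
Proof.
rewrite -(card_in_imset (f := trg)) => [|d g]; last first.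
  by rewrite !inE => /eqP h1 /eqP h2 /dart_eq; apply; rewrite h1 h2.
apply: eq_card => w; rewrite inE; apply/imsetP/idP => [[d + ->]|vw].
  by rewrite inE => /eqP <-; exact: dart_adj.
by exists (exist _ (v, w) vw : dart); rewrite ?inE.
Qed.

End Darts.

Section Drawn.
Variables (R : realType) (G : sgraph) (E : plane_embedding R G) (r : R).
Hypothesis sr : small E r.
Variables (th tm : dart G -> R).
Hypothesis th_itv : forall d, 0 <= th d < 2 * pi.
Hypothesis tm_exit : forall d, exit_at E (org d) (trg d) r (th d) (tm d).
Hypothesis tm_half : forall d, tm d < 2^-1.

Let r0 : 0 < r. Proof. by case: sr. Qed.

Definition core (d : dart G) (s : R) :=
  clarc E (org d) (trg d) (tm d + clamp s * (1 - tm d - tm (flip d))).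

Lemma core_itv d s : tm d <= tm d + clamp s * (1 - tm d - tm (flip d)) <= 1 - tm (flip d).
Proof.
have := tm_half d; have := tm_half (flip d) => h1 h2; have /andP[c0 c1] := clamp_itv s.
have h : 0 <= 1 - tm d - tm (flip d) by lra.
rewrite lerDl mulr_ge0 //=.
have : clamp s * (1 - tm d - tm (flip d)) <= 1 - tm d - tm (flip d) by rewrite ler_piMl.
by lra.
Qed.

Lemma core_arc d s : exists2 q, 0 < q < 1 & core d s = arc E (org d) (trg d) q.
Proof.
have /andP[h1 h2] := core_itv d s; have [/andP[t0 _] _ _] := tm_exit d.
have [/andP[t0' _] _ _] := tm_exit (flip d).
have h : 0 < tm d + clamp s * (1 - tm d - tm (flip d)) < 1 by lra.
by eexists; first exact: h; rewrite /core /clarc clampE //; lra.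
Qed.

Lemma core_cont d : continuous (core d).
Proof.
move=> x; apply: (@cvg_comp _ _ _ (fun s => tm d + clamp s * (1 - tm d - tm (flip d)))
  (clarc E (org d) (trg d))); last exact: clarc_cont (dart_adj d) _.
apply: cvgD; first exact: cvg_cst.
by apply: cvgM; [exact: clamp_cont|exact: cvg_cst].
Qed.

Lemma core0 d : core d 0 = circle_point (pos E (org d)) r (th d).
Proof.
have [/andP[t0 t1] <- _] := tm_exit d.
by rewrite /core clamp0 mul0r addr0 /clarc clampE // !ltW.
Qed.

Lemma core_rev d t : core (flip d) t = core d (1 - t).
Proof.
rewrite /core flipK org_flip trg_flip clarc_rev; last exact: dart_adj.
by rewrite clampN; congr (clarc _ _ _ _); ring.
Qed.

Lemma core_disj d g s t : g != d -> g != flip d -> core d s != core g t.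
Proof.
move=> gd gfd; apply/eqP; have [q q01 ->] := core_arc d s.
have [q' q01' ->] := core_arc g t => h.
have [[h1 h2]|[h1 h2]] := arc_no_crossing (dart_adj d) (dart_adj g) q01 q01' h.
  by case/eqP: gd; apply: dart_eq.
by case/eqP: gfd; apply: dart_eq.
Qed.

Lemma core_far_org d t : r <= nrm (core d t - pos E (org d)).
Proof.
have /andP[h1 h2] := core_itv d t; have [/andP[t0 t1] ht hs] := tm_exit d.
have [/andP[t0' _] _ _] := tm_exit (flip d).
move: h1; rewrite le_eqVlt => /orP[/eqP h1|h1].
  rewrite /core -h1 /clarc clampE ?(ltW t0) ?(ltW t1) // ht.
  by rewrite circle_nrm // ltW.
apply/ltW; rewrite /core /clarc clampE; last by lra.
by apply: hs; lra.
Qed.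

Lemma core_far d x t : r <= nrm (core d t - pos E x).
Proof.
have [->|xo] := eqVneq x (org d); first exact: core_far_org.
have [->|xt] := eqVneq x (trg d).
  by have := core_far_org (flip d) (1 - t); rewrite core_rev subKr.
by case: sr => _ _ h _; apply/ltW; exact: h (dart_adj d) xo xt.
Qed.

Lemma center_far (x y : G) : x != y -> 2 * r < nrm (pos E x - pos E y).
Proof. by case: sr => _ h _ _; exact: h. Qed.

Lemma angle_neq d g : org g = org d -> g != d -> th g != th d.
Proof.
exact: (@th_neq R G (dart G) (@org G) (@flip G) r (pos E) th core (@org_neq_trg G) core0 core_disj).
Qed.

Definition nxt : {perm dart G} := rotation (@org G) th.
Definition flp : {perm dart G} := perm (can_inj (@flipK G)).
Definition fac : {perm dart G} := (flp * nxt^-1)%g.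

Lemma nxt_fac d : nxt (fac d) = flp d.
Proof. by rewrite permM permKV. Qed.

Lemma embedding_planar : (0 < #|dart G|)%N ->
  (#|dart G| < #|porbits flp| + #|porbits nxt| + #|porbits fac|)%N.
Proof.
move=> D0; have k0 : 2 * pi != 0 :> R by rewrite mulf_neq0 // gt_eqF // pi_gt0.
apply: (@planar_count R _ _ _ _ (2 * pi)) => //.
- by move=> d; rewrite !permE flipK.
- move=> d; rewrite permE; apply/eqP => /(congr1 (@org G)) /eqP.
  by rewrite org_flip (negbTE (org_neq_trg d)).
- exact: nxt_fac.
move=> z ze zo.
have ze' d : z (flip d) = - z d by rewrite -ze permE.
have zo' (v : G) : \sum_(g | org g == v) z g = 0.
  have [d dv|h] := pickP (fun g => @org G g == v); last by rewrite big_pred0.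
  rewrite -[RHS](zo d); apply: eq_bigl => g.
  by rewrite eq_porbit_mem porbit_rotation (eqP dv).
exists (corner (@org G) r (pos E) th core z); split=> d.
  rewrite permE; apply: corner_e => //.
  - exact: flipK.
  - by move=> x; exact: org_neq_trg.
  - exact: core_cont.
  - exact: core0.
  - exact: core_rev.
  - exact: core_disj.
  - exact: core_far.
  exact: center_far.
apply: (@corner_next R G (dart G) (@org G) (@flip G)) => //.
- by move=> x; exact: org_neq_trg.
- exact: core0.
- exact: core_disj.
- exact: rotation_o.
by apply: rotation_next; exact: angle_neq.
Qed.

Lemma card_porbit_nxt d : #|porbit nxt d| = degree (org d).
Proof.
by rewrite -card_darts; apply: eq_card => g; rewrite porbit_rotation inE.
Qed.

Definition star (d : dart G) := [seq trg g | g <- traject nxt d #|porbit nxt d|].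

Lemma star_uniq d : uniq (star d).
Proof.
rewrite map_inj_in_uniq ?uniq_traject_porbit // => g h.
rewrite -!porbit_traject !porbit_rotation => /eqP h1 /eqP h2.
by apply: dart_eq; rewrite h1.
Qed.

Lemma mem_star d w : (w \in star d) = adj (org d) w.
Proof.
apply/mapP/idP => [[g + ->]|dw].
  by rewrite -porbit_traject porbit_rotation => /eqP <-; exact: dart_adj.
exists (exist _ (org d, w) dw : dart G) => //.
by rewrite -porbit_traject porbit_rotation.
Qed.

Lemma star_exits d : ordered_exits E (org d) r (star d).
Proof.
pose rep g := th g + (if th g < th d then 2 * pi else 0).
have sz : size (star d) = #|porbit nxt d| by rewrite size_map size_traject.
have p0 := @pi_gt0 R.
have nthE i : (i < size (star d))%N -> nth (org d) (star d) i = trg (iter i nxt d).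
  by rewrite sz => h; rewrite (nth_map d) ?size_traject // nth_traject.
have oi i : org (iter i nxt d) = org d.
  by rewrite -permX; exact: rotationX_o.
have inj i j : (i < size (star d))%N -> (j < size (star d))%N ->
    iter i nxt d = iter j nxt d -> i = j.
  rewrite sz => hi hj h; apply/eqP.
  by rewrite -(nth_uniq d _ _ (uniq_traject_porbit nxt d)) ?size_traject // !nth_traject // h.
have step i : (i.+1 < size (star d))%N -> rep (iter i nxt d) < rep (iter i.+1 nxt d).
  move=> hi; rewrite iterS; set x := iter i nxt d.
  have ox : org x = org d by exact: oi.
  have nd : nxt x != d.
    apply/eqP => h; have := inj i.+1 0%N hi (leq_trans _ hi) h.
    by move=> /(_ isT).
  have nt : th (nxt x) != th d by apply: angle_neq; rewrite // rotation_o ox.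
  have : (th x < th (nxt x) /\
     (forall g, org g = org x -> (th g <= th x) || (th (nxt x) <= th g))) \/
    (forall g, org g = org x -> th (nxt x) <= th g <= th x) := rotation_next angle_neq x.
  case=> [[h1 h2]|h].
    have := h2 d (esym ox); rewrite /rep => /orP[h3|h3].
      have e1 : (th x < th d) = false by rewrite ltNge h3.
      have e2 : (th (nxt x) < th d) = false by rewrite ltNge (le_trans h3 (ltW h1)).
      by rewrite e1 e2 !addr0.
    have h4 : th (nxt x) < th d by rewrite lt_neqAle nt h3.
    by rewrite h4 (lt_trans h1 h4) ltrD2r.
  have /andP[h1 h2] := h d (esym ox).
  have h4 : th (nxt x) < th d by rewrite lt_neqAle nt h1.
  have e1 : (th x < th d) = false by rewrite ltNge h2.
  rewrite /rep h4 e1 addr0.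
  by have := th_itv x; have := th_itv (nxt x); lra.
exists (fun i => rep (iter i nxt d)); split.
- move=> i j /andP[ij js]; elim: j ij js => // j IH.
  rewrite ltnS leq_eqVlt => /orP[/eqP -> | ij] js.
    exact: step.
  exact: lt_trans (IH ij (ltnW js)) (step _ js).
- move=> i hi; have e0 : rep (iter 0 nxt d) = th d by rewrite /rep /= ltxx addr0.
  rewrite e0 /rep; have := th_itv (iter i nxt d); have := th_itv d.
  by case: (ltP (th (iter i nxt d)) (th d)) => h; lra.
move=> i hi; rewrite nthE //.
have := exit_leaves (tm_exit (iter i nxt d)); rewrite oi.
rewrite /rep; case: ifP => _; rewrite ?addr0 // => -[t t01 [ht hs]].
by exists t => //; split => //; rewrite ht /circle_point mulr_natl cosD2pi sinD2pi.
Qed.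

End Drawn.

Lemma stars_size : all (fun s => (size s == 5%N) && all (fun k => N.leb k 36) s) stars.
Proof. by vm_compute. Qed.

Lemma covered_star (x : seq N) : size x = 5%N -> covered x ->
  exists2 s, s \in stars & exists2 j, (j < 5)%N &
    all2 N.leb (rot j x) s \/ all2 N.leb (rev (rot j x)) s.
Proof.
move=> x5 /hasP[t /flattenP[_ /mapP[s sS ->]] + xt].
have /andP[/eqP s5 _] := allP stars_size s sS.
case: x x5 xt => [|x0 [|x1 [|x2 [|x3 [|x4 []]]]]] // _ xt.
case: s sS s5 => [|s0 [|s1 [|s2 [|s3 [|s4 []]]]]] // sS _.
have fin b1 b2 b3 b4 b5 : is_true b1 -> is_true b2 -> is_true b3 -> is_true b4 -> is_true b5 ->
  [&& b1, b2, b3, b4, b5 & true].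
  by move=> -> -> -> -> ->.
rewrite mem_cat => /orP[] /mapP[i + tE]; rewrite {}tE {t} in xt *; rewrite !inE => ic;
  exists [:: s0; s1; s2; s3; s4] => //;
  [exists ((5 - i) %% 5)%N; first (by rewrite ltn_mod); left
  |exists i; first (by case/or4P: ic => [|||/orP[]] /eqP ->); right];
  by case/or4P: ic xt => [|||/orP[]] /eqP -> /and5P[h0 h1 h2 h3 /andP[h4 _]]; apply: fin.
Qed.

Definition bound_of (k : N) : degree_bound := if N.eqb k 36 then Unbounded else N.to_nat k.

Lemma ru_at_most d k : N.leb k 36 -> N.leb (ru d) k -> at_most d (bound_of k).
Proof.
move=> /N.leb_spec0 k36 /N.leb_spec0; rewrite /bound_of; case: N.eqb_spec => //= k0.
rewrite /ru; case: (leqP d 5) => h5; first by lia.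
case: (leqP d 15) => h15; first by lia.
by case: (leqP d 17) => h17; [lia|case: (leqP d 35) => ?; lia].
Qed.

Section Conclusion.
Variables (R : realType) (G : sgraph) (E : plane_embedding R G).
Hypothesis hmin : has_min_degree G 5.

Lemma radius_ex : exists2 r, small E r & forall v (s : 5.-tuple G),
  uniq s -> (forall w, w \in s -> adj v w) ->
  forall r', 0 < r' <= r -> ordered_exits E v r s -> ordered_exits E v r' s.
Proof.
have [r0 r00 h0] := small_ex E.
pose P (p : G * 5.-tuple G) r := uniq p.2 -> (forall w, w \in p.2 -> adj p.1 w) ->
  forall r', 0 < r' <= r -> ordered_exits E p.1 r p.2 -> ordered_exits E p.1 r' p.2.
have [r1 r10 h1] : exists2 e, 0 < e & forall p r, 0 < r <= e -> P p r.
  apply: fin_pos => -[v s].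
  have [us|nu] := boolP (uniq s); last by exists 1 => // r _; rewrite /P /= (negbTE nu).
  case: (pselect (forall w, w \in s -> adj v w)) => [sv|nsv]; last by exists 1 => // r _ _ /nsv.
  have [r1 r10 h1] := exits_consistent E us sv; exists r1 => // r /andP[r_gt0 rr1]
    _ _ r' /andP[r'0 r'r].
  by apply: h1; rewrite ?r_gt0 ?r'0 //= (le_trans r'r).
have m0 : 0 < Num.min r0 r1 by rewrite lt_min r00.
exists (Num.min r0 r1); first by apply: h0; rewrite m0 ge_min lexx.
by move=> v s us sv; apply: (h1 (v, s)); rewrite // m0 ge_min lexx orbT.
Qed.

Lemma star_embedding : exists v (l : 5.-tuple G),
  [/\ degree v = 5%N, covered [seq ru (degree w) | w <- l] &
      forall j, (j < 5)%N -> ccw_neighbors E v (rot j l)].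
Proof.
have [r sr stable] := radius_ex.
pose exit (d : dart G) (q : R * R) := [/\ 0 <= q.1 < 2 * pi,
    exit_at E (org d) (trg d) r q.1 q.2 & q.2 < 2^-1].
have [p hp] : {p : dart G -> R * R & forall d, exit d (p d)}.
  by apply: boolp.choice => d; have [a [t h]] := exit_ex sr (dart_adj d); exists (a, t).
pose th d := (p d).1.
pose tm d := (p d).2.
have th_itv d : 0 <= th d < 2 * pi by case: (hp d).
have tm_exit d : exit_at E (org d) (trg d) r (th d) (tm d) by case: (hp d).
have tm_half d : tm d < 2^-1 by case: (hp d).
case: hmin => deg5 [v0 v05].
have D0 : (0 < #|dart G|)%N.
  have : (0 < #|[set d : dart G | org d == v0]%SET|)%N by rewrite card_darts v05.
  by move/leq_trans; apply; exact: max_card.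
have pl := embedding_planar sr th_itv tm_exit tm_half D0.
pose n := nxt th; pose e := flp G.
have nO d : org (n d) = org d by exact: rotation_o.
have eE d : e d = flip d by rewrite permE.
have n5 d : (5 <= #|porbit n d|)%N.
  by rewrite card_porbit_nxt.
have nd d : n d != d.
  by apply/eqP => h; have := n5 d; rewrite porbit_fix // cards1.
have eK d : e (e d) = d by rewrite !eE flipK.
have e1 d : e d != d.
  by rewrite eE; apply/eqP => /(congr1 (@org G)) /eqP; rewrite org_flip (negbTE (org_neq_trg d)).
have g1 d : e (n d) != d.
  rewrite eE; apply/eqP => /(congr1 (@org G)) /eqP.
  by rewrite org_flip -nO (negbTE (org_neq_trg _)).
have g2 d : e (n (e (n d))) != d.
  rewrite !eE; apply/eqP => h; case/eqP: (nd (flip (n d))).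
  have := congr1 (@org G) h; have := congr1 (@trg G) h; rewrite !org_flip !trg_flip => h1 h2.
  by apply: dart_eq; rewrite ?nO // h2 trg_flip nO.
have eg : (n * e)%g = ((flp G) * n^-1)^-1%g.
  rewrite invMg invgK; congr (_ * _)%g; apply/perm.permP => d.
  by apply: (canRL (permK _)); exact: eK.
have [h h5 cov] : exists2 h, #|porbit n h| = 5%N & covered (star_at e n h).
  by apply: map_star => //; rewrite eg porbitsV; exact: pl.
have dh : degree (org h) = 5%N by rewrite -h5 card_porbit_nxt.
have st d : org d = org h -> star th d =
    [:: trg d; trg (n d); trg (n (n d)); trg (n (n (n d))); trg (n (n (n (n d))))].
  by move=> od; rewrite /star card_porbit_nxt od dh.
have it i : org (iter i n h) = org h by elim: i => //= i IH; rewrite nO.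
pose l := [tuple of [:: trg h; trg (n h); trg (n (n h)); trg (n (n (n h))); trg (n (n (n (n h))))]].
exists (org h), l; split => //.
  move: cov; rewrite /star_at /l /= /deg !eE.
  by rewrite !card_porbit_nxt !org_flip.
move=> j j5; have -> : rot j l = star th (iter j n h).
  have nh := next5 h5.
  by case: j j5 => [|[|[|[|[|]]]]] // _; rewrite st ?it //= /rot /= ?nh.
set d := iter j n h; split.
- exact: star_uniq.
- by move=> w; rewrite mem_star it.
have szd : size (star th d) == 5%N by rewrite st ?it.
near=> r'.
have := star_exits th_itv tm_exit tm_half d.
rewrite it; apply: (stable _ (Tuple szd)).
- exact: star_uniq.
- by move=> w; rewrite mem_star it.
apply/andP; split; first by near: r'; exact: nbhs_right_gt.
by near: r'; apply: nbhs_right_le; case: sr.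
Unshelve. all: by end_near.
Qed.

Definition bounded_star (s : seq N) : Prop :=
  if s is [:: k1; k2; k3; k4; k5] then
    has_minor_star E (bound_of k1) (bound_of k2) (bound_of k3) (bound_of k4) (bound_of k5)
  else True.

Lemma minor_star : exists2 s, s \in stars & bounded_star s.
Proof.
have [v [l [v5 cov ccw]]] := star_embedding.
have sl : size [seq ru (degree w) | w <- l] = 5%N by rewrite size_map size_tuple.
have [s sS [j j5 hj]] := covered_star sl cov; exists s => //.
have /andP[/eqP s5 /allP k36] := allP stars_size s sS.
have [w [wE w5 ws]] : exists w, [/\ cyclic_neighbors E v w, size w = 5%N &
    all2 N.leb [seq ru (degree x) | x <- w] s].
  case: hj => hj; [exists (rot j l)|exists (rev (rot j l))]; split.
  - by left; exact: ccw.
  - by rewrite size_rot size_tuple.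
  - by rewrite map_rot.
  - by right; rewrite revK; exact: ccw.
  - by rewrite size_rev size_rot size_tuple.
  by rewrite map_rev map_rot.
case: s s5 k36 ws {hj sS} => [|k1 [|k2 [|k3 [|k4 [|k5 []]]]]] // _ k36.
case: w w5 wE => [|v1 [|v2 [|v3 [|v4 [|v5' []]]]]] // _ wE /= /and5P[h1 h2 h3 h4 /andP[h5 _]].
have lek k d : k \in [:: k1; k2; k3; k4; k5] -> N.leb (ru d) k -> at_most d (bound_of k).
  by move=> /k36; exact: ru_at_most.
exists v, v1, v2, v3, v4, v5'; split => //.
by split; apply: lek => //; rewrite !inE eqxx ?orbT.
Qed.

End Conclusion.

Local Open Scope nat_scope.

Theorem theorem1 (R : realType) (G : sgraph) (E : plane_embedding R G)
  (hmin : has_min_degree G 5) :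
  has_minor_star E 5 7 7 5 17 \/
  has_minor_star E 5 7 8 5 11 \/
  has_minor_star E 5 7 5 8 8 \/
  has_minor_star E 8 5 5 11 6 \/
  has_minor_star E 8 5 5 8 7 \/
  has_minor_star E 8 5 5 7 8 \/
  has_minor_star E 8 5 5 6 9 \/
  has_minor_star E 5 6 5 8 11 \/
  has_minor_star E 5 6 6 5 Unbounded \/
  has_minor_star E 5 6 6 6 17 \/
  has_minor_star E 6 6 6 6 11 \/
  has_minor_star E 6 6 6 7 8 \/
  has_minor_star E 6 6 7 6 8 \/
  has_minor_star E 5 6 6 11 7 \/
  has_minor_star E 5 6 11 6 7 \/
  has_minor_star E 5 6 6 8 8 \/
  has_minor_star E 5 6 8 6 8 \/
  has_minor_star E 5 7 6 8 7 \/
  has_minor_star E 5 6 7 7 7 \/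
  has_minor_star E 5 6 6 7 11 \/
  has_minor_star E 5 6 7 6 11 \/
  has_minor_star E 5 7 6 7 8 \/
  has_minor_star E 5 7 7 6 8 \/
  has_minor_star E 5 7 6 6 14 \/
  has_minor_star E 5 8 6 6 11 \/
  has_minor_star E 5 5 7 6 14 \/
  has_minor_star E 5 6 7 5 35 \/
  has_minor_star E 5 6 8 5 15 \/
  has_minor_star E 5 6 9 5 10 \/
  has_minor_star E 5 6 11 5 9 \/
  has_minor_star E 5 5 10 5 12 \/
  has_minor_star E 5 7 11 5 8 \/
  has_minor_star E 5 6 5 7 14 \/
  has_minor_star E 5 5 9 5 17.
Proof.
have [s hs hE] := minor_star E hmin.
move: s hs hE; rewrite /stars => s.
do 33! (rewrite inE; case/predU1P => [-> /= h|]; [by left|move=> hs hE; right; move: hs hE]).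
by rewrite mem_seq1 => /eqP -> /=.
Qed.
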